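(* Let $n\in\mathbb{N}$, $\alpha\in(0,1)$, $p\in\left(\frac{1}{1-\alpha},+\infty\right]$, and let $q\in[1,+\infty)$ with $\frac1p+\frac1q=1$. There exist constants $A_{n,\alpha,p},B_{n,\alpha,p}>0$, depending only on $n,\alpha,p$, such that: if $f\in BV^{\alpha,p}(\mathbb{R}^n)$, then for $|D^\alpha f|$-a.e. $x\in\mathbb{R}^n$ there exists $r_x>0$ such that $$|D^\alpha f|(B_r(x))\le A_{n,\alpha,p}\|f\|_{L^p(\mathbb{R}^n)}\,r^{\frac nq-\alpha}\quad\text{and}\quad|D^\alpha(f\chi_{B_r(x)})|(\mathbb{R}^n)\le B_{n,\alpha,p}\|f\|_{L^p(\mathbb{R}^n)}\,r^{\frac nq-\alpha}$$ for all $r\in(0,r_x)$.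
   Context: $B_r(x)$ is the open ball, $\chi_E$ the indicator of $E$. Let $\mu_{n,\alpha}=2^{\alpha}\pi^{-n/2}\Gamma\left(\frac{n+\alpha+1}{2}\right)/\Gamma\left(\frac{1-\alpha}{2}\right)$ and $\operatorname{div}^\alpha\varphi(x)=\mu_{n,\alpha}\int\frac{(y-x)\cdot(\varphi(y)-\varphi(x))}{|y-x|^{n+\alpha+1}}dy$ for $\varphi\in C^\infty_c(\mathbb{R}^n;\mathbb{R}^n)$. For $g\in L^1(\mathbb{R}^n)$ (or $L^p$), $|D^\alpha g|(\mathbb{R}^n):=\sup\{\int g\operatorname{div}^\alpha\varphi\,dx:\varphi\in C^\infty_c(\mathbb{R}^n;\mathbb{R}^n),\ \|\varphi\|_{L^\infty}\le1\}$, and $BV^{\alpha,p}(\mathbb{R}^n)$ is the set of $f\in L^p(\mathbb{R}^n)$ with $|D^\alpha f|(\mathbb{R}^n)<\infty$; for such $f$, $D^\alpha f$ is the unique finite $\mathbb{R}^n$-valued Radon measure with $\int f\operatorname{div}^\alpha\varphi=-\int\varphi\cdot dD^\alpha f$, and $|D^\alpha f|$ its total variation measure. *)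

(* Defs.v *)
From HB Require Import structures.
From mathcomp Require Import all_boot all_order all_algebra.
From mathcomp Require Import all_classical all_reals all_analysis.
Set Implicit Arguments. Unset Strict Implicit. Unset Printing Implicit Defensive.
Import Order.TTheory GRing.Theory Num.Theory.
Import numFieldNormedType.Exports.
Local Open Scope classical_set_scope.
Local Open Scope ring_scope.

Section FracBV.
Variable R : realType.

Definition dotv n (u v : 'rV[R]_n) : R := \sum_i u ord0 i * v ord0 i.
Definition enorm n (v : 'rV[R]_n) : R := Num.sqrt (dotv v v).
Definition eball n (x : 'rV[R]_n) (r : R) : set 'rV[R]_n :=
  [set y | enorm (y - x) < r].

Fixpoint itint (m : nat) (h : (nat -> R) -> \bar R) : \bar R :=
  match m with
  | 0 => h (fun _ => 0)
  | S k => itint k (fun c =>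
      (\int[@lebesgue_measure R]_x h (fun j => if j == k then x else c j))%E)
  end.

Definition Lint n (g : 'rV[R]_n -> \bar R) : \bar R :=
  itint n (fun c => g (\row_(i < n) c (nat_of_ord i))).

Definition Rint n (g : 'rV[R]_n -> R) : R := fine (Lint (fun x => (g x)%:E)).

Definition lebn n (A : set 'rV[R]_n) : \bar R := Lint (fun x => (\1_A x)%:E).

Definition borel_rV n (A : set 'rV[R]_n) : Prop := <<s (@open 'rV[R]_n) >> A.
Definition borel_fun n (f : 'rV[R]_n -> R) : Prop :=
  forall B : set R, measurable B -> borel_rV (f @^-1` B).

Definition Lpnorm n (p : \bar R) (f : 'rV[R]_n -> R) : \bar R :=
  match p with
  | r%:E => ((Lint (fun x => (`|f x| `^ r)%:E)) `^ r^-1)%E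
  | +oo%E => ereal_inf [set M : \bar R |
                lebn [set x | (M < (`|f x|)%:E)%E] = 0%E]
  | -oo%E => 0%E
  end.

Definition Gamma (s : R) : R :=
  fine (\int[@lebesgue_measure R]_(t in `]0%R, +oo[%classic)
          ((t `^ (s - 1)) * expR (- t))%:E)%E.

Definition mu_const (n : nat) (alpha : R) : R :=
  2 `^ alpha * (pi `^ (- (n%:R / 2))) *
  Gamma ((n%:R + alpha + 1) / 2) / Gamma ((1 - alpha) / 2).

Fixpoint Ck n m (k : nat) (f : 'rV[R]_n -> 'rV[R]_m) : Prop :=
  match k with
  | 0 => continuous f
  | S k' => continuous f /\
      forall v : 'rV[R]_n, (forall x, derivable f x v) /\
                           Ck k' (fun x => 'D_v f x)
  end.
Definition smooth n m (f : 'rV[R]_n -> 'rV[R]_m) : Prop := forall k, Ck k f.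

Definition test_field n (U : set 'rV[R]_n) (phi : 'rV[R]_n -> 'rV[R]_n) : Prop :=
  [/\ smooth phi,
      exists K, [/\ compact K, K `<=` U & forall x, ~ K x -> phi x = 0]
    & forall x, enorm (phi x) <= 1].

Definition frac_div n (alpha : R) (phi : 'rV[R]_n -> 'rV[R]_n) (x : 'rV[R]_n) : R :=
  mu_const n alpha *
  Rint (fun y => dotv (y - x) (phi y - phi x) /
                 (enorm (y - x)) `^ (n%:R + alpha + 1)).

(* total fractional variation of f on an open set U:
   sup { int f div^alpha phi : phi in C_c^oo(U;R^n), ||phi||_oo <= 1 }.
   For U = R^n this is |D^alpha f|(R^n); for open U it equals |D^alpha f|(U). *)
Definition frac_var n (alpha : R) (f : 'rV[R]_n -> R) (U : set 'rV[R]_n) : \bar R :=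
  ereal_sup [set (Rint (fun x => f x * frac_div alpha phi x))%:E
            | phi in test_field U].

Definition BValphap n (alpha : R) (p : \bar R) (f : 'rV[R]_n -> R) : Prop :=
  [/\ borel_fun f, (Lpnorm p f < +oo)%E & (frac_var alpha f setT < +oo)%E].

(* |D^alpha f|-null sets (outer regularity of the Radon measure |D^alpha f|) *)
Definition var_null n (alpha : R) (f : 'rV[R]_n -> R) (N : set 'rV[R]_n) : Prop :=
  forall eps : R, 0 < eps ->
    exists U, [/\ open U, N `<=` U & (frac_var alpha f U <= eps%:E)%E].

Definition var_ae n (alpha : R) (f : 'rV[R]_n -> R) (P : 'rV[R]_n -> Prop) : Prop :=
  exists N, var_null alpha f N /\ forall x, ~ N x -> P x.

End FracBV.

(* Main.v *)
Require Import Defs.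
From HB Require Import structures.
From mathcomp Require Import all_boot all_order all_algebra.
From mathcomp Require Import all_classical all_reals all_analysis.
From mathcomp Require Import measurable_realfun ess_sup_inf ring lra.
Import Order.TTheory GRing.Theory Num.Theory.
Import numFieldNormedType.Exports.
Set Implicit Arguments. Unset Strict Implicit. Unset Printing Implicit Defensive.
Local Open Scope classical_set_scope.
Local Open Scope ring_scope.

(**
Write [T phi] for the integral of [f div^alpha phi] and [V U] for the total
fractional variation of [f] on [U]. No measure [D^alpha f] is constructed: the
argument only uses that [T] is linear and that [V] is a supremum of values of [T].

A Leibniz-type identity and Tonelli's theorem bound [T (eta v)], for a radial
cutoff [eta] of radius [r] and a constant vector [v], by a double integral of
[|f x| |eta (x + z) - eta x| / |z|^(n + alpha)]. Hoelder's inequality in [x] and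
[int |eta (x + z) - eta x| dx <= C r^n min(|z| / r, 1)] turn it into
[C ||f||_p r^(n/q - alpha)]; the remaining integral in [z] converges because
[alpha q < 1]. The same estimate controls [T_(f eta) phi - T_f (eta phi)], so that
the second inequality follows from the first one by letting [eta] increase to
the indicator of the ball.

For the first inequality, call [x] bad if [V (B_r x) > A ||f||_p r^(n/q - alpha)]
for arbitrarily small [r]. As [n/q - alpha < n] and [V] is finite, a bad point has
arbitrarily small radii [s] for which this holds and [V (B_12s x) <= 12^n V (B_s x)].
Take a test field [phi] with [T phi] within [d] of the supremum. On a ball of that
kind [phi] is almost constant, hence [T (eta phi)] is at most a quarter of
[V (B_s x)], and replacing [phi] on finitely many disjoint such balls by nearly
optimal fields shows that the sum of the [V (B_s x)] is at most [4 d]. With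
Vitali's covering lemma for finite families, the bad points are covered by an
open set of variation at most [4 * 12^n * d].
*)

(** * Lebesgue measure on sequences supported in the first coordinates *)

(** The assumption [p > 1 / (1 - alpha)] says exactly that [alpha < 1 / q]. The L^1 modulus of
    continuity of an indicator is only linear in [|z|], so Hoelder's inequality leaves [|z|^(1/q)]
    against the singularity [|z|^(-n - alpha)]: this is the origin of the threshold. In the second
    inequality the cutoffs become arbitrarily steep, so the modulus bound may use no derivative of
    [eta]. It rests only on the monotonicity of the radial profile and its values in [0, 1], hence
    one constant serves all cutoffs of a given radius.

    The usual route to the first inequality differentiates a measure and uses its polar vector. Here
    one nearly optimal field replaces that vector: being Lipschitz, it is almost constant on all
    small balls at once. Splitting fields by cutoffs replaces additivity, at the price of doubled
    radii. Accordingly 12 is 2 times 6: the covering lemma for doubled balls gives 6, and one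
    further splitting gives 2.

    The integrals of the statement are iterated one-dimensional integrals. They are first identified
    with integrals for a measure, so that Tonelli's theorem and dominated convergence apply. *)

Section SigmaFiniteOf.
Context d (T : measurableType d) (R : realType).
(** An alias indexed by the proof [h], to which the sigma-finite structure can be attached; products
    of measures ask for that structure. *)
Definition sfm_fun (m : {measure set T -> \bar R}) (h : sigma_finite setT m) :
  set T -> \bar R := m.
Section inst.
Variables (m : {measure set T -> \bar R}) (h : sigma_finite setT m).
HB.instance Definition _ := Measure.on (sfm_fun h).
HB.instance Definition _ := Measure_isSigmaFinite.Build _ _ _ (sfm_fun h) h.
End inst.
Definition sfm (m : {measure set T -> \bar R}) (h : sigma_finite setT m)
  : {sigma_finite_measure set T -> \bar R} := sfm_fun h.
End SigmaFiniteOf.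

Section SeqMeasure.
Variable R : realType.
Local Notation lam := (@lebesgue_measure R).

(** Generators of the cylinder sigma-algebra. Whole sequences are used because [itint] evaluates its
    integrand at sequences, with 0 in the coordinates that are not integrated. *)
Definition coord_sets : set (set (nat -> R)) :=
  [set A | exists i (B : set R), measurable B /\ A = (fun c => c i) @^-1` B].
Definition seqR : measurableType (sigma_display coord_sets) :=
  g_sigma_algebraType coord_sets.

Lemma measurable_coord (i : nat) : measurable_fun setT (fun c : seqR => c i).
Proof.
move=> _ B mB; rewrite setTI; apply: sub_gen_smallest.
by exists i, B.
Qed.

Lemma measurable_fun_seqR d (S : measurableType d) (F : S -> seqR) :
  (forall i, measurable_fun setT (fun s => F s i)) -> measurable_fun setT F.
Proof.
move=> mF; apply: (@measurability _ _ S seqR setT F coord_sets) => //.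
move=> _ [_ [i [B [mB ->]]] <-]; exact: mF.
Qed.

Definition upd (k : nat) (p : seqR * R) : seqR :=
  fun j => if j == k then p.2 else p.1 j.

Lemma measurable_upd k : measurable_fun setT (upd k).
Proof.
apply: measurable_fun_seqR => i; rewrite /upd; case: (i == k).
  exact: measurable_snd.
exact: (measurableT_comp (measurable_coord i) measurable_fst).
Qed.

Definition cbox (k : nat) (N : R) : set seqR :=
  [set c | forall i, (i < k)%N -> `|c i| <= N].

Lemma measurable_cbox k N : measurable (cbox k N).
Proof.
elim: k => [|k IH].
  suff -> : cbox 0 N = setT by [].
  by apply/seteqP; split => // c _ i; rewrite ltn0.
have -> : cbox k.+1 N = cbox k N `&` ((fun c : seqR => c k) @^-1` `[-N, N]).
  apply/seteqP; split => [c /= h|c /= [h1 h2] i].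
    split; first by move=> i ik; apply: h; rewrite ltnW.
    by rewrite in_itv/= -ler_norml; apply: h.
  rewrite ltnS leq_eqVlt => /orP[/eqP ->|]; last exact: h1.
  by move: h2; rewrite in_itv/= -ler_norml.
apply: measurableI => //; rewrite -[X in measurable X]setTI.
exact: measurable_coord.
Qed.

Lemma bigcup_cbox k : \bigcup_N cbox k N%:R = setT.
Proof.
apply/seteqP; split => // c _.
elim: k => [|k [N _ hN]]; first by exists 0%N => // i; rewrite ltn0.
exists (maxn N (Num.truncn `|c k|).+1) => // i; rewrite ltnS leq_eqVlt.
move=> /orP[/eqP ->|ik].
  apply: (@le_trans _ _ ((Num.truncn `|c k|).+1)%:R).
    by apply/ltW; exact: truncnS_gt.
  by rewrite ler_nat leq_maxr.
by apply: (le_trans (hN _ ik)); rewrite ler_nat leq_maxl.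
Qed.

(** Invariant of the construction: a pushforward of a sigma-finite measure need not be sigma-finite,
    but finiteness on boxes survives the step from [k] to [k.+1] and implies sigma-finiteness. *)
Definition boxfinite k (m : set seqR -> \bar R) :=
  forall N : R, (m (cbox k N) < +oo)%E.

Definition stepm k (m : {sigma_finite_measure set seqR -> \bar R}) :
    {measure set seqR -> \bar R} :=
  @measure_function_pushforward__canonical__measure_function_Measure
    _ _ _ _ _ (m \x lam)%E _ (measurable_upd k).

Lemma stepmE k m A : stepm k m A = (m \x lam)%E (upd k @^-1` A).
Proof. by []. Qed.

Lemma upd_cbox k N : upd k @^-1` cbox k.+1 N = cbox k N `*` `[-N, N].
Proof.
apply/seteqP; split => [[c x]/= h|[c x] [/= h1 h2] i].
  split => /=; last by have := h _ (ltnSn k); rewrite /upd eqxx/= in_itv/= -ler_norml.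
  by move=> i ik; have := h i (ltnW ik); rewrite /upd (ltn_eqF ik).
rewrite /upd ltnS leq_eqVlt; case: eqP => [-> _|_] /=; last exact: h1.
by move: h2; rewrite in_itv/= -ler_norml.
Qed.

Lemma boxfinite_stepm k (m : {sigma_finite_measure set seqR -> \bar R}) :
  boxfinite k m -> boxfinite k.+1 (stepm k m).
Proof.
move=> mfin N; rewrite stepmE upd_cbox product_measure1E//=; last first.
  exact: measurable_cbox.
rewrite lte_mul_pinfty//.
- by rewrite ge0_fin_numE// mfin.
- by rewrite lebesgue_measure_itv/=; case: ifP => // _; rewrite -EFinB ltry.
Qed.

Lemma boxfinite_sigma_finite k (m : {measure set seqR -> \bar R}) :
  boxfinite k m -> sigma_finite setT m.
Proof.
move=> mfin; exists (fun N => cbox k N%:R); first by rewrite bigcup_cbox.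
by move=> i; split => //; exact: measurable_cbox.
Qed.

Lemma boxfinite_dirac : boxfinite 0 (dirac ((fun _ => 0) : seqR)).
Proof.
move=> N; rewrite -ge0_fin_numE//; apply: fin_num_measure.
Qed.

(** The measure travels with its invariant, since the next product can only be formed once
    sigma-finiteness is known. *)
Definition seqmeas_sig (k : nat) :
  {m : {sigma_finite_measure set seqR -> \bar R} | boxfinite k m} :=
  nat_rect (fun k => {m : {sigma_finite_measure set seqR -> \bar R} | boxfinite k m})
    (exist _ (dirac ((fun _ => 0) : seqR) : {sigma_finite_measure set seqR -> \bar R})
      (@boxfinite_dirac))
    (fun k m => exist _ (sfm (boxfinite_sigma_finite (boxfinite_stepm (proj2_sig m))))
                   (boxfinite_stepm (proj2_sig m))) k.

Definition seqmeas k : {sigma_finite_measure set seqR -> \bar R} :=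
  proj1_sig (seqmeas_sig k).

Lemma seqmeas0 A : seqmeas 0 A = dirac ((fun _ => 0) : seqR) A.
Proof. by []. Qed.

Lemma seqmeasS k A : seqmeas k.+1 A = (seqmeas k \x lam)%E (upd k @^-1` A).
Proof. by []. Qed.

Lemma ge0_integral_seqmeasS k (h : seqR -> \bar R) :
  measurable_fun setT h -> (forall c, 0 <= h c)%E ->
  (\int[seqmeas k.+1]_c h c = \int[seqmeas k]_c \int[lam]_x h (upd k (c, x)))%E.
Proof.
move=> mh h0.
transitivity (\int[stepm k (seqmeas k)]_c h c)%E.
  exact: eq_measure_integral.
rewrite ge0_integral_pushforward//; last exact: measurable_upd.
rewrite preimage_setT fubini_tonelli1//=.
exact: (measurableT_comp mh (measurable_upd k)).
Qed.

Lemma integral_seqmeasS k (h : seqR -> \bar R) :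
  (seqmeas k.+1).-integrable setT h ->
  (\int[seqmeas k.+1]_c h c = \int[seqmeas k]_c \int[lam]_x h (upd k (c, x)))%E
  /\ (seqmeas k).-integrable setT (fun c => \int[lam]_x h (upd k (c, x)))%E.
Proof.
move=> /integrableP[mh hfin].
have ih : (seqmeas k \x lam)%E.-integrable setT (h \o upd k).
  have := @integrable12ltyP _ _ _ _ _ (seqmeas k) lam (h \o upd k).
  case; first exact: (measurableT_comp mh (measurable_upd k)).
  move=> _; apply.
  have mah : measurable_fun setT (abse \o h) by exact: measurableT_comp.
  by have /= <- := ge0_integral_seqmeasS k mah (fun=> abse_ge0 _).
split; last exact: (integrable_fubini_F ih).
transitivity (\int[stepm k (seqmeas k)]_c h c)%E.
  exact: eq_measure_integral.
rewrite /stepm/= integral_pushforward//; first by rewrite preimage_setT -integral12_prod_meas1.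
exact: measurable_upd.
Qed.

Lemma measurable_integral_upd k (h : seqR -> \bar R) :
  measurable_fun setT h -> (forall c, 0 <= h c)%E ->
  measurable_fun setT (fun c => \int[lam]_x h (upd k (c, x)))%E.
Proof.
move=> mh h0; apply: (@measurable_fun_fubini_tonelli_F _ _ _ _ _ lam (h \o upd k)).
  exact: (measurableT_comp mh (measurable_upd k)).
by move=> c; exact: h0.
Qed.

(** The recursion of [itint] is Tonelli's formula for [seqmeas], one coordinate at a time. *)
Lemma ge0_itintE n (h : seqR -> \bar R) :
  measurable_fun setT h -> (forall c, 0 <= h c)%E ->
  itint n h = (\int[seqmeas n]_c h c)%E.
Proof.
elim: n h => [|n IH] h mh h0 /=.
  by rewrite integral_dirac// diracT mul1e.
rewrite ge0_integral_seqmeasS// -IH//=; first exact: measurable_integral_upd.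
by move=> c; exact: integral_ge0.
Qed.

Lemma integrable_itintE n (h : seqR -> \bar R) :
  (seqmeas n).-integrable setT h -> itint n h = (\int[seqmeas n]_c h c)%E.
Proof.
elim: n h => [|n IH] h ih /=.
  by rewrite integral_dirac ?diracT ?mul1e//; exact: measurable_int ih.
by have [-> /IH <-] := integral_seqmeasS ih.
Qed.

(** * Translation invariance *)

Lemma lebesgue_measure_shift (a : R) (A : set R) : measurable A ->
  lam ((fun x => x + a) @^-1` A) = lam A.
Proof.
have ma : measurable_fun setT ((fun x => x + a) : R -> measurableTypeR R).
  exact: measurable_funD.
move=> mA; apply/esym.
apply: (@lebesgue_measure_unique _
  (@measure_function_pushforward__canonical__measure_function_Measure
    _ _ _ _ _ lam _ ma)) => //= _ [[x y]] _ <-.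
rewrite /pushforward.
have -> : (fun x0 => x0 + a) @^-1` `]x, y] = `]x - a, y - a]%classic.
  by apply/seteqP; split => z; rewrite /= !in_itv/= ltrBlDr lerBrDr.
rewrite !lebesgue_measure_itv/= !lte_fin ltrD2r; case: ifP => // _.
by rewrite -!EFinD; congr EFin; ring.
Qed.

Lemma ge0_integral_shift (a : R) (g : R -> \bar R) :
  measurable_fun setT g -> (forall x, 0 <= g x)%E ->
  (\int[lam]_x g (x + a)%R = \int[lam]_x g x)%E.
Proof.
move=> mg g0.
have ma : measurable_fun setT ((fun x => x + a) : R -> measurableTypeR R).
  exact: measurable_funD.
have := @ge0_integral_pushforward _ _ (measurableTypeR R) (measurableTypeR R) R
  _ ma lam setT g measurableT mg (fun x _ => g0 x).
rewrite preimage_setT => <-.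
by apply: eq_measure_integral => A mA _; exact: lebesgue_measure_shift.
Qed.

(** Only the coordinates below [n] move: in the others [seqmeas n] is a Dirac mass at 0, which is
    not translation invariant. *)
Definition cshift n (z c : seqR) : seqR := fun j => if (j < n)%N then c j + z j else c j.

Lemma measurable_cshift n z : measurable_fun setT (cshift n z).
Proof.
apply: measurable_fun_seqR => i; rewrite /cshift; case: (i < n)%N.
  by apply: measurable_funD => //; exact: measurable_coord.
exact: measurable_coord.
Qed.

Lemma ge0_integral_cshift n z (h : seqR -> \bar R) :
  measurable_fun setT h -> (forall c, 0 <= h c)%E ->
  (\int[seqmeas n]_c h (cshift n z c) = \int[seqmeas n]_c h c)%E.
Proof.
elim: n h => [|n IH] h mh h0 //.
have mhs : measurable_fun setT (h \o cshift n.+1 z).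
  exact: (measurableT_comp mh (measurable_cshift n.+1 z)).
apply: (eq_trans (ge0_integral_seqmeasS n mhs (fun=> h0 _))).
apply: (eq_trans _ (esym (ge0_integral_seqmeasS n mh h0))).
have mh' := measurableT_comp mh (measurable_upd n).
apply: (eq_trans _ (IH _ _ _)); first last.
- by move=> c; apply: integral_ge0.
- exact: measurable_integral_upd.
apply: eq_integral => c _ /=.
have mg : measurable_fun setT ((h \o upd n) \o pair (cshift n z c)).
  by apply: (measurableT_comp mh'); exact: measurable_pair1.
apply: (eq_trans _ (ge0_integral_shift (z n) mg (fun=> h0 _))).
apply: eq_integral => x _; congr h; apply/funext => j.
rewrite /cshift /upd /=; case: (ltngtP j n) => [jn|jn|->].
- by rewrite ltnS (ltnW jn).
- by rewrite ltnS leqNgt jn.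
- by rewrite ltnSn.
Qed.

Lemma seqmeas_box n (a b : nat -> R) : (forall i, a i <= b i) ->
  seqmeas n [set c : seqR | forall i, (i < n)%N -> a i <= c i <= b i]
  = (\prod_(i < n) (b i - a i))%:E.
Proof.
move=> ab; elim: n => [|n IH].
  rewrite seqmeas0 big_ord0 (_ : [set c | _] = setT) ?diracT//.
  by apply/seteqP; split => // c _ i.
rewrite seqmeasS big_ord_recr/= EFinM -IH.
set A := [set c : seqR | forall i, (i < n)%N -> _].
rewrite (_ : _ @^-1` _ = A `*` `[a n, b n]%classic); last first.
  apply/seteqP; split => [[c x]/= h|[c x] [/= h1 h2] i].
    split => /=; last by have := h _ (ltnSn n); rewrite /upd eqxx/= in_itv/=.
    by move=> i ik; have := h i (ltnW ik); rewrite /upd (ltn_eqF ik).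
  rewrite /upd ltnS leq_eqVlt; case: eqP => [-> _|_] /=; last exact: h1.
  by move: h2; rewrite in_itv.
have mA : measurable A.
  rewrite {}/A; clear IH; elim: n => [|n IH].
    rewrite (_ : [set c | _] = setT)//.
    by apply/seteqP; split => // c _ i.
  rewrite (_ : [set c : seqR | _] = [set c : seqR | forall i, (i < n)%N -> a i <= c i <= b i] `&`
      ((fun c : seqR => c n) @^-1` `[a n, b n])).
    apply: measurableI => //; rewrite -[X in measurable X]setTI.
    exact: measurable_coord.
  apply/seteqP; split => [c /= h|c /= [h1 h2] i].
    split; first by move=> i ik; apply: h; rewrite ltnW.
    by rewrite in_itv/=; apply: h.
  by rewrite ltnS leq_eqVlt => /orP[/eqP ->|]; [move: h2; rewrite in_itv/=|exact: h1].
rewrite product_measure1E//=; congr (_ * _)%E.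
rewrite lebesgue_measure_itv/= lte_fin; case: ifPn => [//|].
by rewrite -leNgt => ba; congr EFin; apply/esym/eqP; rewrite subr_eq0 eq_le ba ab.
Qed.

End SeqMeasure.

(** * Lebesgue measure on row vectors *)

Section BorelRow.
Variables (R : realType) (n : nat).
Local Notation rV := 'rV[R]_n.

(** Row vectors with the sigma-algebra of [borel_rV], so that [borel_fun] is measurability by
    definition. *)
Definition rVb : measurableType (sigma_display (@open rV)) :=
  g_sigma_algebraType (@open rV).

Lemma open_measurable_rV (U : set rVb) : @open rV U -> measurable U.
Proof. by move=> oU; exact: sub_gen_smallest. Qed.

Lemma continuous_measurable_rV (g : rV -> R) :
  continuous g -> measurable_fun [set: rVb] g.
Proof.
move=> /continuousP cg; apply: (measurability _ (RGenOpens.measurableE R)).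
move=> _ [_ [a [b ->] <-]]; rewrite setTI; apply: open_measurable_rV.
exact/cg/interval_open.
Qed.

Lemma measurable_rV_coord i : measurable_fun [set: rVb] (fun v : rV => v ord0 i).
Proof. by apply: continuous_measurable_rV; exact: coord_continuous. Qed.

(** Second countability in the form used next: an open set is a union of countably many balls with
    rational centre and radius [1 / (m + 1)]. It makes coordinatewise measurable maps measurable for
    the sigma-algebra of the open sets. *)
Lemma rat_ball_cover (U : set rV) (x : rV) : open U -> U x ->
  exists (q : 'rV[rat]_n) (m : nat),
    ball (map_mx (@ratr R) q) m.+1%:R^-1 `<=` U /\
    ball (map_mx (@ratr R) q) m.+1%:R^-1 x.
Proof.
move=> oU Ux.
have /nbhs_ballP[e /= e0 eU] : nbhs x U by exact: open_nbhs_nbhs.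
pose m := Num.truncn (2 / e).
have m0 : 0 < (m.+1%:R^-1 : R) by rewrite invr_gt0.
have me : m.+1%:R^-1 < e / 2.
  rewrite -[e / 2]invrK ltf_pV2 ?posrE ?invr_gt0 ?divr_gt0// invf_div.
  exact: truncnS_gt.
have H (i : 'I_n) : exists q : rat, `|ratr q - x ord0 i| < m.+1%:R^-1.
  have /rat_in_itvoo[q qi] : x ord0 i - m.+1%:R^-1 < x ord0 i + m.+1%:R^-1.
    by rewrite ltrBlDr -addrA ltrDl addr_gt0.
  exists q; move: qi; rewrite in_itv/= => /andP[q1 q2].
  by rewrite ltr_norml ltrBrDl q1 ltrBlDl q2.
exists (\row_i projT1 (cid (H i))), m.
have bx : ball (map_mx ratr (\row_i projT1 (cid (H i))) : rV) m.+1%:R^-1 x.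
  split => // i j; rewrite (ord1 i) !mxE /ball/=.
  exact: projT2 (cid (H j)).
split=> // y [_ by_]; apply: eU; apply: (@le_ball _ _ x (m.+1%:R^-1 + m.+1%:R^-1)).
  by rewrite [e]splitr; apply: lerD; exact: ltW.
by apply: ball_triangle; [apply: ball_sym; exact: bx|split].
Qed.

Lemma measurable_fun_rV d (S : measurableType d) (F : S -> rVb) :
  (forall i, measurable_fun setT (fun s => (F s : rV) ord0 i)) ->
  measurable_fun setT F.
Proof.
move=> mF; apply: (@measurability _ _ S rVb setT F (@open rV)) => //.
move=> _ [U oU <-]; rewrite setTI.
pose B (k : nat) : set S := match unpickle k with
  | Some (q, m) =>
      if `[< ball (map_mx (@ratr R) q : rV) m.+1%:R^-1 `<=` U >] then
        F @^-1` ball (map_mx (@ratr R) (q : 'rV[rat]_n) : rV) m.+1%:R^-1 else set0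
  | None => set0 end.
have -> : F @^-1` U = \bigcup_k B k.
  apply/seteqP; split => [s /= Us|s [k _]].
    have [q [m [qU qx]]] := rat_ball_cover oU Us.
    exists (pickle (q, m)) => //; rewrite /B pickleK; case: asboolP => // _.
  rewrite /B; case: (unpickle k) => // -[q m]; case: asboolP => // qU; exact: qU.
apply: bigcup_measurable => k _; rewrite /B.
case: (unpickle k) => // -[q m]; case: asboolP => // _.
(* Balls of row vectors refer to the maximum norm, hence are intersections of conditions on single
   coordinates. *)
have -> : F @^-1` ball (map_mx (@ratr R) q : rV) m.+1%:R^-1 =
    \bigcap_(i in [set: 'I_n]) ((fun s => (F s : rV) ord0 i) @^-1` ball (ratr (q ord0 i) : R) m.+1%:R^-1).
  apply/seteqP; split => [s [_ h] i _ /=|s h].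
    by have := h ord0 i; rewrite mxE.
  by split=> // i j; rewrite (ord1 i) mxE; apply: h.
apply: fin_bigcap_measurable => // i _; rewrite -[X in measurable X]setTI.
by apply: mF => //; apply: open_measurable; exact: ball_open.
Qed.

Lemma continuous_measurable_rVb m (g : rV -> 'rV[R]_m) :
  continuous g -> forall i, measurable_fun [set: rVb] (fun x => g x ord0 i).
Proof.
move=> cg i; apply: continuous_measurable_rV => x.
apply: (@continuous_comp _ _ _ g (fun M : 'rV[R]_m => M ord0 i)); first exact: cg.
exact: coord_continuous.
Qed.

Definition rowm (c : seqR R) : rVb := \row_(i < n) c i.

Lemma measurable_rowm : measurable_fun setT rowm.
Proof.
apply: measurable_fun_rV => i; rewrite /rowm.
rewrite (_ : (fun _ => _) = (fun c : seqR R => c i)); first exact: measurable_coord.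
by apply/funext => c; rewrite mxE.
Qed.

Definition lebrV0 : {measure set rVb -> \bar R} :=
  @measure_function_pushforward__canonical__measure_function_Measure
    _ _ _ _ _ (seqmeas R n) _ measurable_rowm.

Definition rbox (a b : 'I_n -> R) : set rVb :=
  [set v | forall i, a i <= (v : rV) ord0 i <= b i].

Lemma measurable_rbox a b : measurable (rbox a b).
Proof.
rewrite (_ : rbox a b = \bigcap_(i in [set: 'I_n])
    ((fun v : rVb => (v : rV) ord0 i) @^-1` `[a i, b i]%classic)).
  apply: fin_bigcap_measurable => // i _; rewrite -[X in measurable X]setTI.
  exact: measurable_rV_coord.
apply/seteqP; split => [v h i _|v h i] /=; first by rewrite in_itv/=; exact: h.
by have /= := h i I; rewrite in_itv.
Qed.

Lemma lebrV0_box (a b : 'I_n -> R) : (forall i, a i <= b i) ->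
  lebrV0 (rbox a b) = (\prod_(i < n) (b i - a i))%:E.
Proof.
move=> ab.
pose ext (f : 'I_n -> R) (k : nat) := if insub k is Some i then f i else 0.
have extE f (i : 'I_n) : ext f i = f i by rewrite /ext valK.
rewrite (_ : lebrV0 _ = seqmeas R n [set c : seqR R | forall i, (i < n)%N -> ext a i <= c i <= ext b i]).
  rewrite seqmeas_box.
    by congr EFin; apply: eq_bigr => i _; rewrite !extE.
  by move=> i; rewrite /ext; case: insubP.
congr (seqmeas R n _); apply/seteqP; split => [c h i ni|c h i].
  by have := h (Ordinal ni); rewrite mxE /= -!extE.
by have := h i (ltn_ord i); rewrite mxE !extE.
Qed.

Lemma lebrV0_sigma_finite : sigma_finite setT lebrV0.
Proof.
exists (fun N => rbox (fun=> - N%:R) (fun=> N%:R)).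
  apply/seteqP; split => // v _.
  exists (Num.truncn (`|v : rV|)).+1 => // i.
  rewrite -ler_norml; apply: (@le_trans _ _ `|v : rV|).
    rewrite [leRHS]mx_normrE.
    by apply: (le_bigmax _ (fun ij => `|(v : rV) ij.1 ij.2|) (ord0, i)).
  by apply/ltW; exact: truncnS_gt.
move=> N; split; first exact: measurable_rbox.
by rewrite lebrV0_box ?ltry// => i; apply: (@le_trans _ _ 0) => //; rewrite oppr_le0.
Qed.

Definition lebrV : {sigma_finite_measure set rVb -> \bar R} :=
  sfm lebrV0_sigma_finite.

Lemma lebrV_box (a b : 'I_n -> R) : (forall i, a i <= b i) ->
  lebrV (rbox a b) = (\prod_(i < n) (b i - a i))%:E.
Proof. exact: lebrV0_box. Qed.

Lemma ge0_LintE (g : rV -> \bar R) : measurable_fun [set: rVb] g ->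
  (forall x, 0 <= g x)%E -> Lint g = (\int[lebrV]_x g x)%E.
Proof.
move=> mg g0.
have mgr : measurable_fun setT (g \o rowm).
  exact: (measurableT_comp mg measurable_rowm).
rewrite /Lint (ge0_itintE n mgr); last by move=> c; exact: g0.
rewrite [RHS](_ : _ = \int[lebrV0]_x g x)%E; last exact: eq_measure_integral.
rewrite [RHS](ge0_integral_pushforward measurable_rowm (seqmeas R n) measurableT mg)//.
Qed.

Lemma integrable_LintE (g : rV -> \bar R) : lebrV.-integrable setT g ->
  Lint g = (\int[lebrV]_x g x)%E.
Proof.
move=> /integrableP[mg gfin].
have mgr : measurable_fun setT (g \o rowm).
  exact: (measurableT_comp mg measurable_rowm).
have igr : (seqmeas R n).-integrable setT (g \o rowm).
  apply/integrableP; split => //.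
  have mag : measurable_fun [set: rVb] (abse \o g) by exact: measurableT_comp.
  have magr : measurable_fun setT (abse \o (g \o rowm)) by exact: measurableT_comp.
  have := ge0_LintE mag (fun=> abse_ge0 _); rewrite /Lint.
  rewrite (ge0_itintE n magr) /=; last by move=> c; exact: abse_ge0.
  by move=> ->.
rewrite /Lint (integrable_itintE igr).
rewrite [RHS](_ : _ = \int[lebrV0]_x g x)%E; last exact: eq_measure_integral.
rewrite [RHS](integral_pushforward measurable_rowm mg)//.
Qed.

Lemma measurable_shift_rV (z : rV) : measurable_fun [set: rVb] ((fun x : rVb => (x + z : rV)) : rVb -> rVb).
Proof.
apply: measurable_fun_rV => i; rewrite (_ : (fun _ => _) = (fun s : rV => s ord0 i + z ord0 i)).
  by apply: measurable_funD => //; exact: measurable_rV_coord.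
by apply/funext => s; rewrite mxE.
Qed.

Lemma ge0_integral_rV_shift (z : rV) (g : rV -> \bar R) :
  measurable_fun [set: rVb] g -> (forall x, 0 <= g x)%E ->
  (\int[lebrV]_x g (x + z)%R = \int[lebrV]_x g x)%E.
Proof.
move=> mg g0; have mgz := measurableT_comp mg (measurable_shift_rV z).
rewrite -(ge0_LintE mg)// -(ge0_LintE mgz)//= /Lint.
pose zc : seqR R := fun k => if insub k is Some i then z ord0 i else 0.
rewrite (ge0_itintE n (measurableT_comp mg measurable_rowm)); last by move=> c; exact: g0.
rewrite (ge0_itintE n (measurableT_comp mgz measurable_rowm)) /=; last by move=> c; exact: g0.
rewrite -(ge0_integral_cshift n zc (measurableT_comp mg measurable_rowm)) /=; last by move=> c; exact: g0.
apply: eq_integral => c _; congr g; apply/rowP => i.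
by rewrite /rowm !mxE /cshift ltn_ord /zc valK.
Qed.

End BorelRow.
Arguments lebrV : simpl never.

(** * Euclidean norm and the singular kernel *)

Lemma ler_eq d (T : porderType d) (x y : T) : x = y -> (x <= y)%O.
Proof. by move=> ->. Qed.

Section Euclid.
Variables (R : realType) (n : nat).
Local Notation rV := 'rV[R]_n.
Implicit Types u v w : rV.

Lemma dotvDl u v w : dotv (u + v) w = dotv u w + dotv v w.
Proof. by rewrite /dotv -big_split; apply: eq_bigr => i _; rewrite mxE mulrDl. Qed.

Lemma dotvC u v : dotv u v = dotv v u.
Proof. by apply: eq_bigr => i _; rewrite mulrC. Qed.

Lemma dotvDr u v w : dotv w (u + v) = dotv w u + dotv w v.
Proof. by rewrite dotvC dotvDl !(dotvC w). Qed.

Lemma dotvZl a u v : dotv (a *: u) v = a * dotv u v.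
Proof. by rewrite /dotv mulr_sumr; apply: eq_bigr => i _; rewrite mxE mulrA. Qed.

Lemma dotvZr a u v : dotv u (a *: v) = a * dotv u v.
Proof. by rewrite dotvC dotvZl dotvC. Qed.

Lemma dotvNr u v : dotv u (- v) = - dotv u v.
Proof. by rewrite -scaleN1r dotvZr mulN1r. Qed.

Lemma dotvBr u v w : dotv w (u - v) = dotv w u - dotv w v.
Proof. by rewrite dotvDr dotvNr. Qed.

Lemma dotv_ge0 u : 0 <= dotv u u.
Proof. by apply: sumr_ge0 => i _; rewrite -expr2 sqr_ge0. Qed.

Lemma enorm_ge0 u : 0 <= enorm u.
Proof. exact: sqrtr_ge0. Qed.

Lemma enorm_sqr u : enorm u ^+ 2 = dotv u u.
Proof. by rewrite sqr_sqrtr// dotv_ge0. Qed.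

Lemma enorm0 : enorm (0 : rV) = 0.
Proof. by rewrite /enorm /dotv big1 ?sqrtr0// => i _; rewrite mxE mul0r. Qed.

Lemma enormZ a u : enorm (a *: u) = `|a| * enorm u.
Proof.
by rewrite /enorm dotvZl dotvZr mulrA -expr2 sqrtrM ?sqr_ge0// sqrtr_sqr.
Qed.

Lemma enormN u : enorm (- u) = enorm u.
Proof. by rewrite -scaleN1r enormZ normrN normr1 mul1r. Qed.

Lemma enormC u v : enorm (u - v) = enorm (v - u).
Proof. by rewrite -enormN opprB. Qed.

Lemma coord_le_enorm u i : `|u ord0 i| <= enorm u.
Proof.
rewrite -ler_sqr ?nnegrE ?enorm_ge0// enorm_sqr /dotv (bigD1 i)//= real_normK ?num_real//.
by rewrite -expr2 lerDl; apply: sumr_ge0 => j _; rewrite -expr2 sqr_ge0.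
Qed.

Lemma enorm_eq0 u : enorm u = 0 -> u = 0.
Proof.
move=> u0; apply/rowP => i; rewrite mxE; apply/eqP; rewrite -normr_le0.
by rewrite -u0 coord_le_enorm.
Qed.

Lemma dotv_cauchy_schwarz u v : dotv u v <= enorm u * enorm v.
Proof.
have [v0|v0] := eqVneq (enorm v) 0.
  by rewrite (enorm_eq0 v0) enorm0 mulr0 /dotv big1// => i _; rewrite mxE mulr0.
have vp : 0 < enorm v by rewrite lt_neqAle eq_sym v0 enorm_ge0.
have := dotv_ge0 (enorm v *: u - enorm u *: v).
rewrite dotvBr dotvZr [dotv _ (_ *: v)]dotvZr.
rewrite ![dotv (_ - _) _]dotvC !dotvBr !dotvZr -!enorm_sqr (dotvC v u) => h.
have [u0|u0] := eqVneq (enorm u) 0.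
  by rewrite (enorm_eq0 u0) enorm0 mul0r /dotv big1// => i _; rewrite mxE mul0r.
have up : 0 < enorm u by rewrite lt_neqAle eq_sym u0 enorm_ge0.
have {h} : 0 <= (enorm u * enorm v) * (enorm u * enorm v - dotv u v) by nra.
by rewrite pmulr_rge0 ?mulr_gt0// subr_ge0.
Qed.

Lemma abs_dotv u v : `|dotv u v| <= enorm u * enorm v.
Proof.
rewrite ler_norml dotv_cauchy_schwarz andbT lerNl -dotvNr.
by apply: (le_trans (dotv_cauchy_schwarz _ _)); rewrite enormN.
Qed.

Lemma enormD u v : enorm (u + v) <= enorm u + enorm v.
Proof.
rewrite -ler_sqr ?nnegrE ?addr_ge0 ?enorm_ge0// enorm_sqr dotvDl !dotvDr.
rewrite (dotvC v u) -!enorm_sqr.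
have := dotv_cauchy_schwarz u v; nra.
Qed.

Lemma enorm_sum (I : Type) (s : seq I) (P : pred I) (F : I -> rV) :
  enorm (\sum_(i <- s | P i) F i) <= \sum_(i <- s | P i) enorm (F i).
Proof.
elim/big_ind2 : _ => [|x a y b ha hb|//]; first by rewrite enorm0.
by apply: (le_trans (enormD _ _)); exact: lerD.
Qed.

Lemma enorm_delta i : enorm (delta_mx ord0 i : rV) = 1.
Proof.
rewrite /enorm /dotv (bigD1 i)//= big1 ?addr0 => [|j ji].
  by rewrite mxE !eqxx mulr1 sqrtr1.
by rewrite mxE eqxx (negbTE ji) mulr0.
Qed.

Lemma row_sum_coord u : u = \sum_i u ord0 i *: (delta_mx ord0 i : rV).
Proof. exact: row_sum_delta. Qed.

Lemma enorm_le_sum u : enorm u <= \sum_i `|u ord0 i|.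
Proof.
rewrite {1}(row_sum_coord u); apply: (le_trans (enorm_sum _ _ _)).
by apply: ler_sum => i _; rewrite enormZ enorm_delta mulr1.
Qed.

Lemma coord_le_norm u i : `|u ord0 i| <= `|u|.
Proof.
rewrite [leRHS]mx_normrE.
exact: (le_bigmax _ (fun ij => `|u ij.1 ij.2|) (ord0, i)).
Qed.

Lemma norm_le_enorm u : `|u| <= enorm u.
Proof.
rewrite [leLHS]mx_normrE; apply: bigmax_le; first exact: enorm_ge0.
by move=> [i j] _ /=; rewrite (ord1 i) coord_le_enorm.
Qed.

Lemma enorm_le_norm u : enorm u <= n%:R * `|u|.
Proof.
apply: (le_trans (enorm_le_sum u)).
apply: (@le_trans _ _ (\sum_(i < n) `|u|)).
  by apply: ler_sum => i _; exact: coord_le_norm.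
by rewrite sumr_const card_ord -[leLHS]mulr_natl.
Qed.

Lemma enorm_abs_sub u v : `|enorm u - enorm v| <= enorm (u - v).
Proof.
have h1 := enormD (u - v) v; have h2 := enormD (v - u) u.
rewrite !subrK in h1 h2; rewrite enormC in h2.
by rewrite ler_norml; apply/andP; split; lra.
Qed.

Lemma continuous_enorm_lip (g : rV -> R) (L : R) :
  (forall u v, `|g u - g v| <= L * enorm (u - v)) -> continuous g.
Proof.
move=> gL x; have FF : Filter (nbhs (x : rV)) by exact: nbhs_filter.
apply/cvgrPdist_lt => e e0.
have n1 : 0 < `|L| * n%:R + 1 :> R by rewrite ltr_wpDl// mulr_ge0.
have : nbhs (x : rV) (ball (x : rV) (e / (`|L| * n%:R + 1))).
  by apply: nbhsx_ballx; rewrite divr_gt0.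
apply: filterS => y; rewrite -ball_normE /= => xy.
apply: (le_lt_trans (gL _ _)).
apply: (@le_lt_trans _ _ (`|L| * (n%:R * `|x - y|))).
  apply: (@le_trans _ _ (`|L| * enorm (x - y))).
    by rewrite ler_wpM2r ?enorm_ge0// ler_norm.
  by rewrite ler_wpM2l// enorm_le_norm.
apply: (@le_lt_trans _ _ ((`|L| * n%:R + 1) * `|x - y|)).
  by rewrite mulrA ler_wpM2r// lerDl.
by rewrite mulrC -ltr_pdivlMr.
Qed.

Lemma continuous_enorm : continuous (@enorm R n).
Proof. by apply: (@continuous_enorm_lip _ 1) => u v; rewrite mul1r enorm_abs_sub. Qed.

Lemma continuous_enormB (x : rV) : continuous (fun y : rV => enorm (y - x)).
Proof.
apply: (@continuous_enorm_lip _ 1) => u v; rewrite mul1r.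
by apply: (le_trans (enorm_abs_sub _ _)); rewrite opprB addrA subrK.
Qed.

Lemma open_eball (x : rV) r : open (eball x r).
Proof.
have -> : eball x r = (fun y => enorm (y - x)) @^-1` [set s | s < r] by [].
apply: open_comp; last exact: open_lt.
by move=> y _; exact: continuous_enormB.
Qed.

Lemma measurable_enorm : measurable_fun [set: rVb R n] (@enorm R n).
Proof. by apply: continuous_measurable_rV; exact: continuous_enorm. Qed.

Definition cball (r : R) : set (rVb R n) := [set z | enorm (z : rV) <= r].

Lemma measurable_cball r : measurable (cball r).
Proof.
rewrite (_ : cball r = setT `&` (fun z : rVb R n => enorm (z : rV)) @^-1` `]-oo, r]%classic).
  by apply: measurable_enorm.
by rewrite setTI; apply/seteqP; split => z /=; rewrite in_itv.
Qed.

Lemma lebrV_cball r : 0 <= r -> (lebrV R n (cball r) <= ((2 * r) ^+ n)%:E)%E.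
Proof.
move=> r0.
apply: (@le_trans _ _ (lebrV R n (rbox (fun=> - r) (fun=> r)))).
  apply: le_measure; rewrite ?inE; [exact: measurable_cball|exact: measurable_rbox|].
  by move=> z zr i; rewrite -ler_norml (le_trans (coord_le_enorm _ _)).
rewrite lebrV_box; last by move=> _; lra.
by rewrite prodr_const card_ord opprK lee_fin -mulr2n mulr_natl.
Qed.

Lemma pow2_bracket (t : R) : 1 <= t -> exists j, 2 ^+ j <= t <= 2 ^+ j.+1.
Proof.
move=> t1.
have ex : exists j, t <= 2 ^+ j.+1.
  exists (Num.truncn t).+1; apply: (@le_trans _ _ (Num.truncn t).+1%:R).
    by apply/ltW; exact: truncnS_gt.
  by rewrite -natrX ler_nat ltnW// ltnW// ltn_expl.
exists (ex_minn ex); case: ex_minnP => j tj jmin; rewrite tj andbT.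
case: j tj jmin => [|j] tj jmin; first by rewrite expr0.
rewrite leNgt; apply/negP => /ltW /jmin; by rewrite ltnn.
Qed.

(** Pointwise [g] is at most the sum over [j] of [c j] times the indicator of the ball of radius
    [rho j]. Each ball lies in a cube of side [2 * rho j], so integrating term by term gives a
    geometric series. *)
Lemma integral_le_geometric (c rho : nat -> R) (g : rV -> R) (D x : R) :
  (forall j, 0 <= c j) -> (forall j, 0 <= rho j) ->
  measurable_fun [set: rVb R n] g -> (forall z, 0 <= g z) ->
  (forall z, g z = 0 \/ exists j, g z <= c j /\ enorm z <= rho j) ->
  (forall j, c j * (2 * rho j) ^+ n <= D * x ^+ j) -> 0 <= D -> 0 < x < 1 ->
  (\int[lebrV R n]_z (g z)%:E <= (D / (1 - x))%:E)%E.
Proof.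
move=> c0 rho0 mg g0 gz cD D0 /andP[x0 x1].
pose F (j : nat) (z : rVb R n) : \bar R := (c j * \1_(cball (rho j)) z)%:E.
have F0 j z : (0 <= F j z)%E by rewrite lee_fin mulr_ge0.
have mgE : measurable_fun [set: rVb R n] (EFin \o g).
  exact: (measurableT_comp (@EFin_measurable _ _) mg).
have mI j : measurable_fun setT (\1_(cball (rho j)) : rVb R n -> R).
  by apply: measurable_indic; exact: measurable_cball.
have mF j : measurable_fun setT (F j).
  by apply/measurable_EFinP; exact: measurable_funM.
apply: (@le_trans _ _ (\int[lebrV R n]_z \big[+%E/0%E]_(0 <= j <oo) F j z)%E).
  apply: ge0_le_integral => //.
  - by move=> z _; rewrite lee_fin.
  - by apply: ge0_emeasurable_sum.
  move=> z _; case: (gz z) => [->|[j [gj zj]]]; first exact: nneseries_ge0.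
  apply: (@le_trans _ _ (F j z)).
    by rewrite lee_fin indicE mem_set// mulr1.
  apply: (@le_trans _ _ (\sum_(0 <= i < j.+1) F i z)%E).
    by rewrite big_nat_recr//= leeDr// sume_ge0.
  exact: nneseries_lim_ge.
rewrite integral_nneseries//.
apply: lime_le; first by apply: is_cvg_nneseries => j _ _; exact: integral_ge0.
near=> N.
apply: (@le_trans _ _ (\sum_(0 <= j < N) (D * x ^+ j)%:E)%E).
  apply: lee_sum => j _.
  rewrite /F; under eq_integral do rewrite EFinM.
  rewrite ge0_integralZl; [|by []|exact/measurable_EFinP|by move=> z _; rewrite lee_fin|by rewrite lee_fin].
  rewrite integral_indic//; last exact: measurable_cball.
  rewrite setIT; apply: (@le_trans _ _ ((c j)%:E * ((2 * rho j) ^+ n)%:E)%E).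
    by apply: lee_pmul; [rewrite lee_fin| | |exact: lebrV_cball].
  by rewrite -EFinM lee_fin.
rewrite sumEFin lee_fin.
by apply: (geometric_le_lim N D0 x0); rewrite ger0_norm// ltW.
Unshelve. all: by end_near. Qed.

End Euclid.

(** * Dyadic estimates for the singular kernel *)

Section Kernel.
Variables (R : realType) (n : nat).
Local Notation rV := 'rV[R]_n.

(* [powR] vanishes at base 0 for nonzero exponents, so the kernel is 0 at the origin *)
Definition kern (a : R) (z : rV) : R := enorm z `^ (- (n%:R + a)).

Lemma kern_ge0 a z : 0 <= kern a z. Proof. exact: powR_ge0. Qed.

Lemma measurable_kern a : measurable_fun [set: rVb R n] (kern a).
Proof. exact: (measurableT_comp (measurable_powR _) (@measurable_enorm R n)). Qed.

Lemma kern_le a z (s : R) : 0 <= a -> 0 < s -> s <= enorm z ->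
  kern a z <= s `^ (- (n%:R + a)).
Proof.
move=> a0 s0 sz; rewrite /kern !powRN lef_pV2 ?posrE ?powR_gt0 ?(lt_le_trans s0)//.
by apply: ge0_ler_powR; rewrite ?nnegrE ?addr_ge0 ?enorm_ge0// ltW.
Qed.

(** The first summand is the contribution of [|z| >= r], a geometric series of ratio [2^(-a)]; the
    second is that of [|z| < r], of ratio [2^(-(b - a))]. *)
Definition dyadic_const (a b : R) : R :=
  4 ^+ n / (1 - 2 `^ (- a)) +
  2 ^+ n * 2 `^ (n%:R + a) / (1 - 2 `^ (- (b - a))).

Definition mint (r : R) (z : rV) : R := Num.min (enorm z / r) 1.

Lemma mint_ge0 r z : 0 < r -> 0 <= mint r z.
Proof. by move=> r0; rewrite /mint le_min ler01 andbT divr_ge0 ?enorm_ge0// ltW. Qed.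

Lemma mint_le1 r z : mint r z <= 1.
Proof. by rewrite /mint ge_min lexx orbT. Qed.

Lemma measurable_mint r : measurable_fun [set: rVb R n] (mint r).
Proof.
apply: measurable_minr => //; apply: measurable_funM => //; exact: measurable_enorm.
Qed.

Lemma powR2N_lt1 (a : R) : 0 < a -> 0 < (2 : R) `^ (- a) < 1.
Proof.
move=> a0; rewrite powR_gt0//= powRN invf_lt1 ?powR_gt0//.
have := @gt0_ltr_powR R a a0 1 2; rewrite powR1; apply; rewrite ?nnegrE//.
by rewrite ltr1n.
Qed.

Lemma dyadic_const_gt0 (a b : R) : 0 < a -> a < b -> 0 < dyadic_const a b.
Proof.
move=> a0 ab; have /andP[x0 x1] := powR2N_lt1 a0.
have /andP[y0 y1] : 0 < (2 : R) `^ (- (b - a)) < 1 by apply: powR2N_lt1; rewrite subr_gt0.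
apply: addr_gt0; first by rewrite divr_gt0 ?exprn_gt0// subr_gt0.
by rewrite divr_gt0 ?mulr_gt0 ?exprn_gt0 ?powR_gt0// subr_gt0.
Qed.

Lemma integral_kern_far (a r : R) : 0 < a -> 0 < r ->
  (\int[lebrV R n]_z ((if r <= enorm z then kern a z else 0))%:E <=
   (4 ^+ n * r `^ (- a) / (1 - 2 `^ (- a)))%:E)%E.
Proof.
move=> a0 r0.
have p0 j : 0 < 2 ^+ j * r :> R by rewrite mulr_gt0// exprn_gt0.
(* Shells [2^j r <= |z| <= 2^(j+1) r]: the kernel is bounded by its value at the inner radius, and
   the cube around the outer ball has side [4 * 2^j r], hence the factor [4^n]. *)
apply: (@integral_le_geometric R n (fun j => (2 ^+ j * r) `^ (- (n%:R + a)))
  (fun j => 2 ^+ j.+1 * r)).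
- by move=> j; exact: powR_ge0.
- by move=> j; exact: ltW.
- apply: measurable_fun_ifT => //; last exact: measurable_kern.
  by apply: measurable_fun_ler => //; exact: measurable_enorm.
- by move=> z; case: ifP => // _; exact: kern_ge0.
- move=> z; case: ifPn => [rz|]; last by left.
  right; have [|j /andP[j1 j2]] := @pow2_bracket R (enorm z / r).
    by rewrite ler_pdivlMr// mul1r.
  exists j; rewrite ler_pdivlMr// in j1; rewrite ler_pdivrMr// in j2.
  by split=> //; apply: kern_le => //; exact: ltW.
- move=> j; rewrite opprD powRD; last by rewrite (gt_eqF (p0 j)) implybT.
  rewrite (powRN _ n%:R) powR_mulrn ?(ltW (p0 j))//.
  rewrite exprS (_ : 2 * (2 * 2 ^+ j * r) = 4 * (2 ^+ j * r)); last by ring.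
  rewrite [(4 * _) ^+ n]exprMn powRM ?exprn_ge0 ?(ltW r0)//.
  have -> : (2 ^+ j : R) `^ (- a) = (2 `^ (- a)) ^+ j.
    by rewrite -!powR_mulrn ?powR_ge0// -!powRrM mulrC.
  have : (2 ^+ j * r) ^+ n != 0 by rewrite expf_neq0// gt_eqF.
  move: ((2 ^+ j * r) ^+ n) (4 ^+ n) (_ ^+ j) => W F4 T W0.
  by apply: ler_eq; field.
- by rewrite mulr_ge0 ?exprn_ge0 ?powR_ge0.
- exact: powR2N_lt1.
Qed.

Lemma integral_kern_near (a b r : R) : 0 < a -> a < b -> 0 < r ->
  (\int[lebrV R n]_z ((if enorm z < r then (enorm z / r) `^ b * kern a z else 0))%:E <=
   (2 ^+ n * 2 `^ (n%:R + a) * r `^ (- a) / (1 - 2 `^ (- (b - a))))%:E)%E.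
Proof.
move=> a0 ab r0; have b0 : 0 < b by apply: lt_trans ab.
pose u (j : nat) : R := (2 ^+ j)^-1.
have u0 j : 0 < u j by rewrite invr_gt0 exprn_gt0.
have p0 j : 0 < u j * r :> R by rewrite mulr_gt0.
(* Shells [2^(-j-1) r <= |z| <= 2^(-j) r]: the gain [2^(-j b)] against the growth [2^(j a)] of
   kernel times volume makes the series converge, as [a < b]. *)
apply: (@integral_le_geometric R n
  (fun j => u j `^ b * (u j * r / 2) `^ (- (n%:R + a))) (fun j => u j * r)).
- by move=> j; rewrite mulr_ge0 ?powR_ge0.
- by move=> j; exact: ltW.
- apply: measurable_fun_ifT => //; last first.
    apply: measurable_funM; last exact: measurable_kern.
    apply: (measurableT_comp (measurable_powR _)).
    by apply: measurable_funM => //; exact: measurable_enorm.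
  by apply: measurable_fun_ltr => //; exact: measurable_enorm.
- by move=> z; case: ifP => // _; rewrite mulr_ge0 ?powR_ge0 ?kern_ge0.
- move=> z; case: ifPn => [rz|]; last by left.
  have [z0|z0] := eqVneq (enorm z) 0.
    by left; rewrite z0 mul0r powR0 ?mul0r// gt_eqF.
  have zp : 0 < enorm z by rewrite lt_neqAle eq_sym z0 enorm_ge0.
  right; have [|j /andP[j1 j2]] := @pow2_bracket R (r / enorm z).
    by rewrite ler_pdivlMr// mul1r ltW.
  have pj : 0 < 2 ^+ j :> R by rewrite exprn_gt0.
  have zu : enorm z <= u j * r.
    by rewrite /u mulrC ler_pdivlMr// mulrC -ler_pdivlMr.
  exists j; split=> //; apply: ler_pM; rewrite ?powR_ge0 ?kern_ge0//.
    apply: ge0_ler_powR; rewrite ?nnegrE ?divr_ge0 ?(ltW b0) ?(ltW zp) ?(ltW r0) ?(ltW (u0 j))//.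
    by rewrite ler_pdivrMr.
  apply: kern_le; rewrite ?(ltW a0) ?divr_gt0//.
  rewrite ler_pdivrMr// in j2.
  by rewrite ler_pdivrMr// /u mulrC ler_pdivrMr// (le_trans j2)// exprS; apply: ler_eq; ring.
- move=> j; rewrite opprD powRD; last first.
    by apply/implyP => _; rewrite gt_eqF// divr_gt0.
  rewrite (powRN _ n%:R) powR_mulrn ?divr_ge0 ?(ltW (p0 j))//.
  rewrite powRM ?invr_ge0 ?(ltW (p0 j))// powRM ?(ltW (u0 j)) ?(ltW r0)//.
  have -> : (2 `^ (- (b - a))) ^+ j = u j `^ b * u j `^ (- a).
    rewrite -powRD; last by rewrite (gt_eqF (u0 j)) implybT.
    rewrite -powR_mulrn ?powR_ge0// -powRrM /u -powR_inv1 ?exprn_ge0//.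
    by rewrite -powR_mulrn// -!powRrM; congr powR; ring.
  have -> : (2^-1 : R) `^ (- a) = 2 `^ a by rewrite -powR_inv1// -powRrM mulN1r opprK.
  rewrite powRD; last by apply/implyP => _; rewrite gt_eqF.
  rewrite powR_mulrn//.
  rewrite [(_ / 2) ^+ n]exprMn [(2 * _) ^+ n]exprMn exprVn.
  have : (u j * r) ^+ n != 0 by rewrite expf_neq0// gt_eqF.
  have : 2 ^+ n != 0 :> R by rewrite expf_neq0.
  move: ((u j * r) ^+ n) (2 ^+ n : R) => W F2 F0 W0.
  by apply: ler_eq; field; rewrite F0 W0.
- by rewrite !mulr_ge0 ?exprn_ge0 ?powR_ge0.
- by apply: powR2N_lt1; rewrite subr_gt0.
Qed.

Lemma integral_mint_kern (a b r : R) : 0 < a -> a < b -> 0 < r ->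
  (\int[lebrV R n]_z (mint r z `^ b * kern a z)%:E <=
   (dyadic_const a b * r `^ (- a))%:E)%E.
Proof.
move=> a0 ab r0.
have mfar : measurable_fun [set: rVb R n] (fun z => if r <= enorm z then kern a z else 0).
  apply: measurable_fun_ifT => //; last exact: measurable_kern.
  by apply: measurable_fun_ler => //; exact: measurable_enorm.
have mnear : measurable_fun [set: rVb R n]
    (fun z => if enorm z < r then (enorm z / r) `^ b * kern a z else 0).
  apply: measurable_fun_ifT => //; last first.
    apply: measurable_funM; last exact: measurable_kern.
    apply: (measurableT_comp (measurable_powR _)).
    by apply: measurable_funM => //; exact: measurable_enorm.
  by apply: measurable_fun_ltr => //; exact: measurable_enorm.
pose F1 (z : rVb R n) := (if r <= enorm z then kern a z else 0)%:E.
pose F2 (z : rVb R n) := (if enorm z < r then (enorm z / r) `^ b * kern a z else 0)%:E.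
rewrite (_ : (\int[lebrV R n]_z _) = \int[lebrV R n]_z (F1 z + F2 z))%E.
  rewrite ge0_integralD//.
  - rewrite mulrDl EFinD; apply: leeD.
      by apply: (le_trans (integral_kern_far a0 r0)); rewrite lee_fin; apply: ler_eq; ring.
    by apply: (le_trans (integral_kern_near a0 ab r0)); rewrite lee_fin; apply: ler_eq; ring.
  - by move=> z _; rewrite lee_fin; case: ifP => // _; exact: kern_ge0.
  - exact: (measurableT_comp (@EFin_measurable _ _) mfar).
  - by move=> z _; rewrite lee_fin; case: ifP => // _; rewrite mulr_ge0 ?powR_ge0 ?kern_ge0.
  - exact: (measurableT_comp (@EFin_measurable _ _) mnear).
apply: eq_integral => z _; rewrite /F1 /F2 -EFinD; congr EFin; rewrite /mint.
case: (leP r (enorm z)) => rz.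
  by rewrite addr0 (min_idPr _) ?powR1 ?mul1r// ler_pdivlMr// mul1r.
by rewrite add0r (min_idPl _)// ler_pdivrMr// mul1r ltW.
Qed.

End Kernel.

(** * Hoelder estimate for the nonlocal integral *)

Section Lp.
Variables (R : realType) (n : nat).
Local Notation rV := 'rV[R]_n.
Local Notation leb := (lebrV R n).

Lemma measurable_borel_fun (f : rV -> R) : borel_fun f -> measurable_fun [set: rVb R n] f.
Proof. by move=> bf _ Y mY; rewrite setTI; exact: bf. Qed.

Lemma measurable_comp_fst d (S : measurableType d) (g : rV -> R) :
  measurable_fun [set: rVb R n] g ->
  measurable_fun [set: rVb R n * S] (fun xz : rVb R n * S => g xz.1).
Proof.
by move=> mg; exact: (@measurableT_comp _ _ _ _ (rVb R n) _ g _
  (fst : rVb R n * S -> rVb R n) mg measurable_fst).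
Qed.

Lemma measurable_comp_snd d (S : measurableType d) (g : rV -> R) :
  measurable_fun [set: rVb R n] g ->
  measurable_fun [set: S * rVb R n] (fun xz : S * rVb R n => g xz.2).
Proof.
by move=> mg; exact: (@measurableT_comp _ _ _ _ (rVb R n) _ g _
  (snd : S * rVb R n -> rVb R n) mg measurable_snd).
Qed.

Lemma ge0_le_integral_rV (g h : rV -> R) :
  measurable_fun [set: rVb R n] g -> measurable_fun [set: rVb R n] h ->
  (forall x, 0 <= g x) -> (forall x, g x <= h x) ->
  (\int[leb]_x (g x)%:E <= \int[leb]_x (h x)%:E)%E.
Proof.
move=> mg mh g0 gh; apply: ge0_le_integral => //;
  try (by move=> x _; rewrite lee_fin); exact/measurable_EFinP.
Qed.

Lemma ge0_integralD_rV (g h : rV -> R) :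
  measurable_fun [set: rVb R n] g -> measurable_fun [set: rVb R n] h ->
  (forall x, 0 <= g x) -> (forall x, 0 <= h x) ->
  (\int[leb]_x (g x + h x)%:E = \int[leb]_x (g x)%:E + \int[leb]_x (h x)%:E)%E.
Proof.
move=> mg mh g0 h0; under eq_integral do rewrite EFinD.
apply: ge0_integralD => //; try (by move=> x _; rewrite lee_fin); exact/measurable_EFinP.
Qed.

Lemma ge0_integral_rV_shift_EFin (z : rV) (g : rV -> R) :
  measurable_fun [set: rVb R n] g -> (forall x, 0 <= g x) ->
  (\int[leb]_x (g (x + z)%R)%:E = \int[leb]_x (g x)%:E)%E.
Proof.
move=> mg g0; apply: (ge0_integral_rV_shift z (g := fun x => (g x)%:E)).
  exact/measurable_EFinP.
by move=> x; rewrite lee_fin.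
Qed.

Lemma lebnE (A : set (rVb R n)) : measurable A -> lebn A = leb A.
Proof.
move=> mA; have mI : measurable_fun setT (\1_A : rVb R n -> R) by exact: measurable_indic.
have mE : measurable_fun [set: rVb R n] (fun x => (\1_A x)%:E : \bar R).
  exact: (measurableT_comp (@EFin_measurable _ _) mI).
rewrite /lebn (ge0_LintE mE); last by move=> x; rewrite lee_fin.
by rewrite integral_indic// setIT.
Qed.

Lemma lebrVT_neq0 : leb setT <> 0%E.
Proof.
move=> h; have : (leb (rbox (fun=> 0%R) (fun=> 1%R)) <= leb setT)%E.
  by apply: le_measure; rewrite ?inE//; exact: measurable_rbox.
rewrite h lebrV_box// prodr_const subr0 expr1n lee_fin ler10 //.
Qed.

Lemma Lpnorm_infty_ess_sup (f : rV -> R) : measurable_fun [set: rVb R n] f ->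
  Lpnorm +oo%E f = ess_sup leb (fun x : rVb R n => (`|f x|)%:E).
Proof.
move=> mf.
have mF : measurable_fun [set: rVb R n] (fun x : rVb R n => (`|f x|)%:E).
  by apply/measurable_EFinP; exact: measurableT_comp.
rewrite (ess_supEmu0 _ mF) /Lpnorm; congr ereal_inf.
apply/seteqP; split => y /=;
  rewrite (_ : [set x : rV | _] = (fun x : rVb R n => (`|f x|)%:E) @^-1` `]y, +oo[%classic);
  rewrite ?lebnE//; try by apply/seteqP; split => x /=; rewrite in_itv/= andbT.
all: rewrite -[X in measurable X]setTI; apply: mF => //; exact: emeasurable_itv.
Qed.

Lemma Lpnorm_ge0 p (f : rV -> R) : measurable_fun [set: rVb R n] f -> (0 <= Lpnorm p f)%E.
Proof.
move=> mf; case: p => [r| |//]; first exact: poweR_ge0.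
rewrite /Lpnorm; apply: le_ereal_inf_tmp => M /= hM; rewrite leNgt; apply/negP => M0.
apply: lebrVT_neq0; rewrite -lebnE// -hM; congr lebn.
by apply/seteqP; split => // x _ /=; apply: (lt_le_trans M0); rewrite lee_fin.
Qed.

(** For [p = +oo] the bound by the essential supremum holds almost everywhere and is integrated; the
    finite case reduces to the inequality for Lebesgue norms once [Lpnorm] is unfolded. *)
Lemma hoelder_Lpnorm (p : \bar R) (q : R) (f g : rV -> R) :
  (p = +oo%E /\ q = 1) \/ (exists p' : R, [/\ p = p'%:E, 0 < p' & p'^-1 + q^-1 = 1]) ->
  0 < q ->
  measurable_fun [set: rVb R n] f -> measurable_fun [set: rVb R n] g ->
  (forall x, 0 <= g x) -> (Lpnorm p f < +oo)%E ->
  (\int[leb]_x (`|f x| * g x)%:E <=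
   Lpnorm p f * (\int[leb]_x (g x `^ q)%:E) `^ q^-1)%E.
Proof.
move=> pq q0 mf mg g0 fin.
have maf : measurable_fun [set: rVb R n] (fun x => `|f x|) by exact: measurableT_comp.
case: pq => [[pE qE]|[p' [pE p0 pq]]].
- rewrite qE invr1 poweRe1; last by apply: integral_ge0 => x _; rewrite lee_fin powR_ge0.
  under [X in (_ <= _ * X)%E]eq_integral do rewrite powRr1//.
  have N0 := Lpnorm_ge0 p mf.
  rewrite -ge0_integralZl//; first last.
  + by move=> x _; rewrite lee_fin.
  + by apply/measurable_EFinP.
  apply: ae_ge0_le_integral => //.
  + by move=> x _; rewrite lee_fin mulr_ge0.
  + by apply/measurable_EFinP; exact: measurable_funM.
  + by move=> x _; apply: mule_ge0 => //; rewrite lee_fin.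
  + by apply: emeasurable_funM => //; apply/measurable_EFinP.
  rewrite pE (Lpnorm_infty_ess_sup mf).
  have := ess_sup_ge leb (fun x : rVb R n => (`|f x|)%:E).
  apply: filterS => x fx _; rewrite EFinM; apply: lee_wpmul2r => //.
  by rewrite lee_fin.
- have := hoelder leb maf mg p0 q0 pq.
  rewrite Lnorm1 Lnorm.unlock => h.
  have -> : Lpnorm p f = ((\int[leb]_x `|(EFin \o (fun x => `|f x|%R)) x| `^ p') `^ p'^-1)%E.
    have mfp : measurable_fun [set: rVb R n] (fun x => (`|f x| `^ p')%:E).
      apply/measurable_EFinP.
      exact: (measurableT_comp (measurable_powR _) maf).
    rewrite pE /Lpnorm (ge0_LintE mfp); last by move=> x; rewrite lee_fin powR_ge0.
    congr (_ `^ _)%E; apply: eq_integral => x _.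
    by rewrite /= normr_id ?poweR_EFin.
  apply: le_trans; last apply: le_trans.
  2: exact: h.
  + by apply: ler_eq; apply: eq_integral => x _ /=; rewrite normrM normr_id (ger0_norm (g0 _)).
  + apply: ler_eq; congr (_ * _ `^ _)%E; apply: eq_integral => x _.
    by rewrite /= ?poweR_EFin (ger0_norm (g0 _)).
Qed.

(** After Tonelli, Hoelder in [x] at fixed [z] takes the q-th root of the hypothesis on [D], so
    [mint r z] appears to the power [1 / q]; the integral in [z] then converges since [a < q^-1].
    The difference [D] is left abstract because it will come from scalar cutoffs as well as from
    vector fields. *)
Lemma nonlocal_bound (p : \bar R) (q a r Q : R) (f : rV -> R) (D : rV -> rV -> R) :
  (p = +oo%E /\ q = 1) \/ (exists p' : R, [/\ p = p'%:E, 0 < p' & p'^-1 + q^-1 = 1]) ->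
  0 < q -> 0 < a -> a < q^-1 -> 0 < r -> 0 <= Q ->
  measurable_fun [set: rVb R n] f -> (Lpnorm p f < +oo)%E ->
  measurable_fun [set: rVb R n * rVb R n] (fun xz : rVb R n * rVb R n => D xz.1 xz.2) ->
  (forall x z, 0 <= D x z) ->
  (forall z, \int[leb]_x (D x z `^ q)%:E <= (Q * r ^+ n * mint r z)%:E)%E ->
  (\int[leb]_x \int[leb]_z (`|f x| * D x z * kern a z)%:E <=
   (dyadic_const n a q^-1 * Q `^ q^-1 * fine (Lpnorm p f) * r `^ (n%:R / q - a))%:E)%E.
Proof.
move=> pq q0 a0 aq r0 Q0 mf fin mD D0 hD.
pose F (xz : rVb R n * rVb R n) : \bar R := (`|f xz.1| * D xz.1 xz.2 * kern a xz.2)%:E.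
have F0 xz : (0 <= F xz)%E by rewrite lee_fin !mulr_ge0 ?kern_ge0.
have mF : measurable_fun setT F.
  have mk : measurable_fun [set: rVb R n * rVb R n]
      (fun xz : rVb R n * rVb R n => kern a xz.2).
    by apply: measurable_comp_snd; exact: measurable_kern.
  have mf1 : measurable_fun [set: rVb R n * rVb R n]
      (fun xz : rVb R n * rVb R n => f xz.1) by exact: measurable_comp_fst.
  apply/measurable_EFinP; apply: measurable_funM; last exact: mk.
  apply: measurable_funM; last exact: mD.
  exact: measurableT_comp.
rewrite (_ : (\int[leb]_x _) = \int[leb]_x \int[leb]_z F (x, z))%E//.
rewrite (@fubini_tonelli _ _ _ _ R leb leb F mF F0).
set N := fine (Lpnorm p f).
have NE : Lpnorm p f = N%:E.
  by rewrite /N fineK// ge0_fin_numE//; exact: Lpnorm_ge0.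
have N0 : 0 <= N by rewrite fine_ge0//; exact: Lpnorm_ge0.
pose K := N * Q `^ q^-1 * r `^ (n%:R / q).
have K0 : 0 <= K by rewrite !mulr_ge0 ?powR_ge0.
have mG : measurable_fun [set: rVb R n] (fun z => mint r z `^ q^-1 * kern a z).
  apply: measurable_funM; last exact: measurable_kern.
  exact: (measurableT_comp (measurable_powR _) (@measurable_mint R n r)).
have mGE : measurable_fun [set: rVb R n] (fun z => (mint r z `^ q^-1 * kern a z)%:E).
  by apply/measurable_EFinP.
apply: (@le_trans _ _ (\int[leb]_z (K%:E * (mint r z `^ q^-1 * kern a z)%:E))%E).
  apply: ge0_le_integral => //.
  - by move=> z _; exact: integral_ge0.
  - exact: (@measurable_fun_fubini_tonelli_G _ _ _ _ R leb F mF F0).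
  - by apply: emeasurable_funM.
  move=> z _.
  have mDz : measurable_fun [set: rVb R n] (fun x => D x z).
    exact: (measurableT_comp mD (measurable_pair2 z)).
  have mfD : measurable_fun [set: rVb R n] (fun x => (`|f x| * D x z)%:E).
    apply/measurable_EFinP; apply: measurable_funM => //.
    exact: measurableT_comp.
  have -> : (\int[leb]_x F (x, z) =
      \int[leb]_x ((`|f x| * D x z)%:E * (kern a z)%:E))%E.
    by apply: eq_integral => x _; rewrite -EFinM.
  rewrite ge0_integralZr//; first last.
  - by rewrite lee_fin kern_ge0.
  - by move=> x _; rewrite lee_fin mulr_ge0.
  rewrite [(_ * kern a z)%:E]EFinM muleA; apply: lee_wpmul2r; first by rewrite lee_fin kern_ge0.
  apply: (le_trans (hoelder_Lpnorm pq q0 mf mDz (fun=> D0 _ _) fin)).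
  rewrite NE /K -mulrA (EFinM N) -muleA; apply: lee_wpmul2l; first by rewrite lee_fin.
  have -> : ((Q `^ q^-1 * r `^ (n%:R / q))%:E * (mint r z `^ q^-1)%:E =
             (Q * r ^+ n * mint r z)%:E `^ q^-1)%E.
    rewrite poweR_EFin -EFinM; congr EFin.
    rewrite powRM ?mulr_ge0 ?exprn_ge0 ?mint_ge0 ?(ltW r0)// powRM ?exprn_ge0 ?(ltW r0)//.
    by rewrite -(powR_mulrn _ (ltW r0)) -powRrM.
  have inI (y : \bar R) : (0 <= y)%E -> y \in `[0%E, +oo%E].
    by move=> y0; rewrite in_itv/= y0 leey.
  apply: gt0_ler_poweR; [by rewrite invr_ge0 ltW| | |exact: hD]; apply: inI.
    by apply: integral_ge0 => x _; rewrite lee_fin powR_ge0.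
  by rewrite lee_fin !mulr_ge0 ?exprn_ge0 ?mint_ge0 ?(ltW r0).
rewrite ge0_integralZl//; last first.
  by move=> z _; rewrite lee_fin mulr_ge0 ?kern_ge0 ?powR_ge0.
apply: (@le_trans _ _ (K%:E * (dyadic_const n a q^-1 * r `^ (- a))%:E)%E).
  apply: lee_wpmul2l; first by rewrite lee_fin.
  exact: integral_mint_kern.
rewrite -EFinM lee_fin /K powRD; last by rewrite (gt_eqF r0) implybT.
by apply: ler_eq; ring.
Qed.

End Lp.

(** * Translates of radial functions *)

Section RadialDifference.
Variables (R : realType) (n : nat).
Local Notation rV := 'rV[R]_n.
Local Notation leb := (lebrV R n).
Variables (H : R -> R) (c : rV) (r : R).
Hypothesis r0 : 0 < r.
Hypothesis H01 : forall t, 0 <= H t <= 1.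
Hypothesis Hdec : forall s t, s <= t -> H t <= H s.
Hypothesis Hsupp : forall t, r ^+ 2 <= t -> H t = 0.
Let eta (x : rV) : R := H (enorm (x - c) ^+ 2).
Hypothesis meta : measurable_fun [set: rVb R n] eta.

Let eta0 x : 0 <= eta x. Proof. by have /andP[] := H01 (enorm (x - c) ^+ 2). Qed.
Let eta1 x : eta x <= 1. Proof. by have /andP[] := H01 (enorm (x - c) ^+ 2). Qed.

Let meta_shift (z : rV) : measurable_fun [set: rVb R n] (fun x => eta (x + z)).
Proof. exact: (measurableT_comp meta (measurable_shift_rV z)). Qed.

Let eta_box x : eta x != 0 -> rbox (fun i => c ord0 i - r) (fun i => c ord0 i + r) x.
Proof.
move=> h i; have xr : enorm (x - c) < r.
  rewrite ltNge; apply/negP => rx; move/eqP : h; apply; apply: Hsupp.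
  by rewrite ler_sqr// nnegrE ?enorm_ge0// ltW.
have := le_lt_trans (coord_le_enorm (x - c) i) xr.
rewrite !mxE ltr_norml => /andP[h1 h2].
by apply/andP; split; lra.
Qed.

Lemma integral_le_box (g : rV -> R) (a b : 'I_n -> R) : (forall i, a i <= b i) ->
  measurable_fun [set: rVb R n] g -> (forall x, 0 <= g x <= 1) ->
  (forall x, g x != 0 -> rbox a b x) ->
  (\int[leb]_x (g x)%:E <= (\prod_i (b i - a i))%:E)%E.
Proof.
move=> ab mg g01 gb.
have mB := @measurable_rbox R n a b.
have mI : measurable_fun setT (\1_(rbox a b) : rVb R n -> R) by exact: measurable_indic.
apply: (@le_trans _ _ (\int[leb]_x (\1_(rbox a b) x)%:E)%E).
  apply: ge0_le_integral_rV => // x; first by case/andP: (g01 x).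
  have [->|/gb xb] := eqVneq (g x) 0; first by [].
  by rewrite indicE mem_set//; case/andP: (g01 x).
rewrite integral_indic// setIT; exact: (ler_eq (lebrV_box ab)).
Qed.

Lemma integral_radial_le : (\int[leb]_x (eta x)%:E <= ((2 * r) ^+ n)%:E)%E.
Proof.
apply: (le_trans (integral_le_box _ meta _ eta_box)).
- by move=> i; rewrite lerBlDr -addrA lerDl addr_ge0// ltW.
- by move=> x; rewrite eta0 eta1.
rewrite lee_fin; apply: ler_eq; rewrite (eq_bigr (fun=> 2 * r)).
  by rewrite prodr_const card_ord.
by move=> i _; ring.
Qed.

(** It contains the points that are no farther from the centre than both of their translates by [t]
    and by [- t] along axis [i]; these are the points that escape the comparison below. *)
Let slab (t : R) (i : 'I_n) (x : rV) : R := if `|x ord0 i - c ord0 i| <= `|t| / 2 then eta x else 0.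

Let mslab t i : measurable_fun [set: rVb R n] (slab t i).
Proof.
apply: measurable_fun_ifT => //; apply: measurable_fun_ler => //.
apply: measurableT_comp => //; apply: measurable_funB => //.
exact: measurable_rV_coord.
Qed.

Let slab_le t i : (\int[leb]_x (slab t i x)%:E <= (`|t| * (2 * r) ^+ n.-1)%:E)%E.
Proof.
pose w j := if j == i then `|t| / 2 else r.
have w0 j : 0 <= w j by rewrite /w; case: ifP => _; [rewrite divr_ge0|exact: ltW].
apply: (le_trans (@integral_le_box _ (fun j => c ord0 j - w j) (fun j => c ord0 j + w j) _ (mslab t i) _ _)).
- by move=> j; rewrite lerBlDr -addrA lerDl addr_ge0.
- by move=> x; rewrite /slab; case: ifP => _; rewrite ?eta0 ?eta1// lexx ler01.
- move=> x; rewrite /slab; case: ifPn => [h /eta_box xb j|]; last by rewrite eqxx.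
  rewrite /w; case: eqP => [->|_]; last exact: xb.
  by move: h; rewrite ler_norml => /andP[h1 h2]; apply/andP; split; lra.
rewrite lee_fin; apply: ler_eq; rewrite (bigD1 i)//=.
rewrite (_ : c ord0 i + w i - _ = `|t|); last by rewrite /w eqxx; field.
congr (_ * _); rewrite (eq_bigr (fun=> 2 * r)); last first.
  by move=> j ji; rewrite /w (negbTE ji); ring.
by rewrite prodr_const cardC1 card_ord.
Qed.

Let sq_shift (x : rV) (t : R) (i : 'I_n) :
  enorm (x + t *: delta_mx ord0 i - c) ^+ 2 =
  enorm (x - c) ^+ 2 + 2 * t * (x ord0 i - c ord0 i) + t ^+ 2.
Proof.
have -> : x + t *: delta_mx ord0 i - c = (x - c) + t *: delta_mx ord0 i.
  by rewrite addrAC.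
have -> : x ord0 i - c ord0 i = (x - c) ord0 i by rewrite !mxE.
move: (x - c) => y.
rewrite !enorm_sqr dotvDl !dotvDr !dotvZl !dotvZr (dotvC (delta_mx _ _) y).
have -> : dotv y (delta_mx ord0 i) = y ord0 i.
  rewrite /dotv (bigD1 i)//= big1 ?addr0 => [|j ji].
    by rewrite !mxE !eqxx mulr1.
  by rewrite !mxE eqxx (negbTE ji) mulr0.
rewrite -[dotv (delta_mx _ _) _]enorm_sqr enorm_delta; ring.
Qed.

(* With P the half space where the shift moves x closer to the centre,
   |eta(x+z) - eta x| = eta(x+z) + eta x - 2 min, and translating the half of the
   minimum that involves eta(x+z) leaves only a slab of width |t|. *)
Lemma integral_radial_shift1 (t : R) (i : 'I_n) :
  (\int[leb]_x (`|eta (x + t *: delta_mx ord0 i)%R - eta x|)%:E <=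
   (2 * `|t| * (2 * r) ^+ n.-1)%:E)%E.
Proof.
set z : rV := t *: delta_mx ord0 i.
pose P (x : rV) := enorm (x + z - c) ^+ 2 <= enorm (x - c) ^+ 2.
have mP : measurable_fun [set: rVb R n] P.
  apply: measurable_fun_ler.
    apply: measurable_funX; apply: continuous_measurable_rV.
    have -> : (fun x : rV => enorm (x + z - c)) = (fun x => enorm (x - (c - z))).
      by apply/funext => x; congr enorm; rewrite opprB addrA.
    exact: continuous_enormB.
  by apply: measurable_funX; apply: continuous_measurable_rV; exact: continuous_enormB.
pose m1 (x : rV) := if P x then eta x else 0.
pose m2 (x : rV) := if P x then 0 else eta (x + z).
pose m2' (x : rV) := if P (x - z) then 0 else eta x.
pose d (x : rV) := `|eta (x + z) - eta x|.
have mm1 : measurable_fun [set: rVb R n] m1 by exact: measurable_fun_ifT.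
have mm2 : measurable_fun [set: rVb R n] m2 by exact: measurable_fun_ifT.
have mm2' : measurable_fun [set: rVb R n] m2'.
  apply: measurable_fun_ifT => //.
  exact: (measurableT_comp mP (measurable_shift_rV (- z))).
have md : measurable_fun [set: rVb R n] d.
  by apply: measurableT_comp => //; exact: measurable_funB.
have m10 x : 0 <= m1 x by rewrite /m1; case: ifP.
have m20 x : 0 <= m2 x by rewrite /m2; case: ifP.
have m20' x : 0 <= m2' x by rewrite /m2'; case: ifP.
have d0 x : 0 <= d x by exact: normr_ge0.
pose I (g : rV -> R) : \bar R := (\int[leb]_x (g x)%:E)%E.
have ID (g h : rV -> R) : measurable_fun [set: rVb R n] g -> measurable_fun [set: rVb R n] h ->
    (forall x, 0 <= g x) -> (forall x, 0 <= h x) ->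
    I (fun x => g x + h x) = (I g + I h)%E by exact: ge0_integralD_rV.
have Ile (g h : rV -> R) : measurable_fun [set: rVb R n] g -> measurable_fun [set: rVb R n] h ->
    (forall x, 0 <= g x) -> (forall x, g x <= h x) -> (I g <= I h)%E.
  exact: ge0_le_integral_rV.
have I0 (g : rV -> R) : (forall x, 0 <= g x) -> (0 <= I g)%E.
  by move=> g0; apply: integral_ge0 => x _; rewrite lee_fin.
have Im2 : I m2 = I m2'.
  rewrite /I -(ge0_integral_rV_shift_EFin z mm2' m20').
  by apply: eq_integral => x _; rewrite /m2' /m2 addrK.
have Ishift : I (fun x => eta (x + z)) = I eta.
  exact: ge0_integral_rV_shift_EFin.
have mz := meta_shift z.
have mm12 : measurable_fun [set: rVb R n] (fun x => m1 x + m2 x) by exact: measurable_funD.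
have mm12' : measurable_fun [set: rVb R n] (fun x => m1 x + m2' x) by exact: measurable_funD.
have mm12d : measurable_fun [set: rVb R n] (fun x => m1 x + m2 x + (m1 x + m2 x)).
  exact: measurable_funD.
have m120 x : 0 <= m1 x + m2 x by rewrite addr_ge0.
have m120' x : 0 <= m1 x + m2' x by rewrite addr_ge0.
have m12d0 x : 0 <= m1 x + m2 x + (m1 x + m2 x) by rewrite addr_ge0.
have slab0 x : 0 <= slab t i x by rewrite /slab; case: ifP.
have E1 : (I d + (I m1 + I m2 + (I m1 + I m2)) = I eta + I eta)%E.
  rewrite -{1}Ishift.
  rewrite -(ID _ _ mm1 mm2 m10 m20) -(ID _ _ mm12 mm12 m120 m120).
  rewrite -(ID _ _ md mm12d d0 m12d0) -(ID _ _ mz meta (fun=> eta0 _) eta0).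
  apply: eq_integral => x _; congr EFin; rewrite /d /m1 /m2; case: ifPn => hP.
    rewrite ger0_norm ?subr_ge0; first by ring.
    exact: Hdec.
  rewrite ler0_norm ?subr_le0; first by ring.
  by apply: Hdec; rewrite ltW// ltNge.
have ms := mslab t i.
have E2 : (I eta <= I m1 + I m2 + I (slab t i))%E.
  rewrite Im2 -(ID _ _ mm1 mm2' m10 m20') -(ID _ _ mm12' ms m120' slab0).
  apply: Ile => //; first exact: measurable_funD.
  move=> x; rewrite /m1 /m2' /slab.
  have e0 := eta0 x.
  case: ifPn => h1; first by case: ifPn => h2; case: ifPn => h3; lra.
  case: ifPn => h2; last by case: ifPn => h3; lra.
  case: ifPn => h3; first by lra.
  (* Neither translate of [x] is closer to the centre. Expanding the two squared distances gives
     [|2 t y| <= t^2] for the i-th coordinate [y] of [x - c], so [x] lies in the slab after all. *)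
  exfalso; move: h1 h2 h3; rewrite /P subrK -!ltNge.
  have -> : x - z = x + (- t) *: delta_mx ord0 i by rewrite scaleNr.
  rewrite /z !sq_shift sqrrN.
  move: (x ord0 i - c ord0 i) (enorm _ ^+ 2) => y e h1 h2 h3.
  have t0 : 0 < `|t|.
    rewrite normr_gt0; apply/eqP => t0; move: h1; rewrite t0; lra.
  have k1 : `|t| * `|t| < 2 * `|t| * `|y| by nra.
  have k2 : `|2 * t * y| <= t ^+ 2.
    by rewrite ler_norml; apply/andP; split; lra.
  rewrite !normrM (ger0_norm (_ : 0 <= 2))// -(real_normK (num_real t)) expr2 in k2.
  by have := lt_le_trans k1 k2; rewrite ltxx.
(* Finiteness of all integrals turns [E1] and [E2] into real relations, and subtracting them bounds
   [I d] by twice the integral over the slab. *)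
have Ifin : I eta \is a fin_num.
  by rewrite ge0_fin_numE ?I0//; apply: (le_lt_trans integral_radial_le); rewrite ltry.
have m1fin : I m1 \is a fin_num.
  rewrite ge0_fin_numE ?I0//; apply: (@le_lt_trans _ _ (I eta)).
    by apply: Ile => // x; rewrite /m1; case: ifP.
  by rewrite -ge0_fin_numE ?I0.
have m2fin : I m2 \is a fin_num.
  rewrite ge0_fin_numE ?I0//; apply: (@le_lt_trans _ _ (I eta)).
    by rewrite Im2; apply: Ile => // x; rewrite /m2'; case: ifP.
  by rewrite -ge0_fin_numE ?I0.
have slabfin : I (slab t i) \is a fin_num.
  rewrite ge0_fin_numE; first by apply: (le_lt_trans (slab_le t i)); rewrite ltry.
  by apply: I0 => x; rewrite /slab; case: ifP.
have dfin : I d \is a fin_num.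
  have : (I d <= I eta + I eta)%E.
    have h1 := I0 _ m10; have h2 := I0 _ m20.
    by rewrite -E1; apply: leeDl; apply: adde_ge0; exact: adde_ge0.
  move=> hle; rewrite ge0_fin_numE; last exact: I0.
  apply: (le_lt_trans hle); have e0 := I0 _ eta0.
  by rewrite -(ge0_fin_numE (adde_ge0 e0 e0)) fin_numD Ifin.
have := slab_le t i; rewrite -/(I (slab t i)) -/(I d).
move: E1 E2; rewrite -(fineK Ifin) -(fineK m1fin) -(fineK m2fin) -(fineK slabfin) -(fineK dfin).
rewrite -!EFinD !lee_fin => -[E1] E2 E3.
have -> : 2 * `|t| * (2 * r) ^+ n.-1 = 2 * (`|t| * (2 * r) ^+ n.-1) by ring.
lra.
Qed.

(** Telescoping: a general translation is composed of axis-parallel ones, and translation invariance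
    brings every increment back to the previous lemma. *)
Lemma integral_radial_shift_seq (z : rV) (s : seq 'I_n) :
  (\int[leb]_x (`|eta (x + \sum_(i <- s) z ord0 i *: delta_mx ord0 i)%R - eta x|)%:E <=
   (2 * (\sum_(i <- s) `|z ord0 i|) * (2 * r) ^+ n.-1)%:E)%E.
Proof.
elim: s => [|i s IH].
  rewrite !big_nil mulr0 mul0r; under eq_integral do rewrite addr0 subrr normr0.
  by rewrite integral0.
rewrite !big_cons mulrDr mulrDl EFinD.
set w : rV := \sum_(j <- s) _ *: _ in IH *.
set d1 : rV := z ord0 i *: delta_mx ord0 i.
pose g1 (x : rV) := `|eta (x + d1) - eta x|.
have mg1 : measurable_fun [set: rVb R n] g1.
  by apply: measurableT_comp => //; exact: measurable_funB.
have mg2 : measurable_fun [set: rVb R n] (fun x => `|eta (x + w) - eta x|).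
  by apply: measurableT_comp => //; exact: measurable_funB.
have mg1w : measurable_fun [set: rVb R n] (fun x => g1 (x + w)).
  exact: (measurableT_comp mg1 (measurable_shift_rV w)).
have mg3 : measurable_fun [set: rVb R n] (fun x => `|eta (x + (d1 + w)) - eta x|).
  by apply: measurableT_comp => //; exact: measurable_funB.
have mg12 : measurable_fun [set: rVb R n] (fun x => g1 (x + w) + `|eta (x + w) - eta x|).
  exact: measurable_funD.
have hle x : `|eta (x + (d1 + w)) - eta x| <= g1 (x + w) + `|eta (x + w) - eta x|.
  rewrite /g1 -addrA [w + d1]addrC.
  have -> : eta (x + (d1 + w)) - eta x =
    (eta (x + (d1 + w)) - eta (x + w)) + (eta (x + w) - eta x) by ring.
  exact: ler_normD.
apply: (le_trans (ge0_le_integral_rV mg3 mg12 (fun=> normr_ge0 _) hle)).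
have g10 x : 0 <= g1 x by exact: normr_ge0.
rewrite (ge0_integralD_rV mg1w mg2 (fun=> g10 _) (fun=> normr_ge0 _)).
apply: leeD => //.
rewrite (ge0_integral_rV_shift_EFin w mg1 g10).
exact: integral_radial_shift1.
Qed.

(** Large enough for both branches of the minimum: [2 n |z| (2 r)^(n-1)] from the coordinate shifts
    and [2 (2 r)^n] from bounding the two terms separately. *)
Definition radial_const : R := 2 ^+ n.+1 * n.+1%:R.

Lemma radial_const_gt0 : 0 < radial_const.
Proof. by rewrite mulr_gt0 ?exprn_gt0. Qed.

(** Differences of [eta] are at most 1, so the power [q >= 1] only decreases them and the L^1
    estimates apply. The bound sees the profile [H] through [r] alone, whatever its steepness. *)
Lemma integral_radial_diff (q : R) (z : rV) : (0 < n)%N -> 1 <= q ->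
  (\int[leb]_x (`|eta (x + z)%R - eta x| `^ q)%:E <=
   (radial_const * r ^+ n * mint r z)%:E)%E.
Proof.
move=> n0 q1.
have mg : measurable_fun [set: rVb R n] (fun x => `|eta (x + z) - eta x|).
  by apply: measurableT_comp => //; exact: measurable_funB.
have le1 x : `|eta (x + z) - eta x| <= 1.
  have := eta0 (x + z); have := eta1 (x + z); have := eta0 x; have := eta1 x.
  by move=> *; rewrite ler_norml; apply/andP; split; lra.
apply: (@le_trans _ _ (\int[leb]_x (`|eta (x + z)%R - eta x|)%:E)%E).
  have mgq : measurable_fun [set: rVb R n] (fun x => `|eta (x + z) - eta x| `^ q).
    exact: (measurableT_comp (measurable_powR _) mg).
  apply: (ge0_le_integral_rV mgq mg) => x; first exact: powR_ge0.
  rewrite -[leRHS]powRr1//.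
  have [->|ne0] := eqVneq `|eta (x + z) - eta x| 0.
    by rewrite !powR0// gt_eqF// (lt_le_trans _ q1).
  by apply: ger_powR => //; rewrite le1 andbT lt_neqAle eq_sym ne0 normr_ge0.
rewrite /mint minr_pMr; last by rewrite !mulr_ge0 ?exprn_ge0 ?(ltW r0).
rewrite EFin_min lexI; apply/andP; split.
- apply: (@le_trans _ _ (2 * (\sum_(i < n) `|z ord0 i|) * (2 * r) ^+ n.-1)%:E).
    have := @integral_radial_shift_seq z (index_enum _).
    by under eq_integral do rewrite -row_sum_coord.
  rewrite lee_fin.
  have -> : radial_const * r ^+ n * (enorm z / r) = 2 * (2 * n.+1%:R * enorm z) * (2 * r) ^+ n.-1.
    have e1 : r ^+ n = r * r ^+ n.-1 by rewrite -exprS prednK.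
    have e2 : 2 ^+ n.+1 = 2 * 2 * 2 ^+ n.-1 :> R by rewrite -mulrA -!exprS prednK.
    by rewrite /radial_const e1 e2 exprMn; field; rewrite gt_eqF.
  rewrite ler_wpM2r ?exprn_ge0 ?mulr_ge0 ?(ltW r0)// ler_wpM2l//.
  apply: (@le_trans _ _ (\sum_(i < n) enorm z)).
    by apply: ler_sum => i _; exact: coord_le_enorm.
  rewrite sumr_const card_ord -[leLHS]mulr_natl ler_wpM2r ?enorm_ge0//.
  by rewrite -natrM ler_nat mul2n -addnn (leq_trans (leqnSn n))// leq_addr.
- rewrite mulr1.
  have mz := meta_shift z.
  have mzD : measurable_fun [set: rVb R n] (fun x => eta (x + z) + eta x).
    exact: measurable_funD.
  have hle x : `|eta (x + z) - eta x| <= eta (x + z) + eta x.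
    by apply: (le_trans (ler_normB _ _)); rewrite !ger0_norm.
  apply: (le_trans (ge0_le_integral_rV mg mzD (fun=> normr_ge0 _) hle)).
  rewrite (ge0_integralD_rV mz meta (fun=> eta0 _) eta0).
  rewrite (ge0_integral_rV_shift_EFin z meta eta0).
  apply: (@le_trans _ _ (((2 * r) ^+ n)%:E + ((2 * r) ^+ n)%:E)%E).
    by apply: leeD; exact: integral_radial_le.
  rewrite -EFinD lee_fin.
  have h0 : 0 <= 2 * (2 ^+ n * r ^+ n) by rewrite !mulr_ge0 ?exprn_ge0 ?(ltW r0).
  have -> : (2 * r) ^+ n + (2 * r) ^+ n = 2 * (2 ^+ n * r ^+ n) by rewrite exprMn; ring.
  have -> : radial_const * r ^+ n = 2 * (2 ^+ n * r ^+ n) * n.+1%:R.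
    by rewrite /radial_const exprS; ring.
  by rewrite ler_peMr// ler1n.
Qed.

End RadialDifference.

(** * Smooth cutoff functions *)

Section ScalarSmooth.
Variables (R : realType).

(** Scalar counterpart of [Ck] on any normed space, so that the same closure rules serve profiles on
    the line and functions of row vectors. *)
Fixpoint sCk (V : normedModType R) (k : nat) (g : V -> R) : Prop :=
  match k with
  | 0 => continuous g
  | S k' => continuous g /\
      forall v : V, (forall x, derivable g x v) /\ sCk k' (fun x => 'D_v g x)
  end.

Variable V : normedModType R.
Implicit Types g h : V -> R.

Lemma sCkW k g : sCk k.+1 g -> sCk k g.
Proof.
elim: k g => [|k IH] g; first by case.
move=> [cg dg]; split => // v; have [d1 d2] := dg v; split => //.
exact: IH.
Qed.

Lemma sCk_ext k g h : g =1 h -> sCk k g -> sCk k h.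
Proof. by move=> /funext ->. Qed.

Lemma sCk_cst k (a : R) : sCk k (fun _ : V => a).
Proof.
elim: k a => [|k IH] a; first by move=> x; exact: cvg_cst.
split; first by move=> x; exact: cvg_cst.
move=> v; split; first by move=> x; exact: derivable_cst.
by apply: (sCk_ext _ (IH 0)) => x; rewrite derive_cst.
Qed.

Lemma sCkD k g h : sCk k g -> sCk k h -> sCk k (fun x => g x + h x).
Proof.
elim: k g h => [|k IH] g h.
  by move=> cg ch x; apply: cvgD; [exact: cg|exact: ch].
move=> [cg dg] [ch dh]; split.
  by move=> x; apply: cvgD; [exact: cg|exact: ch].
move=> v; have [dg1 dg2] := dg v; have [dh1 dh2] := dh v; split.
  by move=> x; exact: derivableD.
apply: (sCk_ext _ (IH _ _ dg2 dh2)) => x.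
by rewrite deriveD.
Qed.

Lemma sCkM k g h : sCk k g -> sCk k h -> sCk k (fun x => g x * h x).
Proof.
elim: k g h => [|k IH] g h.
  by move=> cg ch x; apply: cvgM; [exact: cg|exact: ch].
move=> Cg Ch; have [cg dg] := Cg; have [ch dh] := Ch; split.
  by move=> x; apply: cvgM; [exact: cg|exact: ch].
move=> v; have [dg1 dg2] := dg v; have [dh1 dh2] := dh v; split.
  by move=> x; exact: derivableM.
apply: (sCk_ext _ (sCkD (IH _ _ (sCkW Cg) dh2) (IH _ _ (sCkW Ch) dg2))) => x.
by rewrite deriveM.
Qed.

Lemma sCk_sum k (I : Type) (s : seq I) (G : I -> V -> R) :
  (forall i, sCk k (G i)) -> sCk k (fun x => \sum_(i <- s) G i x).
Proof.
move=> hG; elim: s => [|i s IH].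
  by apply: (sCk_ext _ (sCk_cst k 0)) => x; rewrite big_nil.
by apply: (sCk_ext _ (sCkD (hG i) IH)) => x; rewrite big_cons.
Qed.

Lemma sCkV k g : (forall x, 0 < g x) -> sCk k g -> sCk k (fun x => (g x)^-1).
Proof.
move=> g0; have gn x : g x != 0 by rewrite gt_eqF.
elim: k => [|k IH].
  by move=> cg x; apply: cvgV => //; exact: cg.
move=> Cg; have [cg dg] := Cg; split.
  by move=> x; apply: cvgV => //; exact: cg.
move=> v; have [dg1 dg2] := dg v; split.
  by move=> x; exact: derivableV.
have C1 := IH (sCkW Cg).
apply: (sCk_ext _ (sCkM (sCkM (sCk_cst k (-1)) (sCkM C1 C1)) dg2)) => x.
rewrite deriveV// -[RHS]/(- (g x) ^- 2 * 'D_v g x); congr (_ * _).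
by rewrite mulN1r expr2 invfM.
Qed.

Lemma derive_line (g : V -> R) (x v : V) :
  'D_v g x = 'D_1 (fun t : R => g (t *: v + x)) 0.
Proof.
rewrite /derive; set g1 := fun h : R => h^-1 *: _; set g2 := fun h : R => h^-1 *: _.
suff -> : g1 = g2 by [].
by rewrite funeqE /g1 /g2 => h /=; rewrite addr0 scale0r add0r [_%:A]mulr1.
Qed.

(** Restricting [g] to the line through [x] in direction [v] reduces the claim to the chain rule in
    one variable; directional derivability of [g] is thus enough. *)
Lemma is_derive_scomp (h : R -> R) g (x v : V) :
  derivable h (g x) 1 -> derivable g x v ->
  derivable (h \o g) x v /\ 'D_v (h \o g) x = 'D_1 h (g x) * 'D_v g x.
Proof.
move=> dh dg.
have g0 : g (0 *: v + x) = g x by rewrite scale0r add0r.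
have dG : derivable (fun t : R => g (t *: v + x)) 0 1.
  exact: ((derivable1P _ _ _).1 dg).
have dh' : derivable h (g (0 *: v + x)) 1 by rewrite g0.
have dhg : derivable (h \o (fun t : R => g (t *: v + x))) 0 1.
  by apply/derivable1_diffP; apply: differentiable_comp; apply/derivable1_diffP.
split; first exact: ((derivable1P _ _ _).2 dhg).
rewrite !derive_line -[LHS]/('D_1 (h \o (fun t : R => g (t *: v + x))) 0).
have H1 : is_derive (g (0 *: v + x)) 1 h ('D_1 h (g x)).
  by rewrite g0; exact: derivableP.
by have [_] := @is_derive1_comp R h (fun t : R => g (t *: v + x)) 0 _ _ H1 (derivableP dG).
Qed.

(** With all orders assumed, the derivative of [h] satisfies the same hypothesis, and the induction
    on [k] closes through the product rule. *)
Lemma sCk_comp k (h : R -> R) g : (forall j, @sCk R j h) -> (forall j, sCk j g) ->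
  sCk k (fun x => h (g x)).
Proof.
elim: k h => [|k IH] h Ch Cg.
  move=> x; apply: (@continuous_comp _ _ _ g h); first exact: (Cg 0%N).
  exact: (Ch 0%N).
split.
  move=> x; apply: (@continuous_comp _ _ _ g h); first exact: (Cg 0%N).
  exact: (Ch 0%N).
move=> v.
have dh y : derivable h y 1 by have [_ /(_ 1)[]] := Ch 1%N.
have dg x : derivable g x v by have [_ /(_ v)[]] := Cg 1%N.
split; first by move=> x; have [] := is_derive_scomp (dh (g x)) (dg x).
have C' j : @sCk R j (fun y => 'D_1 h y) by have [_ /(_ 1)[_]] := Ch j.+1.
have Cgv : sCk k (fun x => 'D_v g x) by have [_ /(_ v)[_]] := Cg k.+1.
apply: (sCk_ext _ (sCkM (IH _ C' Cg) Cgv)) => x.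
by have [_] := is_derive_scomp (dh (g x)) (dg x).
Qed.

End ScalarSmooth.

(** * A smooth monotone transition built from exp(-1/t) *)

Section FlatFunction.
Variable R : realType.

(** All the functions [t^(-m) exp(-1/t)] are kept, because derivatives of one are linear
    combinations of others; this makes smoothness a single induction. *)
Definition flat (m : nat) (t : R) : R := if 0 < t then t^-1 ^+ m * expR (- t^-1) else 0.

Lemma flat_ge0 m t : 0 <= flat m t.
Proof.
rewrite /flat; case: ifPn => // t0; rewrite mulr_ge0 ?expR_ge0// exprn_ge0// invr_ge0.
exact: ltW.
Qed.

(** With [u = 1 / t] and [k = m + 2], [exp u = (exp (u / k))^k >= (u / k)^k]. A quadratic bound is
    what makes the difference quotient at 0 tend to 0. *)
Lemma flat_le m t : flat m t <= m.+2%:R ^+ m.+2 * t ^+ 2.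
Proof.
rewrite /flat; case: ifPn => [t0|_]; last by rewrite mulr_ge0 ?sqr_ge0 ?exprn_ge0.
have u0 : 0 < t^-1 by rewrite invr_gt0.
have h : (t^-1 / m.+2%:R) ^+ m.+2 <= expR t^-1.
  have -> : t^-1 = m.+2%:R * (t^-1 / m.+2%:R) by rewrite mulrC divfK.
  rewrite mulrAC divff// mul1r expRM_natl.
  apply: lerXn2r; rewrite ?nnegrE ?expR_ge0 ?divr_ge0 ?(ltW u0)//.
  by apply: (le_trans _ (expR_ge1Dx _)); rewrite lerDr.
rewrite expRN ler_pdivrMr ?expR_gt0//.
apply: le_trans (ler_wpM2l _ h); last by rewrite mulr_ge0 ?sqr_ge0 ?exprn_ge0.
have tn : t != 0 by rewrite gt_eqF.
have : m.+2%:R ^+ m.+2 != 0 :> R by rewrite expf_neq0.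
rewrite expr_div_n [t^-1 ^+ m.+2]exprS [t^-1 ^+ m.+1]exprS.
move: (m.+2%:R ^+ m.+2) (t^-1 ^+ m) => K u Kn.
by rewrite (_ : K * t ^+ 2 * _ = u)//; field; rewrite Kn tn.
Qed.

Lemma is_derive_flat_pos m (t : R) : 0 < t ->
  is_derive t 1 (fun s => s^-1 ^+ m * expR (- s^-1))
    (t^-1 ^+ m.+2 * expR (- t^-1) - m%:R * (t^-1 ^+ m.+1 * expR (- t^-1))).
Proof.
move=> t0; have tn : t != 0 by rewrite gt_eqF.
have dV : is_derive t 1 (fun s : R => s^-1) (- t^-1 ^+ 2).
  split; first by apply: derivableV => //; exact: derivable_id.
  by rewrite deriveV// derive_id -[_ *: _]/(_ * _) mulr1 -exprVn.
have dX : is_derive t 1 (fun s : R => s^-1 ^+ m) (m%:R * t^-1 ^+ m.-1 * (- t^-1 ^+ 2)).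
  have h := @is_deriveX R R (fun s => s^-1) m t 1 _ dV.
  have -> : (fun s : R => s^-1 ^+ m) = (fun s : R => s^-1) ^+ m.
    by apply/funext => s; rewrite exprfctE.
  exact: h.
have dE : is_derive t 1 (fun s : R => expR (- s^-1)) (expR (- t^-1) * t^-1 ^+ 2).
  have dN : is_derive t 1 (fun s : R => - s^-1) (t^-1 ^+ 2).
    by have := @is_deriveN R R R (fun s => s^-1) t 1 _ dV; rewrite opprK.
  exact: (@is_derive1_comp R expR (fun s => - s^-1) t _ _ (is_derive_expR _) dN).
have := @is_deriveM R R _ _ t 1 _ _ dX dE.
move/is_derive_eq; apply.
rewrite -![_ *: _]/(_ * _).
case: m dX => [|m] _; first by rewrite /=; ring.
by rewrite /= !exprS; ring.
Qed.

Lemma is_derive_flat m (t : R) :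
  is_derive t 1 (flat m) (flat m.+2 t - m%:R * flat m.+1 t).
Proof.
case: (ltrgtP t 0) => [t0|t0|->].
- have ft j : flat j t = 0 by rewrite /flat ltNge (ltW t0).
  rewrite !ft mulr0 subr0.
  apply: (@near_eq_is_derive _ _ _ (cst 0)).
  by near=> s; rewrite /flat ltNge ltW//; near: s; exact: lt_nbhsl.
- rewrite /flat t0.
  apply: (near_eq_is_derive _ (is_derive_flat_pos m t0)).
  by near=> s; rewrite /flat ifT//; near: s; exact: lt_nbhsr.
- have f0 j : flat j 0 = 0 by rewrite /flat ltxx.
  rewrite !f0 mulr0 subr0.
  have lim0 : h^-1 *: ((flat m \o shift 0) (h *: (1 : R)) - flat m 0) @[h --> (0:R)^'] --> (0 : R).
    apply/cvgrPdist_le => e e0.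
    pose K : R := m.+2%:R ^+ m.+2.
    have K0 : 0 < K by rewrite exprn_gt0.
    near=> h.
    have hn : h != 0 by near: h; exact: nbhs_dnbhs_neq.
    rewrite sub0r normrN f0 subr0 /= /shift /= addr0 -[h *: 1]/(h * 1) mulr1.
    rewrite -[_ *: _]/(_ * _) normrM normfV (ger0_norm (flat_ge0 _ _)).
    rewrite ler_pdivrMl ?normr_gt0//.
    apply: (le_trans (flat_le m h)); rewrite -/K -(real_normK (num_real h)) expr2 mulrCA.
    rewrite ler_wpM2l// -ler_pdivlMl//.
    near: h; apply: dnbhs0_le; rewrite mulr_gt0// invr_gt0//.
  split; first exact: (cvgP _ lim0).
  exact: (cvg_lim _ lim0).
Unshelve. all: by end_near. Qed.

(** Even on the line [sCk] asks for derivatives in every direction, whereas the rules of calculus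
    give direction 1. *)
Lemma derive_R_scale (f : R -> R) (x v : R) : derivable f x 1 ->
  derivable f x v /\ 'D_v f x = v * 'D_1 f x.
Proof.
move=> d1; have df : differentiable f x by apply/derivable1_diffP.
split; first exact: diff_derivable.
by rewrite (deriveE _ df) (deriveE _ df) -[v in LHS]mulr1 -[v * 1]/(v *: 1) linearZ.
Qed.

Lemma sCk_flat k m : @sCk R R k (flat m).
Proof.
have cf j : continuous (flat j).
  move=> x; apply: differentiable_continuous; apply/derivable1_diffP.
  by have [] := is_derive_flat j x.
elim: k m => [|k IH] m; first exact: cf.
split=> // v; split.
  by move=> x; have [d _] := is_derive_flat m x; have [] := derive_R_scale v d.
have C1 := sCkM (sCk_cst R k v) (sCkD (IH m.+2) (sCkM (sCk_cst R k (- m%:R)) (IH m.+1))).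
apply: (sCk_ext _ C1) => x.
have [d dE] := is_derive_flat m x; have [_ ->] := derive_R_scale v d.
by rewrite dE mulNr.
Qed.

(** It falls from 1 at [t = 1] to 0 at [t = 2]. The denominator never vanishes since [2 - t] and
    [t - 1] are not both nonpositive. *)
Definition step (t : R) : R := flat 0 (2 - t) / (flat 0 (2 - t) + flat 0 (t - 1)).

Lemma flat_gt0 m t : 0 < t -> 0 < flat m t.
Proof. by move=> t0; rewrite /flat t0 mulr_gt0 ?expR_gt0// exprn_gt0// invr_gt0. Qed.

Lemma flat0_le s t : s <= t -> flat 0 s <= flat 0 t.
Proof.
move=> st; rewrite /flat !expr0 !mul1r; case: ifPn => s0; last first.
  by case: ifP => // _; rewrite expR_ge0.
have t0 := lt_le_trans s0 st.
by rewrite t0 ler_expR lerN2 lef_pV2.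
Qed.

Lemma step_den_gt0 t : 0 < flat 0 (2 - t) + flat 0 (t - 1).
Proof.
have [t2|t2] := ltP t 2.
  by rewrite ltr_wpDr ?flat_ge0// flat_gt0// subr_gt0.
by rewrite ltr_wpDl ?flat_ge0// flat_gt0// subr_gt0; lra.
Qed.

Lemma step01 t : 0 <= step t <= 1.
Proof.
rewrite /step divr_ge0 ?flat_ge0 ?(ltW (step_den_gt0 t))//=.
by rewrite ler_pdivrMr ?step_den_gt0// mul1r lerDl flat_ge0.
Qed.

Lemma step_le s t : s <= t -> step t <= step s.
Proof.
move=> st; rewrite /step ler_pdivrMr ?step_den_gt0// mulrAC ler_pdivlMr ?step_den_gt0//.
have h1 : flat 0 (2 - t) <= flat 0 (2 - s) by apply: flat0_le; lra.
have h2 : flat 0 (s - 1) <= flat 0 (t - 1) by apply: flat0_le; lra.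
have := flat_ge0 0 (2 - t); have := flat_ge0 0 (s - 1).
have := flat_ge0 0 (2 - s); have := flat_ge0 0 (t - 1).
move: (flat 0 (2 - t)) (flat 0 (2 - s)) (flat 0 (s - 1)) (flat 0 (t - 1)) h1 h2 => a b c d *.
rewrite !mulrDr [a * b]mulrC lerD2l; apply: ler_pM => //.
Qed.

Lemma step_eq1 t : t <= 1 -> step t = 1.
Proof.
move=> t1; rewrite /step.
have -> : flat 0 (t - 1) = 0 by rewrite /flat ltNge subr_le0 t1.
by rewrite addr0 divff// gt_eqF// flat_gt0//; lra.
Qed.

Lemma step_eq0 t : 2 <= t -> step t = 0.
Proof. by move=> t2; rewrite /step {1}/flat ltNge subr_le0 t2 mul0r. Qed.

Lemma sCk_id k : @sCk R R k id.
Proof.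
case: k => [|k]; first by move=> x; exact: cvg_id.
split; first by move=> x; exact: cvg_id.
move=> v; split; first by move=> x; exact: derivable_id.
by apply: (sCk_ext _ (sCk_cst R k v)) => x; rewrite derive_id.
Qed.

Lemma sCk_affine k (a b : R) : @sCk R R k (fun t => a * t + b).
Proof.
apply: sCkD; last exact: sCk_cst.
by apply: sCkM; [exact: sCk_cst|exact: sCk_id].
Qed.

Lemma sCk_step k : @sCk R R k step.
Proof.
have f1 j : @sCk R R j (fun t => flat 0 (2 - t)).
  apply: (sCk_ext _ (sCk_comp j (fun i => sCk_flat i 0) (fun i => sCk_affine i (-1) 2))) => t.
  by congr flat; ring.
have f2 j : @sCk R R j (fun t => flat 0 (t - 1)).
  apply: (sCk_ext _ (sCk_comp j (fun i => sCk_flat i 0) (fun i => sCk_affine i 1 (-1)))) => t.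
  by congr flat; ring.
apply: sCkM; first exact: f1.
apply: sCkV; first exact: step_den_gt0.
exact: sCkD.
Qed.

End FlatFunction.

(** * Smooth vector fields *)

Section VectorSmooth.
Variables (R : realType) (n : nat).
Local Notation rV := 'rV[R]_n.

Lemma continuous_rV_coords m (f : rV -> 'rV[R]_m) :
  (forall i, continuous (fun x => f x ord0 i)) -> continuous f.
Proof.
move=> cf x; have FF : Filter (nbhs (x : rV)) by exact: nbhs_filter.
apply/cvgrPdist_le => e e0.
have : \forall y \near x, forall i : 'I_m, `|f x ord0 i - f y ord0 i| <= e.
  have h i : \forall y \near x, `|f x ord0 i - f y ord0 i| <= e.
    by have /cvgrPdist_le/(_ _ e0) := cf i x.
  exact: (@filter_forall _ _ _ _ FF h).
apply: filterS => y hy.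
rewrite [leLHS]mx_normrE; apply: bigmax_le; first exact: ltW.
by move=> [i j] _ /=; rewrite (ord1 i) !mxE; exact: hy.
Qed.

Lemma CkP m k (f : rV -> 'rV[R]_m) :
  Ck k f <-> forall i, sCk k (fun x => f x ord0 i).
Proof.
elim: k f => [|k IH] f /=.
  split => [cf i x|cf]; last exact: continuous_rV_coords.
  apply: (@continuous_comp _ _ _ f (fun M : 'rV[R]_m => M ord0 i)); first exact: cf.
  exact: coord_continuous.
split => [[cf df] i|h].
- split.
    move=> x; apply: (@continuous_comp _ _ _ f (fun M : 'rV[R]_m => M ord0 i)); first exact: cf.
    exact: coord_continuous.
  move=> v; have [d1 d2] := df v; split.
    by move=> x; have /derivable_mxP := d1 x; exact.
  move/IH : d2 => /(_ i); apply: sCk_ext => x.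
  by rewrite derive_mx// mxE.
- split; first by apply: continuous_rV_coords => i; have [] := h i.
  move=> v.
  have d1 x : derivable f x v.
    by apply/derivable_mxP => i j; rewrite (ord1 i); have [_ /(_ v)[]] := h j.
  split => //; apply/IH => i.
  have [_ /(_ v)[_]] := h i; apply: sCk_ext => x.
  by rewrite derive_mx// mxE.
Qed.

Definition ssmooth (g : rV -> R) := forall k, sCk k g.

Lemma smoothP m (f : rV -> 'rV[R]_m) :
  smooth f <-> forall i, ssmooth (fun x => f x ord0 i).
Proof.
split => [h i k|h k]; first by have /CkP := h k; exact.
by apply/CkP => i; exact: h.
Qed.

Lemma smooth_continuous m (f : rV -> 'rV[R]_m) : smooth f -> continuous f.
Proof. by move=> h; exact: (h 0%N). Qed.

Lemma smooth_scale m (g : rV -> R) (f : rV -> 'rV[R]_m) :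
  ssmooth g -> smooth f -> smooth (fun x => g x *: f x).
Proof.
move=> hg /smoothP hf; apply/smoothP => i k.
by apply: (sCk_ext _ (sCkM (hg k) (hf i k))) => x; rewrite mxE.
Qed.

Lemma smoothD m (f g : rV -> 'rV[R]_m) :
  smooth f -> smooth g -> smooth (fun x => f x + g x).
Proof.
move=> /smoothP hf /smoothP hg; apply/smoothP => i k.
by apply: (sCk_ext _ (sCkD (hf i k) (hg i k))) => x; rewrite mxE.
Qed.

Lemma smooth_cst m (v : 'rV[R]_m) : smooth (fun _ : rV => v).
Proof. by apply/smoothP => i k; exact: sCk_cst. Qed.

Lemma ssmooth_coord i : ssmooth (fun x : rV => x ord0 i).
Proof.
move=> k; have cc : continuous (fun x : rV => x ord0 i) by exact: coord_continuous.
have H (v x : rV) : is_derive x v (fun x : rV => x ord0 i) (v ord0 i).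
  have d := @derivable_id R rV x v.
  split; first by have /derivable_mxP := d; exact.
  have := derive_mx d; rewrite derive_id => /matrixP/(_ ord0 i); rewrite mxE => E.
  exact: esym E.
case: k => [//|k]; split => // v; split; first by move=> x; have [] := H v x.
by apply: (sCk_ext _ (sCk_cst _ k (v ord0 i))) => x; have [_ ->] := H v x.
Qed.

Lemma ssmooth_enorm_sqr (c : rV) : ssmooth (fun x => enorm (x - c) ^+ 2).
Proof.
move=> k.
have C i : sCk k (fun x : rV => x ord0 i + - c ord0 i).
  by apply: sCkD; [exact: ssmooth_coord|exact: sCk_cst].
apply: (sCk_ext _ (sCk_sum (index_enum _) (fun i => sCkM (C i) (C i)))) => x.
by rewrite enorm_sqr /dotv; apply: eq_bigr => i _; rewrite !mxE.
Qed.

(** The profile is applied to the squared distance, a polynomial, so that the cutoff is smooth at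
    its centre too; hence [a] and [b] are squared radii. *)
Definition profile (a b t : R) : R := step (1 + (t - a) / (b - a)).
Definition cutoff (c : rV) (a b : R) (x : rV) : R := profile a b (enorm (x - c) ^+ 2).

Lemma profile01 a b t : 0 <= profile a b t <= 1.
Proof. exact: step01. Qed.

Lemma profile_le a b s t : a < b -> s <= t -> profile a b t <= profile a b s.
Proof.
move=> ab st; apply: step_le; rewrite lerD2l ler_pM2r ?invr_gt0 ?subr_gt0//.
by rewrite lerD2r.
Qed.

Lemma profile_eq1 a b t : a < b -> t <= a -> profile a b t = 1.
Proof.
move=> ab ta; apply: step_eq1; rewrite gerDl; rewrite pmulr_lle0 ?invr_gt0 ?subr_gt0//.
by rewrite subr_le0.
Qed.

Lemma profile_eq0 a b t : a < b -> b <= t -> profile a b t = 0.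
Proof.
move=> ab bt; apply: step_eq0.
have -> : 2 = 1 + 1 :> R by [].
by rewrite lerD2l ler_pdivlMr ?subr_gt0// mul1r lerD2r.
Qed.

Lemma ssmooth_cutoff c a b : ssmooth (cutoff c a b).
Proof.
move=> k; apply: (@sCk_comp R rV k (profile a b)); last exact: ssmooth_enorm_sqr.
move=> j.
apply: (sCk_ext _ (sCk_comp j (@sCk_step R) (fun i => sCk_affine i (b - a)^-1 (1 - a / (b - a))))) => t.
by rewrite /profile; congr step; ring.
Qed.

Lemma cutoff_ge0 c a b x : 0 <= cutoff c a b x.
Proof. by have /andP[] := profile01 a b (enorm (x - c) ^+ 2). Qed.

Lemma cutoff_le1 c a b x : cutoff c a b x <= 1.
Proof. by have /andP[] := profile01 a b (enorm (x - c) ^+ 2). Qed.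

Lemma ssmooth_continuous g : ssmooth g -> continuous g.
Proof. by move=> h; exact: (h 0%N). Qed.

Lemma measurable_cutoff c a b : measurable_fun [set: rVb R n] (cutoff c a b).
Proof. by apply: continuous_measurable_rV; apply: ssmooth_continuous; exact: ssmooth_cutoff. Qed.

Lemma compact_ecball (c : rV) (b : R) : compact [set x : rV | enorm (x - c) ^+ 2 <= b].
Proof.
apply: bounded_closed_compact.
  exists (`|c| + (b + 1)); split; first exact: num_real.
  move=> M hM x /= hx; apply: ltW; apply: le_lt_trans hM.
  rewrite -[x](subrK c) addrC; apply: (le_trans (ler_normD _ _)); rewrite lerD2l.
  apply: (le_trans (norm_le_enorm _)).
  have := enorm_ge0 (x - c); nra.
have -> : [set x : rV | enorm (x - c) ^+ 2 <= b] = (fun x => enorm (x - c) ^+ 2) @^-1` [set t | t <= b] by [].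
apply: closed_comp; last exact: closed_le.
by move=> x _; apply: ssmooth_continuous; exact: ssmooth_enorm_sqr.
Qed.

Lemma compact_enorm_bounded (K : set rV) : compact K ->
  exists2 M, 0 < M & forall x, K x -> enorm x <= M.
Proof.
move=> /compact_bounded[M [_ hM]].
exists (n%:R * (`|M| + 1) + 1); first by rewrite ltr_wpDl// mulr_ge0// addr_ge0.
move=> x Kx; apply: (le_trans (enorm_le_norm x)).
apply: (@le_trans _ _ (n%:R * (`|M| + 1))); last by rewrite lerDl.
rewrite ler_wpM2l//; apply: hM => //.
by apply: (le_lt_trans (ler_norm M)); rewrite ltrDl.
Qed.

Lemma derive_bounded (g : rV -> R) (K : set rV) (v : rV) :
  ssmooth g -> compact K -> (forall x, ~ K x -> g x = 0) ->
  exists2 L, 0 <= L & forall x, `|'D_v g x| <= L.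
Proof.
move=> sg cK g0.
have cD : continuous (fun x => 'D_v g x).
  by have [_ /(_ v)[_ h]] := sg 1%N; exact: h.
have : compact ((fun x => 'D_v g x) @` K).
  apply: continuous_compact => //; exact: continuous_subspaceT.
move=> /compact_bounded[M [_ hM]].
exists (`|M| + 1); first by rewrite addr_ge0.
move=> x; case: (pselect (K x)) => Kx.
  apply: hM; first by apply: (le_lt_trans (ler_norm M)); rewrite ltrDl.
  by exists x.
suff -> : 'D_v g x = 0 by rewrite normr0 addr_ge0.
rewrite -(derive_cst (0 : R) x v); apply: near_eq_derive.
have oK : open (~` K) by rewrite openC; exact: compact_closed.
have : nbhs x (~` K) by exact: open_nbhs_nbhs.
by apply: filterS => y Ky; rewrite g0.
Qed.

Lemma lipschitz_line (g : rV -> R) (v x : rV) (L : R) : ssmooth g ->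
  (forall x, `|'D_v g x| <= L) -> forall t : R, `|g (x + t *: v) - g x| <= L * `|t|.
Proof.
move=> sg hL.
pose G (t : R) := g (x + t *: v).
have dG (t : R) : is_derive t (1 : R) G ('D_v g (x + t *: v)).
  have [_ /(_ v)[dg _]] := sg 1%N.
  have h := (derivable1P _ _ _).1 (dg (x + t *: v)).
  have E : (fun s : R => g (s *: v + (x + t *: v))) = G \o (fun s => s + t).
    by apply/funext => s; rewrite /G /= scalerDl addrCA.
  rewrite E in h.
  have dG0 : derivable G t 1.
    have -> : G = (G \o (fun s : R => s + t)) \o (fun s : R => s - t).
      by apply/funext => s /=; rewrite subrK.
    apply/derivable1_diffP; apply: differentiable_comp.
      by apply/derivable1_diffP; apply: derivableB; [exact: derivable_id|exact: derivable_cst].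
    by rewrite subrr; apply/derivable1_diffP.
  split => //; rewrite (derive_line g (x + t *: v) v) E.
  have d0 : is_derive (0 : R) 1 (fun s : R => s + t) 1.
    have := @is_deriveD R R R id (cst t) 0 1 _ _ (is_derive_id _ _) (is_derive_cst _ _ _).
    by rewrite addr0.
  have d1 : is_derive ((fun s : R => s + t) 0) 1 G ('D_1 G t).
    by rewrite add0r; exact: derivableP.
  by have [_ ->] := @is_derive1_comp R G (fun s : R => s + t) 0 _ _ d1 d0; rewrite mulr1.
have cG : continuous G.
  by move=> t; apply: differentiable_continuous; apply/derivable1_diffP; have [] := dG t.
have step a b : a <= b -> `|G b - G a| <= L * (b - a).
  move=> ab; have [|d _ ->] := MVT_segment ab (fun t _ => dG t).
    exact: continuous_subspaceT.
  by rewrite normrM [`|b - a|]ger0_norm ?subr_ge0// ler_wpM2r ?subr_ge0.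
move=> t; have G0 : G 0 = g x by rewrite /G scale0r addr0.
rewrite -G0 -/(G t); have [t0|t0] := leP 0 t.
  by apply: (le_trans (step _ _ t0)); rewrite subr0 ger0_norm.
rewrite distrC; apply: (le_trans (step _ _ (ltW t0))).
by rewrite sub0r ltr0_norm.
Qed.

(** Partial derivatives are bounded by compactness; the mean value theorem is applied along one
    coordinate axis after another. *)
Lemma smooth_lipschitz m (f : rV -> 'rV[R]_m) (K : set rV) :
  smooth f -> compact K -> (forall x, ~ K x -> f x = 0) ->
  exists2 L, 0 <= L & forall x z, enorm (f (x + z) - f x) <= L * enorm z.
Proof.
move=> sf cK f0.
have scal (g : rV -> R) : ssmooth g -> (forall x, ~ K x -> g x = 0) ->
    exists2 L, 0 <= L & forall x z, `|g (x + z) - g x| <= L * enorm z.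
  move=> sg g0.
  have /choice[L hL] : forall i : 'I_n, exists L,
      0 <= L /\ forall x, `|'D_(delta_mx ord0 i : rV) g x| <= L.
    by move=> i; have [L ? ?] := derive_bounded (delta_mx ord0 i) sg cK g0; exists L.
  exists (\sum_i L i); first by apply: sumr_ge0 => i _; have [] := hL i.
  move=> x z.
  have key (s : seq 'I_n) : `|g (x + \sum_(i <- s) z ord0 i *: delta_mx ord0 i) - g x|
      <= (\sum_(i <- s) L i) * enorm z.
    elim: s => [|i s IH]; first by rewrite !big_nil addr0 subrr normr0 mul0r.
    rewrite !big_cons mulrDl.
    set w : rV := \sum_(j <- s) _ *: _ in IH *.
    have -> : g (x + (z ord0 i *: delta_mx ord0 i + w)) - g x =
      (g ((x + w) + z ord0 i *: delta_mx ord0 i) - g (x + w)) + (g (x + w) - g x).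
      have -> : x + (z ord0 i *: delta_mx ord0 i + w) = x + w + z ord0 i *: delta_mx ord0 i.
        by rewrite addrA addrAC.
      by ring.
    apply: (le_trans (ler_normD _ _)); apply: lerD => //.
    have [L0 hLi] := hL i.
    apply: (le_trans (lipschitz_line (x + w) sg hLi _)).
    by rewrite ler_wpM2l// coord_le_enorm.
  by have := key (index_enum _); rewrite -row_sum_coord.
have /choice[L hL] : forall i : 'I_m, exists L,
    0 <= L /\ forall x z, `|f (x + z) ord0 i - f x ord0 i| <= L * enorm z.
  move=> i; have /smoothP/(_ i) := sf => /scal[|L ? ?]; last by exists L.
  by move=> x /f0 ->; rewrite mxE.
exists (\sum_i L i); first by apply: sumr_ge0 => i _; have [] := hL i.
move=> x z; apply: (le_trans (enorm_le_sum _)); rewrite mulr_suml.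
by apply: ler_sum => i _; rewrite !mxE; have [_] := hL i; exact.
Qed.

End VectorSmooth.

(** * Fractional divergence *)

Section FracDiv.
Variables (R : realType) (n : nat) (al : R).
Hypothesis al01 : 0 < al < 1.
Local Notation rV := 'rV[R]_n.
Local Notation leb := (lebrV R n).
Local Notation mu := (mu_const n al).

Let al0 : 0 < al. Proof. by case/andP: al01. Qed.

Lemma RintE (g : rV -> R) : leb.-integrable setT (EFin \o g) ->
  Defs.Rint g = Rintegral leb setT g.
Proof. by move=> ig; rewrite /Defs.Rint (integrable_LintE ig). Qed.

Lemma measurable_add_rV :
  measurable_fun [set: rVb R n * rVb R n] ((fun p => (p.1 + p.2 : rV)) : rVb R n * rVb R n -> rVb R n).
Proof.
apply: measurable_fun_rV => i.
have m1 : measurable_fun [set: rVb R n * rVb R n] (fun p : rVb R n * rVb R n => (p.1 : rV) ord0 i).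
  exact: (measurable_comp_fst (@measurable_rV_coord R n i)).
have m2 : measurable_fun [set: rVb R n * rVb R n] (fun p : rVb R n * rVb R n => (p.2 : rV) ord0 i).
  exact: (measurable_comp_snd (@measurable_rV_coord R n i)).
rewrite (_ : (fun _ => _) = (fun p : rVb R n * rVb R n => (p.1 : rV) ord0 i + (p.2 : rV) ord0 i)).
  exact: measurable_funD.
by apply/funext => p; rewrite mxE.
Qed.

Lemma measurable_sub_rV :
  measurable_fun [set: rVb R n * rVb R n] ((fun p => (p.2 - p.1 : rV)) : rVb R n * rVb R n -> rVb R n).
Proof.
apply: measurable_fun_rV => i.
have m1 : measurable_fun [set: rVb R n * rVb R n] (fun p : rVb R n * rVb R n => (p.1 : rV) ord0 i).
  exact: (measurable_comp_fst (@measurable_rV_coord R n i)).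
have m2 : measurable_fun [set: rVb R n * rVb R n] (fun p : rVb R n * rVb R n => (p.2 : rV) ord0 i).
  exact: (measurable_comp_snd (@measurable_rV_coord R n i)).
rewrite (_ : (fun _ => _) = (fun p : rVb R n * rVb R n => (p.2 : rV) ord0 i - (p.1 : rV) ord0 i)).
  exact: measurable_funB.
by apply/funext => p; rewrite !mxE.
Qed.

Lemma measurable_comp_add (g : rV -> R) : measurable_fun [set: rVb R n] g ->
  measurable_fun [set: rVb R n * rVb R n] (fun p : rVb R n * rVb R n => g (p.1 + p.2)).
Proof. by move=> mg; exact: (measurableT_comp mg measurable_add_rV). Qed.

Lemma measurable_comp_sub (g : rV -> R) : measurable_fun [set: rVb R n] g ->
  measurable_fun [set: rVb R n * rVb R n] (fun p : rVb R n * rVb R n => g (p.2 - p.1)).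
Proof. by move=> mg; exact: (measurableT_comp mg measurable_sub_rV). Qed.

Lemma measurable_enorm_diff (phi : rV -> rV) : continuous phi ->
  measurable_fun [set: rVb R n * rVb R n]
    (fun p : rVb R n * rVb R n => enorm (phi (p.1 + p.2) - phi p.1)).
Proof.
move=> cphi.
have mv : measurable_fun [set: rVb R n * rVb R n]
    ((fun p => (phi (p.1 + p.2) - phi p.1 : rV)) : rVb R n * rVb R n -> rVb R n).
  apply: measurable_fun_rV => i.
  have mc := continuous_measurable_rVb cphi i.
  rewrite (_ : (fun _ => _) = (fun p : rVb R n * rVb R n => phi (p.1 + p.2) ord0 i - phi p.1 ord0 i)).
    apply: measurable_funB; first exact: (measurable_comp_add mc).
    exact: (measurable_comp_fst mc).
  by apply/funext => p; rewrite !mxE.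
exact: (measurableT_comp (@measurable_enorm R n) mv).
Qed.

(** What absolute convergence of the fractional divergence and of its pairing asks of a field. In
    contrast to test fields, bounded by 1, these fields form a vector space, as linearity of the
    pairing requires. *)
Definition nice (phi : rV -> rV) := exists L M : R,
  [/\ 0 <= L, 0 < M, continuous phi,
      forall x z, enorm (phi (x + z) - phi x) <= L * mint 1 z
    & forall x, M < enorm x -> phi x = 0].

Lemma nice_smooth (phi : rV -> rV) (K : set rV) :
  smooth phi -> compact K -> (forall x, ~ K x -> phi x = 0) -> nice phi.
Proof.
move=> sphi cK phi0.
have [L L0 hL] := smooth_lipschitz sphi cK phi0.
have [M M0 hM] := compact_enorm_bounded cK.
have cphi := smooth_continuous sphi.
have : compact (phi @` K) by apply: continuous_compact => //; exact: continuous_subspaceT.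
move=> /compact_enorm_bounded[B B0 hB].
have hB' x : enorm (phi x) <= B.
  case: (pselect (K x)) => Kx; first by apply: hB; exists x.
  by rewrite phi0// enorm0 ltW.
exists (L + 2 * B), M; split => //.
- by rewrite addr_ge0// mulr_ge0// ltW.
- move=> x z.
  have h1 := hL x z.
  have h2 : enorm (phi (x + z) - phi x) <= 2 * B.
    apply: (le_trans (enormD _ _)); rewrite enormN.
    by have := hB' (x + z); have := hB' x; lra.
  rewrite /mint divr1; have z0 := enorm_ge0 z.
  case: (leP (enorm z) 1) => hz; first by nra.
  by nra.
- move=> x hx; apply: phi0 => /hM; by rewrite leNgt hx.
Qed.

Lemma niceD phi psi : nice phi -> nice psi -> nice (fun x => phi x + psi x).
Proof.
move=> [L1 [M1 [L10 M10 c1 h1 s1]]] [L2 [M2 [L20 M20 c2 h2 s2]]].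
exists (L1 + L2), (Num.max M1 M2); split.
- exact: addr_ge0.
- by rewrite lt_max M10.
- apply: continuous_rV_coords => i.
  have h := sCkD ((CkP 0 phi).1 c1 i) ((CkP 0 psi).1 c2 i).
  by apply: (sCk_ext (k := 0) _ h) => x; rewrite mxE.
- move=> x z; rewrite opprD addrACA mulrDl; apply: (le_trans (enormD _ _)).
  exact: lerD.
- by move=> x; rewrite gt_max => /andP[/s1 -> /s2 ->]; rewrite addr0.
Qed.

Lemma niceZ a phi : nice phi -> nice (fun x => a *: phi x).
Proof.
move=> [L1 [M1 [L10 M10 c1 h1 s1]]]; exists (`|a| * L1), M1; split => //.
- exact: mulr_ge0.
- apply: continuous_rV_coords => i.
  have h := sCkM (sCk_cst rV 0 a) ((CkP 0 phi).1 c1 i).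
  by apply: (sCk_ext (k := 0) _ h) => x; rewrite mxE.
- by move=> x z; rewrite -scalerBr enormZ -mulrA ler_wpM2l.
- by move=> x /s1 ->; rewrite scaler0.
Qed.

Definition fdker (phi : rV -> rV) (x y : rV) : R :=
  dotv (y - x) (phi y - phi x) / enorm (y - x) `^ (n%:R + al + 1).

(** Cauchy-Schwarz cancels one power of [|z|]. At [z = 0] the left side is 0 by convention: the
    power is 0 and so is its inverse. *)
Lemma kern_dotv (z w : rV) :
  `|dotv z w / enorm z `^ (n%:R + al + 1)| <= enorm w * kern al z.
Proof.
have e0 : 0 < n%:R + al + 1 :> R by rewrite -addrA ltr_wpDl// addr_gt0.
have [z0|z0] := eqVneq (enorm z) 0.
  rewrite z0 powR0 ?gt_eqF// invr0 mulr0 normr0 mulr_ge0 ?enorm_ge0 ?kern_ge0//.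
have zp : 0 < enorm z by rewrite lt_neqAle eq_sym z0 enorm_ge0.
rewrite normrM normfV [`|_ `^ _|]ger0_norm ?powR_ge0// ler_pdivrMr ?powR_gt0//.
apply: (le_trans (abs_dotv _ _)).
rewrite -mulrA /kern -powRD; last by rewrite z0 implybT.
rewrite (_ : _ + _ = 1); last by ring.
by rewrite powRr1 ?enorm_ge0// mulrC.
Qed.

Lemma measurable_fdker phi : continuous phi ->
  measurable_fun [set: rVb R n * rVb R n] (fun p : rVb R n * rVb R n => fdker phi p.1 p.2).
Proof.
move=> cphi.
have -> : (fun p : rVb R n * rVb R n => fdker phi p.1 p.2) =
    (fun p : rVb R n * rVb R n =>
      (\sum_i (((p.2 : rV) ord0 i - (p.1 : rV) ord0 i) * (phi p.2 ord0 i - phi p.1 ord0 i)))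
      * enorm ((p.2 : rV) - p.1) `^ (- (n%:R + al + 1))).
  apply/funext => p; rewrite /fdker powRN /dotv; congr (_ * _).
  by apply: eq_bigr => i _; rewrite !mxE.
apply: measurable_funM; last first.
  apply: (measurableT_comp (measurable_powR _)).
  exact: (measurable_comp_sub (@measurable_enorm R n)).
apply: measurable_sum => i.
have mc := continuous_measurable_rVb cphi i.
apply: measurable_funM; apply: measurable_funB.
- exact: (measurable_comp_snd (@measurable_rV_coord R n i)).
- exact: (measurable_comp_fst (@measurable_rV_coord R n i)).
- exact: (measurable_comp_snd mc).
- exact: (measurable_comp_fst mc).
Qed.

Lemma measurable_fdker_section phi x : continuous phi ->
  measurable_fun [set: rVb R n] (fdker phi x).
Proof.
move=> cphi.
exact: (measurableT_comp (measurable_fdker cphi) (measurable_pair1 (x : rVb R n))).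
Qed.

Lemma section_bound (F D : rV -> R) (x : rV) :
  measurable_fun [set: rVb R n] F -> measurable_fun [set: rVb R n] D ->
  (forall y, 0 <= D y) ->
  (forall y, `|F y| <= D y * kern al (y - x)) ->
  (\int[leb]_y (`|F y|)%:E <= \int[leb]_z (D (x + z)%R * kern al z)%:E)%E.
Proof.
move=> mF mD D0 FD.
have mk : measurable_fun [set: rVb R n] (fun y => kern al (y - x)).
  exact: (measurableT_comp (@measurable_kern R n al) (measurable_shift_rV (- x))).
have mDk : measurable_fun [set: rVb R n] (fun y => D y * kern al (y - x)).
  exact: measurable_funM.
have maF : measurable_fun [set: rVb R n] (fun y => `|F y|) by exact: measurableT_comp.
apply: (le_trans (ge0_le_integral_rV maF mDk (fun=> normr_ge0 _) FD)).
have Dk0 y : 0 <= D y * kern al (y - x) by rewrite mulr_ge0 ?kern_ge0.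
rewrite -(ge0_integral_rV_shift_EFin x mDk Dk0).
by apply: ler_eq; apply: eq_integral => z _; rewrite addrK [(z + x)%R]addrC.
Qed.

Lemma nice_section phi x : nice phi ->
  (\int[leb]_z (enorm (phi (x + z)%R - phi x) * kern al z)%:E < +oo)%E.
Proof.
move=> [L [M [L0 M0 c1 h1 s1]]].
have mph : measurable_fun [set: rVb R n] (fun z => enorm (phi (x + z) - phi x)).
  exact: (measurableT_comp (measurable_enorm_diff c1) (measurable_pair1 (x : rVb R n))).
have mk := @measurable_kern R n al.
have mm := @measurable_mint R n 1.
have m1 : measurable_fun [set: rVb R n] (fun z => mint 1 z `^ 1 * kern al z).
  by apply: measurable_funM => //; exact: (measurableT_comp (measurable_powR _) mm).
apply: (@le_lt_trans _ _ (\int[leb]_z (L * (mint 1 z `^ 1 * kern al z))%:E)%E).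
  apply: ge0_le_integral_rV => //.
  - exact: measurable_funM.
  - exact: measurable_funM.
  - by move=> z; rewrite mulr_ge0 ?enorm_ge0 ?kern_ge0.
  - by move=> z; rewrite mulrA ler_wpM2r ?kern_ge0// powRr1 ?mint_ge0.
under eq_integral do rewrite EFinM.
rewrite ge0_integralZl//; first last.
- by move=> z _; rewrite lee_fin mulr_ge0 ?powR_ge0 ?kern_ge0.
- by apply/measurable_EFinP.
apply: lte_mul_pinfty; rewrite ?lee_fin//.
(* For a Lipschitz field the near part carries the full power [|z|], so the kernel estimate is used
   with [b = 1] and needs only [alpha < 1]. *)
case/andP: al01 => a0 a1.
by apply: (le_lt_trans (integral_mint_kern n a0 a1 ltr01)); rewrite ltry.
Qed.

Lemma integrable_fdker phi x : nice phi ->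
  leb.-integrable setT (EFin \o fdker phi x).
Proof.
move=> nphi; have [L [M [L0 M0 c1 h1 s1]]] := nphi.
have mF := measurable_fdker_section x c1.
apply/integrableP; split; first exact/measurable_EFinP.
apply: le_lt_trans (nice_section x nphi).
have mD : measurable_fun [set: rVb R n] (fun y => enorm (phi y - phi x)).
  have mv : measurable_fun [set: rVb R n] ((fun y : rVb R n => (phi y - phi x : rV)) : rVb R n -> rVb R n).
    apply: measurable_fun_rV => i.
    have mc := continuous_measurable_rVb c1 i.
    rewrite (_ : (fun _ => _) = (fun y : rVb R n => phi y ord0 i - phi x ord0 i)).
      exact: measurable_funB.
    by apply/funext => p; rewrite !mxE.
  exact: (measurableT_comp (@measurable_enorm R n) mv).
apply: (@section_bound _ (fun y => enorm (phi y - phi x)) x) => //.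
- by move=> y; exact: enorm_ge0.
- by move=> y; exact: kern_dotv.
Qed.

Lemma frac_divE phi x : nice phi ->
  frac_div al phi x = mu * Rintegral leb setT (fdker phi x).
Proof. by move=> nphi; rewrite /frac_div RintE//; exact: integrable_fdker. Qed.

Lemma frac_divD phi psi x : nice phi -> nice psi ->
  frac_div al (fun y => phi y + psi y) x = frac_div al phi x + frac_div al psi x.
Proof.
move=> n1 n2; rewrite !frac_divE//; last exact: niceD.
rewrite -mulrDr -RintegralD//; try exact: integrable_fdker.
congr (_ * _); apply: eq_Rintegral => y _; rewrite /fdker -mulrDl -dotvDr.
by congr (dotv _ _ / _); rewrite opprD addrACA.
Qed.

Lemma frac_divZ a phi x : nice phi ->
  frac_div al (fun y => a *: phi y) x = a * frac_div al phi x.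
Proof.
move=> n1; rewrite !frac_divE//; last exact: niceZ.
have i1 := integrable_fdker x n1.
rewrite [RHS]mulrCA; congr (_ * _).
have -> : a * Rintegral leb setT (fdker phi x) =
    Rintegral leb setT (fun y => a * fdker phi x y) by rewrite RintegralZl.
apply: eq_Rintegral => y _; rewrite /fdker mulrA -dotvZr.
by rewrite scalerBr.
Qed.

Lemma abs_Rintegral_le (F : rV -> R) : measurable_fun [set: rVb R n] F ->
  ((`|Rintegral leb setT F|)%:E <= \int[leb]_y (`|F y|)%:E)%E.
Proof.
move=> mF.
have [h|h] := eqVneq (\int[leb]_y (`|F y|)%:E)%E +oo%E; first by rewrite h leey.
have iF : leb.-integrable setT (EFin \o F).
  by apply/integrableP; split; [exact/measurable_EFinP|rewrite ltey].
rewrite /Rintegral -abse_EFin fineK; last exact: integrable_fin_num.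
by apply: le_abse_integral => //; exact/measurable_EFinP.
Qed.

Lemma frac_div_bound phi x : nice phi ->
  ((`|frac_div al phi x|)%:E <=
   (`|mu|)%:E * \int[leb]_z (enorm (phi (x + z)%R - phi x) * kern al z)%:E)%E.
Proof.
move=> nphi; have [L [M [L0 M0 c1 h1 s1]]] := nphi.
have mF := measurable_fdker_section x c1.
rewrite frac_divE// normrM EFinM; apply: lee_wpmul2l; first by rewrite lee_fin.
apply: (le_trans (abs_Rintegral_le mF)).
have mD : measurable_fun [set: rVb R n] (fun y => enorm (phi y - phi x)).
  have mv : measurable_fun [set: rVb R n] ((fun y : rVb R n => (phi y - phi x : rV)) : rVb R n -> rVb R n).
    apply: measurable_fun_rV => i.
    have mc := continuous_measurable_rVb c1 i.
    rewrite (_ : (fun _ => _) = (fun y : rVb R n => phi y ord0 i - phi x ord0 i)).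
      exact: measurable_funB.
    by apply/funext => p; rewrite !mxE.
  exact: (measurableT_comp (@measurable_enorm R n) mv).
apply: (@section_bound _ (fun y => enorm (phi y - phi x)) x) => //.
- by move=> y; exact: enorm_ge0.
- by move=> y; exact: kern_dotv.
Qed.

(** The terms in [phi x] cancel, and [(eta x - eta y) phi y] remains in the integrand. The error
    therefore involves no difference of [phi], only the bound [|phi| <= 1]. *)
Lemma frac_div_leibniz (eta : rV -> R) phi x :
  continuous eta -> nice phi -> nice (fun y => eta y *: phi y) ->
  (forall y, enorm (phi y) <= 1) ->
  ((`|eta x * frac_div al phi x - frac_div al (fun y => eta y *: phi y) x|)%:E <=
   (`|mu|)%:E * \int[leb]_z (`|eta (x + z)%R - eta x| * kern al z)%:E)%E.
Proof.
move=> ceta n1 n2 phi1.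
have i1 := integrable_fdker x n1; have i2 := integrable_fdker x n2.
have [L [M [L0 M0 c1 h1 s1]]] := n1; have [L' [M' [_ _ c2 _ _]]] := n2.
have -> : eta x * frac_div al phi x - frac_div al (fun y => eta y *: phi y) x =
    mu * Rintegral leb setT (fun y => eta x * fdker phi x y - fdker (fun y => eta y *: phi y) x y).
  rewrite !frac_divE// RintegralB//; last first.
    by apply: (integrableZl _ (eta x) i1).
  by rewrite RintegralZl// mulrBr mulrCA.
rewrite normrM EFinM; apply: lee_wpmul2l; first by rewrite lee_fin.
have meta := continuous_measurable_rV ceta.
have mF : measurable_fun [set: rVb R n]
    (fun y => eta x * fdker phi x y - fdker (fun y => eta y *: phi y) x y).
  apply: measurable_funB; last exact: measurable_fdker_section.
  by apply: measurable_funM => //; exact: measurable_fdker_section.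
apply: (le_trans (abs_Rintegral_le mF)).
apply: (@section_bound _ (fun y => `|eta y - eta x|) x) => //.
- by apply: measurableT_comp => //; exact: measurable_funB.
- move=> y.
  have -> : eta x * fdker phi x y - fdker (fun y => eta y *: phi y) x y =
      dotv (y - x) ((eta x - eta y) *: phi y) / enorm (y - x) `^ (n%:R + al + 1).
    rewrite /fdker mulrA -mulrBl -dotvZr -dotvBr; congr (dotv _ _ / _).
    by rewrite scalerBr scalerBl opprB addrA subrK.
  apply: (le_trans (kern_dotv _ _)); rewrite ler_wpM2r ?kern_ge0//.
  rewrite enormZ distrC -[leRHS]mulr1 ler_wpM2l//.
Qed.

(** Tonelli's measurability statement concerns nonnegative integrands, so it is applied to the
    positive and the negative part separately. *)
Lemma measurable_frac_div phi : nice phi ->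
  measurable_fun [set: rVb R n] (frac_div al phi).
Proof.
move=> nphi; have [L [M [L0 M0 c1 h1 s1]]] := nphi.
have -> : frac_div al phi = (fun x => mu * Rintegral leb setT (fdker phi x)).
  by apply/funext => x; exact: frac_divE.
apply: measurable_funM => //.
pose G (p : rVb R n * rVb R n) : \bar R := (fdker phi p.1 p.2)%:E.
have mG : measurable_fun setT G by apply/measurable_EFinP; exact: measurable_fdker.
have mp : measurable_fun [set: rVb R n] (fun x => \int[leb]_y (G^\+ (x, y)))%E.
  apply: (@measurable_fun_fubini_tonelli_F _ _ _ _ R leb (G^\+)%E) => //.
  exact: measurable_funepos.
have mn : measurable_fun [set: rVb R n] (fun x => \int[leb]_y (G^\- (x, y)))%E.
  apply: (@measurable_fun_fubini_tonelli_F _ _ _ _ R leb (G^\-)%E) => //.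
  exact: measurable_funeneg.
have -> : (fun x : rVb R n => Rintegral leb setT (fdker phi x)) =
    fine \o (fun x : rVb R n => \int[leb]_y (G^\+ (x, y)) - \int[leb]_y (G^\- (x, y)))%E.
  apply/funext => x; rewrite /Rintegral integralE /comp.
  have e1 : ((fun y : rVb R n => (fdker phi x y)%:E)^\+ = (fun y => G^\+ (x, y)))%E.
    by apply/funext => y; rewrite !funeposE.
  have e2 : ((fun y : rVb R n => (fdker phi x y)%:E)^\- = (fun y => G^\- (x, y)))%E.
    by apply/funext => y; rewrite !funenegE.
  by rewrite e1 e2.
apply: measurableT_comp; first exact: fine_measurable.
exact: emeasurable_funB.
Qed.

End FracDiv.

(** * The pairing of f with the fractional divergence *)

Section Pairing.
Variables (R : realType) (n : nat) (al : R) (p : \bar R) (q : R).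
Local Notation rV := 'rV[R]_n.
Local Notation leb := (lebrV R n).
Local Notation mu := (mu_const n al).
Hypothesis n0 : (0 < n)%N.
Hypothesis al01 : 0 < al < 1.
Hypothesis q1 : 1 <= q.
Hypothesis alq : al < q^-1.
Hypothesis pq :
  (p = +oo%E /\ q = 1) \/ (exists p' : R, [/\ p = p'%:E, 0 < p' & p'^-1 + q^-1 = 1]).

Let al0 : 0 < al. Proof. by case/andP: al01. Qed.
Let q0 : 0 < q. Proof. exact: lt_le_trans q1. Qed.

Variable f : rV -> R.
Hypothesis mf : measurable_fun [set: rVb R n] f.
Hypothesis fin : (Lpnorm p f < +oo)%E.

Definition ediff (phi : rV -> rV) (x z : rV) : R := enorm (phi (x + z) - phi x).
Definition adiff (eta : rV -> R) (x z : rV) : R := `|eta (x + z) - eta x|.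

Definition nonlocal (D : rV -> rV -> R) : \bar R :=
  (\int[leb]_x \int[leb]_z (`|f x| * D x z * kern al z)%:E)%E.

(** The constant depends on [phi], which is harmless: it serves for integrability and, through the
    factor [fine (Lpnorm p f)], to see that pairings are nonpositive when the norm is 0. *)
Lemma nonlocal_nice phi : nice phi ->
  exists C : R, (nonlocal (ediff phi) <= (C * fine (Lpnorm p f))%:E)%E.
Proof.
move=> [L [M [L0 M0 c1 h1 s1]]].
(* The difference vanishes unless [x] or [x + z] is in the ball of radius [M]; each condition costs
   a volume of at most [(2 M)^n]. *)
pose Q := L `^ q * (2 * (2 * M) ^+ n).
have Q0 : 0 <= Q by rewrite mulr_ge0 ?powR_ge0// mulr_ge0// exprn_ge0// mulr_ge0// ltW.
exists (dyadic_const n al q^-1 * Q `^ q^-1).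
apply: le_trans (_ : (_ <= (dyadic_const n al q^-1 * Q `^ q^-1 * fine (Lpnorm p f)
    * 1 `^ (n%:R / q - al))%:E)%E) _; last by rewrite powR1 mulr1.
apply: (nonlocal_bound pq q0 al0 alq ltr01 Q0 mf fin
  (measurable_enorm_diff c1) (fun _ _ => enorm_ge0 _)).
move=> z; rewrite expr1n mulr1.
have mi := mint_ge0 z ltr01 : 0 <= mint 1 z.
have mi1 := mint_le1 1 z.
pose ind (x : rV) : R := \1_(@cball R n M) x.
have mind : measurable_fun [set: rVb R n] ind.
  by apply: measurable_indic; exact: measurable_cball.
have ind0 x : 0 <= ind x by rewrite /ind indicE.
have mindz : measurable_fun [set: rVb R n] (fun x => ind (x + z)).
  exact: (measurableT_comp mind (measurable_shift_rV z)).
have mD : measurable_fun [set: rVb R n] (fun x => enorm (phi (x + z) - phi x) `^ q).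
  apply: (measurableT_comp (measurable_powR _)).
  exact: (measurableT_comp (measurable_enorm_diff c1) (measurable_pair2 (z : rVb R n))).
pose c := L `^ q * mint 1 z.
have c0 : 0 <= c by rewrite mulr_ge0 ?powR_ge0.
have mB : measurable_fun [set: rVb R n] (fun x => ind x + ind (x + z)) by exact: measurable_funD.
have B0 x : 0 <= ind x + ind (x + z) by rewrite addr_ge0.
have mcB : measurable_fun [set: rVb R n] (fun x => c * (ind x + ind (x + z))).
  exact: measurable_funM.
have hle x : enorm (phi (x + z) - phi x) `^ q <= c * (ind x + ind (x + z)).
  have [h|h] := eqVneq (ind x + ind (x + z)) 0.
    have : ind x = 0 /\ ind (x + z) = 0 by have := ind0 x; have := ind0 (x + z); lra.
    rewrite /ind !indicE; case: (boolP (x \in _)) => [_ [/eqP]|hx]; first by rewrite oner_eq0.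
    case: (boolP (x + z \in _)) => [_ [_ /eqP]|hxz _]; first by rewrite oner_eq0.
    rewrite (s1 x); last by rewrite ltNge; apply/negP => hc; move/negP: hx; apply; rewrite inE.
    rewrite (s1 (x + z)); last by rewrite ltNge; apply/negP => hc; move/negP: hxz; apply; rewrite inE.
    by rewrite subrr enorm0 powR0 ?gt_eqF// mulr_ge0.
  have h' : 1 <= ind x + ind (x + z).
    move: h; rewrite /ind !indicE; case: (x \in _); case: (x + z \in _) => //=; rewrite ?addr0 ?add0r ?eqxx// => _.
    by rewrite lerDl.
  apply: (@le_trans _ _ c); last by rewrite ler_peMr.
  apply: (@le_trans _ _ ((L * mint 1 z) `^ q)).
    by apply: ge0_ler_powR; rewrite ?nnegrE ?enorm_ge0 ?mulr_ge0 ?(ltW q0).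
  rewrite powRM// /c ler_wpM2l ?powR_ge0//.
  have [->|ne] := eqVneq (mint 1 z) 0; first by rewrite powR0 ?gt_eqF.
  rewrite -[leRHS]powRr1//; apply: ger_powR => //.
  by rewrite mi1 andbT lt_neqAle eq_sym ne mi.
apply: (le_trans (ge0_le_integral_rV mD mcB (fun=> powR_ge0 _ _) hle)).
under eq_integral do rewrite EFinM.
rewrite ge0_integralZl//; first last.
- by move=> x _; rewrite lee_fin.
- by apply/measurable_EFinP.
rewrite (ge0_integralD_rV mind mindz ind0 (fun=> ind0 _)).
rewrite (ge0_integral_rV_shift_EFin z mind ind0).
have hI : (\int[leb]_x (ind x)%:E <= ((2 * M) ^+ n)%:E)%E.
  rewrite integral_indic//; last exact: measurable_cball.
  by rewrite setIT; apply: lebrV_cball; exact: ltW.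
apply: (@le_trans _ _ (c%:E * (((2 * M) ^+ n)%:E + ((2 * M) ^+ n)%:E))%E).
  by apply: lee_wpmul2l; [rewrite lee_fin|exact: leeD].
by rewrite -EFinD -EFinM lee_fin /c /Q; apply: ler_eq; ring.
Qed.

Definition pairing (g : rV -> R) (phi : rV -> rV) : R :=
  Defs.Rint (fun x => g x * frac_div al phi x).

Lemma integral_inner (D : rV -> rV -> R) x :
  measurable_fun [set: rVb R n] (D x) -> (forall z, 0 <= D x z) ->
  (\int[leb]_z (`|f x| * D x z * kern al z)%:E =
   (`|f x|)%:E * \int[leb]_z (D x z * kern al z)%:E)%E.
Proof.
move=> mD D0.
under eq_integral do rewrite -mulrA EFinM.
rewrite ge0_integralZl//.
- by apply/measurable_EFinP; apply: measurable_funM => //; exact: measurable_kern.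
- by move=> z _; rewrite lee_fin mulr_ge0 ?kern_ge0.
Qed.

Lemma measurable_nonlocal_inner (D : rV -> rV -> R) :
  measurable_fun [set: rVb R n * rVb R n] (fun xz : rVb R n * rVb R n => D xz.1 xz.2) ->
  (forall x z, 0 <= D x z) ->
  measurable_fun [set: rVb R n] (fun x => \int[leb]_z (`|f x| * D x z * kern al z)%:E)%E.
Proof.
move=> mD D0.
pose F (xz : rVb R n * rVb R n) : \bar R := (`|f xz.1| * D xz.1 xz.2 * kern al xz.2)%:E.
have F0 xz : (0 <= F xz)%E by rewrite lee_fin !mulr_ge0 ?kern_ge0.
have mk : measurable_fun [set: rVb R n * rVb R n]
    (fun xz : rVb R n * rVb R n => kern al xz.2).
  by apply: measurable_comp_snd; exact: measurable_kern.
have mf1 : measurable_fun [set: rVb R n * rVb R n]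
    (fun xz : rVb R n * rVb R n => f xz.1) by exact: measurable_comp_fst.
have mF : measurable_fun setT F.
  apply/measurable_EFinP; apply: measurable_funM; last exact: mk.
  apply: measurable_funM; last exact: mD.
  exact: measurableT_comp.
exact: (@measurable_fun_fubini_tonelli_F _ _ _ _ R leb F mF F0).
Qed.

Lemma integral_le_nonlocal (h : rV -> R) (D : rV -> rV -> R) :
  measurable_fun [set: rVb R n] h ->
  measurable_fun [set: rVb R n * rVb R n] (fun xz : rVb R n * rVb R n => D xz.1 xz.2) ->
  (forall x z, 0 <= D x z) ->
  (forall x, (`|h x|)%:E <= (`|mu|)%:E * ((`|f x|)%:E * \int[leb]_z (D x z * kern al z)%:E))%E ->
  (\int[leb]_x (`|h x|)%:E <= (`|mu|)%:E * nonlocal D)%E.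
Proof.
move=> mh mD D0 hD.
have mI := measurable_nonlocal_inner mD D0.
have mDx (x : rV) : measurable_fun [set: rVb R n] (D x).
  exact: (measurableT_comp mD (measurable_pair1 (x : rVb R n))).
have I0 x : (0 <= \int[leb]_z (`|f x| * D x z * kern al z)%:E)%E.
  by apply: integral_ge0 => z _; rewrite lee_fin !mulr_ge0 ?kern_ge0.
rewrite /nonlocal -ge0_integralZl//.
apply: ge0_le_integral => //.
- by apply/measurable_EFinP; exact: measurableT_comp.
- by apply: emeasurable_funM.
- by move=> x _; rewrite integral_inner.
Qed.

(** Domination by [f] is all that is assumed of [g], so that products of [f] with cutoffs and
    indicators are covered. *)
Lemma integrable_pairing (g : rV -> R) phi :
  measurable_fun [set: rVb R n] g -> (forall x, `|g x| <= `|f x|) -> nice phi ->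
  leb.-integrable setT (EFin \o (fun x => g x * frac_div al phi x)).
Proof.
move=> mg gf nphi; have [L [M [L0 M0 c1 h1 s1]]] := nphi.
have mh : measurable_fun [set: rVb R n] (fun x => g x * frac_div al phi x).
  by apply: measurable_funM => //; exact: measurable_frac_div.
apply/integrableP; split; first exact/measurable_EFinP.
have hb := @integral_le_nonlocal _ (ediff phi) mh
  (measurable_enorm_diff c1) (fun _ _ => enorm_ge0 _).
apply: (@le_lt_trans _ _ ((`|mu|)%:E * nonlocal (ediff phi))%E).
  apply: hb => x; rewrite normrM EFinM muleCA; apply: lee_pmul => //.
  - by rewrite lee_fin.
  - exact: frac_div_bound.
apply: lte_mul_pinfty; rewrite ?lee_fin//.
by have [C /le_lt_trans] := nonlocal_nice nphi; apply; rewrite ltry.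
Qed.

Lemma pairingE (g : rV -> R) phi :
  measurable_fun [set: rVb R n] g -> (forall x, `|g x| <= `|f x|) -> nice phi ->
  pairing g phi = Rintegral leb setT (fun x => g x * frac_div al phi x).
Proof. by move=> mg gf nphi; apply: RintE; exact: integrable_pairing. Qed.

Lemma pairingD phi psi : nice phi -> nice psi ->
  pairing f (fun x => phi x + psi x) = pairing f phi + pairing f psi.
Proof.
move=> n1 n2; have i1 := integrable_pairing mf (fun=> lexx _) n1.
have i2 := integrable_pairing mf (fun=> lexx _) n2.
rewrite !pairingE//; last exact: niceD.
rewrite -RintegralD//; apply: eq_Rintegral => x _.
by rewrite frac_divD// mulrDr.
Qed.

Lemma pairingZ a phi : nice phi -> pairing f (fun x => a *: phi x) = a * pairing f phi.
Proof.
move=> n1; have i1 := integrable_pairing mf (fun=> lexx _) n1.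
rewrite !pairingE//; last exact: niceZ.
have -> : a * Rintegral leb setT (fun x => f x * frac_div al phi x) =
    Rintegral leb setT (fun x => a * (f x * frac_div al phi x)) by rewrite RintegralZl.
by apply: eq_Rintegral => x _; rewrite frac_divZ// mulrCA.
Qed.

Lemma pairing_le phi : nice phi ->
  ((pairing f phi)%:E <= (`|mu|)%:E * nonlocal (ediff phi))%E.
Proof.
move=> nphi; have [L [M [L0 M0 c1 h1 s1]]] := nphi.
have mh : measurable_fun [set: rVb R n] (fun x => f x * frac_div al phi x).
  by apply: measurable_funM => //; exact: measurable_frac_div.
rewrite pairingE//.
apply: (@le_trans _ _ (`|Rintegral leb setT (fun x => f x * frac_div al phi x)|)%:E).
  by rewrite lee_fin ler_norm.
apply: (le_trans (abs_Rintegral_le mh)).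
apply: (integral_le_nonlocal mh (measurable_enorm_diff c1) (fun _ _ => enorm_ge0 _)).
move=> x; rewrite normrM EFinM muleCA; apply: lee_wpmul2l; first by rewrite lee_fin.
exact: frac_div_bound.
Qed.

Lemma measurable_abs_diff (eta : rV -> R) : measurable_fun [set: rVb R n] eta ->
  measurable_fun [set: rVb R n * rVb R n]
    (fun xz : rVb R n * rVb R n => `|eta (xz.1 + xz.2) - eta xz.1|).
Proof.
move=> meta; apply: measurableT_comp => //; apply: measurable_funB.
  exact: measurable_comp_add.
exact: (measurable_comp_fst meta).
Qed.

(** The pointwise Leibniz bound integrated against [f]. Its error term is independent of [phi], so
    it survives a supremum over test fields. *)
Lemma pairing_leibniz (eta : rV -> R) phi :
  continuous eta -> (forall x, 0 <= eta x <= 1) ->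
  nice phi -> nice (fun y => eta y *: phi y) -> (forall y, enorm (phi y) <= 1) ->
  ((pairing (fun x => f x * eta x) phi)%:E <=
   (pairing f (fun y => eta y *: phi y))%:E +
   (`|mu|)%:E * nonlocal (adiff eta))%E.
Proof.
move=> ceta eta01 n1 n2 phi1.
have meta := continuous_measurable_rV ceta.
have mfe : measurable_fun [set: rVb R n] (fun x => f x * eta x) by exact: measurable_funM.
have fe x : `|f x * eta x| <= `|f x|.
  have /andP[e0 e1] := eta01 x.
  by rewrite normrM (ger0_norm e0) ler_piMr.
have i1 := integrable_pairing mfe fe n1.
have i2 := integrable_pairing mf (fun=> lexx _) n2.
rewrite (pairingE mfe fe n1) (pairingE mf (fun=> lexx _) n2).
pose h x := f x * eta x * frac_div al phi x - f x * frac_div al (fun y => eta y *: phi y) x.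
have mh : measurable_fun [set: rVb R n] h.
  by apply: measurable_funB; apply: measurable_funM => //; exact: measurable_frac_div.
have hE : Rintegral leb setT h = Rintegral leb setT (fun x => f x * eta x * frac_div al phi x) -
    Rintegral leb setT (fun x => f x * frac_div al (fun y => eta y *: phi y) x).
  exact: RintegralB.
have -> : Rintegral leb setT (fun x => f x * eta x * frac_div al phi x) =
    Rintegral leb setT (fun x => f x * frac_div al (fun y => eta y *: phi y) x) + Rintegral leb setT h.
  by rewrite hE addrCA subrr addr0.
rewrite EFinD; apply: leeD => //.
apply: (@le_trans _ _ (`|Rintegral leb setT h|)%:E); first by rewrite lee_fin ler_norm.
apply: (le_trans (abs_Rintegral_le mh)).
apply: (integral_le_nonlocal mh (measurable_abs_diff meta) (fun _ _ => normr_ge0 _)).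
move=> x; rewrite /h -mulrA -mulrBr normrM EFinM muleCA.
apply: lee_wpmul2l; first by rewrite lee_fin.
exact: frac_div_leibniz.
Qed.

Definition decay_const : R :=
  `|mu| * (dyadic_const n al q^-1 * radial_const R n `^ q^-1).

Lemma decay_const_ge0 : 0 <= decay_const.
Proof.
rewrite mulr_ge0// mulr_ge0 ?powR_ge0//; apply: ltW; exact: dyadic_const_gt0.
Qed.

Lemma nonlocal_cutoff (c : rV) (a b rho : R) : 0 < rho -> a < b -> b <= rho ^+ 2 ->
  ((`|mu|)%:E * nonlocal (adiff (cutoff c a b)) <=
   (decay_const * fine (Lpnorm p f) * rho `^ (n%:R / q - al))%:E)%E.
Proof.
move=> rho0 ab brho.
have meta := @measurable_cutoff R n c a b.
have hD := fun z => @integral_radial_diff R n (profile a b) c rho rho0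
  (profile01 a b) (fun s t => profile_le ab) (fun t ht => profile_eq0 ab (le_trans brho ht))
  meta q z n0 q1.
have := nonlocal_bound pq q0 al0 alq rho0 (ltW (radial_const_gt0 R n)) mf fin
  (measurable_abs_diff meta) (fun _ _ => normr_ge0 _) hD.
move=> h; apply: (le_trans (lee_wpmul2l _ h)); first by rewrite lee_fin.
by rewrite -EFinM lee_fin /decay_const; apply: ler_eq; ring.
Qed.

Lemma pairing_cutoff_cst (c v : rV) (a b rho : R) : 0 < rho -> a < b -> b <= rho ^+ 2 ->
  enorm v <= 1 ->
  pairing f (fun x => cutoff c a b x *: v) <=
  decay_const * fine (Lpnorm p f) * rho `^ (n%:R / q - al).
Proof.
move=> rho0 ab brho v1.
have nv : nice (fun x => cutoff c a b x *: v).
  apply: (nice_smooth (K := [set x | enorm (x - c) ^+ 2 <= b])).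
  - by apply: smooth_scale; [exact: ssmooth_cutoff|exact: smooth_cst].
  - exact: compact_ecball.
  - move=> x /negP; rewrite -ltNge => xb.
    by rewrite /cutoff profile_eq0 ?scale0r// ltW.
rewrite -lee_fin; apply: (le_trans (pairing_le nv)).
apply: le_trans (nonlocal_cutoff c rho0 ab brho).
apply: lee_wpmul2l; first by rewrite lee_fin.
have [L [M [_ _ cv _ _]]] := nv.
have meta := @measurable_cutoff R n c a b.
have m1 := measurable_nonlocal_inner (D := ediff (fun x => cutoff c a b x *: v)) (measurable_enorm_diff cv) (fun _ _ => enorm_ge0 _).
have m2 := measurable_nonlocal_inner (D := adiff (cutoff c a b)) (measurable_abs_diff meta) (fun _ _ => normr_ge0 _).
have kk := @measurable_kern R n al.
apply: ge0_le_integral => //.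
  by move=> x _; apply: integral_ge0 => z _; rewrite lee_fin !mulr_ge0 ?enorm_ge0 ?kern_ge0.
move=> x _; apply: ge0_le_integral_rV.
- apply: measurable_funM => //; apply: measurable_funM => //.
  exact: (measurableT_comp (measurable_enorm_diff cv) (measurable_pair1 (x : rVb R n))).
- apply: measurable_funM => //; apply: measurable_funM => //.
  exact: (measurableT_comp (measurable_abs_diff meta) (measurable_pair1 (x : rVb R n))).
- by move=> z; rewrite !mulr_ge0 ?enorm_ge0 ?kern_ge0.
- move=> z; rewrite /ediff /adiff ler_wpM2r ?kern_ge0// ler_wpM2l// -scalerBl enormZ ler_piMr//.
Qed.

End Pairing.

(** * Fractional variation *)

Section Variation.
Variables (R : realType) (n : nat) (al : R) (p : \bar R) (q : R).
Local Notation rV := 'rV[R]_n.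
Local Notation leb := (lebrV R n).
Hypothesis n0 : (0 < n)%N.
Hypothesis al01 : 0 < al < 1.
Hypothesis q1 : 1 <= q.
Hypothesis alq : al < q^-1.
Hypothesis pq :
  (p = +oo%E /\ q = 1) \/ (exists p' : R, [/\ p = p'%:E, 0 < p' & p'^-1 + q^-1 = 1]).
Variable f : rV -> R.
Hypothesis mf : measurable_fun [set: rVb R n] f.
Hypothesis fin : (Lpnorm p f < +oo)%E.
Hypothesis bv : (frac_var al f setT < +oo)%E.

Let q0 : 0 < q. Proof. exact: lt_le_trans q1. Qed.
Local Notation T := (pairing al f).
Local Notation gam := (n%:R / q - al).
Local Notation M := (fine (Lpnorm p f)).
Local Notation C0 := (decay_const n al q).

Let M0 : 0 <= M. Proof. by rewrite fine_ge0//; exact: Lpnorm_ge0. Qed.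
Let C00 : 0 <= C0. Proof. exact: decay_const_ge0. Qed.

Lemma gam_le_dim : gam < n%:R.
Proof.
have /andP[a0 _] := al01.
have : n%:R / q <= n%:R :> R by rewrite ler_pdivrMr// ler_peMr.
by move: (n%:R / q) => t; lra.
Qed.

Lemma test_nice U (phi : rV -> rV) : test_field U phi -> nice phi.
Proof. by case=> sphi [K [cK _ K0]] _; exact: nice_smooth sphi cK K0. Qed.

Lemma test_field0 U : test_field U (fun _ : rV => 0).
Proof.
split; first exact: smooth_cst.
  by exists set0; split => //; exact: compact0.
by move=> x; rewrite enorm0.
Qed.

Lemma test_fieldS U W (phi : rV -> rV) : U `<=` W -> test_field U phi -> test_field W phi.
Proof.
move=> UW [sphi [K [cK KU K0]] b]; split => //.
by exists K; split => //; exact: subset_trans UW.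
Qed.

Lemma pairing0 : T (fun _ => 0) = 0.
Proof.
have nz := test_nice (test_field0 setT).
have := pairingZ al01 q1 alq pq mf fin 0 nz.
rewrite mul0r => <-; congr (pairing al f _).
by apply/funext => x; rewrite scale0r.
Qed.

Lemma pairing_le_var U phi : test_field U phi -> ((T phi)%:E <= frac_var al f U)%E.
Proof. by move=> tphi; apply: ereal_sup_ubound; exists phi. Qed.

Lemma frac_var_le U W : U `<=` W -> (frac_var al f U <= frac_var al f W)%E.
Proof.
move=> UW; apply: ub_ereal_sup => _ [phi tphi <-].
by apply: pairing_le_var; exact: test_fieldS tphi.
Qed.

Lemma frac_var_ge0 U : (0 <= frac_var al f U)%E.
Proof. by have := pairing_le_var (test_field0 U); rewrite pairing0. Qed.

Definition var (U : set rV) : R := fine (frac_var al f U).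

Lemma varE U : frac_var al f U = (var U)%:E.
Proof.
rewrite /var fineK// ge0_fin_numE ?frac_var_ge0//.
by apply: le_lt_trans bv; exact: frac_var_le.
Qed.

Lemma var_ge0 U : 0 <= var U.
Proof. by rewrite -lee_fin -varE frac_var_ge0. Qed.

Lemma var_le U W : U `<=` W -> var U <= var W.
Proof. by move=> UW; rewrite -lee_fin -!varE frac_var_le. Qed.

Lemma pairing_le_varR U phi : test_field U phi -> T phi <= var U.
Proof. by move=> /pairing_le_var; rewrite varE lee_fin. Qed.

Lemma pairing_le_scaled U phi (e : R) : 0 < e -> smooth phi ->
  (exists K, [/\ compact K, K `<=` U & forall x, ~ K x -> phi x = 0]) ->
  (forall x, enorm (phi x) <= e) -> T phi <= e * var U.
Proof.
move=> e0 sphi hK phie.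
have t1 : test_field U (fun x => e^-1 *: phi x).
  split.
  - by apply: smooth_scale => // k; exact: sCk_cst.
  - by have [K [cK KU K0]] := hK; exists K; split => // x /K0 ->; rewrite scaler0.
  - by move=> x; rewrite enormZ ger0_norm ?invr_ge0 ?(ltW e0)// mulrC ler_pdivrMr// mul1r.
have -> : T phi = e * T (fun x => e^-1 *: phi x).
  rewrite -(pairingZ al01 q1 alq pq mf fin)//; last exact: test_nice t1.
  congr (pairing al f _); apply/funext => x.
  by rewrite scalerA divff ?gt_eqF// scale1r.
by rewrite ler_wpM2l ?(ltW e0)//; exact: pairing_le_varR.
Qed.

Lemma var_approx U (d : R) : 0 < d -> exists2 phi, test_field U phi & var U - d < T phi.
Proof.
move=> d0.
have hfin : frac_var al f U \is a fin_num by rewrite varE.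
have [_ [phi tphi <-] h] := ub_ereal_sup_adherent d0 hfin.
by exists phi => //; move: h; rewrite -/(frac_var al f U) varE -EFinB lte_fin.
Qed.

(** If the norm were 0, every pairing would be at most a multiple of it, hence the variation 0.
    Positivity of the norm is needed to choose the radius in [good_scale]. *)
Lemma var_gt0_Lp U : 0 < var U -> 0 < M.
Proof.
move=> v0; rewrite lt_neqAle M0 andbT eq_sym; apply/negP => /eqP ME.
have : (frac_var al f U <= 0)%E.
  apply: ub_ereal_sup => _ [phi tphi <-].
  have nphi := test_nice tphi.
  apply: (le_trans (pairing_le al01 q1 alq pq mf fin nphi)).
  have [C hC] := nonlocal_nice al01 q1 alq pq mf fin nphi.
  apply: (le_trans (lee_wpmul2l _ hC)); first by rewrite lee_fin.
  by rewrite ME mulr0 mule0.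
by rewrite varE lee_fin leNgt v0.
Qed.

(** Equal to 1 on the ball of radius [s], with support in the closed ball of radius [sqrt 2 * s], a
    compact subset of the open ball of radius [2 * s]. *)
Definition cut (x : rV) (s : R) : rV -> R := cutoff x (s ^+ 2) (2 * s ^+ 2).

Section cut_props.
Variables (x : rV) (s : R).
Hypothesis s0 : 0 < s.
Let ss : s ^+ 2 < 2 * s ^+ 2.
Proof. by rewrite ltr_pMl ?exprn_gt0// ltr1n. Qed.

Lemma cut_eq1 y : eball x s y -> cut x s y = 1.
Proof.
move=> xy; apply: profile_eq1 => //; rewrite ler_sqr ?nnegrE ?enorm_ge0 ?(ltW s0)//.
exact: ltW.
Qed.

Lemma cut_eq0 y : 2 * s ^+ 2 < enorm (y - x) ^+ 2 -> cut x s y = 0.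
Proof. by move=> h; apply: profile_eq0 => //; exact: ltW. Qed.

Lemma cut_supp : [set y : rV | enorm (y - x) ^+ 2 <= 2 * s ^+ 2] `<=` eball x (2 * s).
Proof.
move=> y /= h; rewrite /eball /= -ltr_sqr ?nnegrE ?enorm_ge0 ?mulr_ge0 ?(ltW s0)//.
apply: (le_lt_trans h); rewrite exprMn ltr_pM2r ?exprn_gt0//.
by rewrite expr2; lra.
Qed.

Lemma cut_out y : ~ eball x (2 * s) y -> cut x s y = 0.
Proof.
move=> h; apply: cut_eq0; rewrite ltNge; apply/negP => h'; apply: h.
exact: cut_supp.
Qed.

Lemma cut_ge0 y : 0 <= cut x s y. Proof. exact: cutoff_ge0. Qed.
Lemma cut_le1 y : cut x s y <= 1. Proof. exact: cutoff_le1. Qed.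

Lemma ssmooth_cut : ssmooth (cut x s). Proof. exact: ssmooth_cutoff. Qed.

Lemma cut_field_supp (phi : rV -> rV) :
  exists K, [/\ compact K, K `<=` eball x (2 * s)
    & forall y, ~ K y -> cut x s y *: phi y = 0].
Proof.
exists [set y : rV | enorm (y - x) ^+ 2 <= 2 * s ^+ 2]; split.
- exact: compact_ecball.
- exact: cut_supp.
- by move=> y /negP; rewrite -ltNge => /cut_eq0 ->; rewrite scale0r.
Qed.

Lemma cut_test (phi : rV -> rV) : smooth phi -> (forall y, enorm (phi y) <= 1) ->
  test_field (eball x (2 * s)) (fun y => cut x s y *: phi y).
Proof.
move=> sphi b; split.
- by apply: smooth_scale => //; exact: ssmooth_cut.
- exact: cut_field_supp.
- move=> y; rewrite enormZ ger0_norm ?cut_ge0// mulr_ile1 ?cut_ge0 ?enorm_ge0 ?cut_le1//.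
Qed.

Lemma ssmooth_1cut : ssmooth (fun y => 1 + -1 * cut x s y).
Proof.
move=> k; apply: sCkD; first exact: sCk_cst.
by apply: sCkM; [exact: sCk_cst|exact: ssmooth_cut].
Qed.

Lemma cut_test_compl U (phi : rV -> rV) : test_field U phi ->
  test_field U (fun y => (1 + -1 * cut x s y) *: phi y).
Proof.
move=> [sphi [K [cK KU K0]] b]; split.
- by apply: smooth_scale => //; exact: ssmooth_1cut.
- by exists K; split => // y /K0 ->; rewrite scaler0.
- move=> y; have h0 := cut_ge0 y; have h1 := cut_le1 y.
  rewrite enormZ ger0_norm; last by lra.
  by rewrite mulr_ile1 ?enorm_ge0//; lra.
Qed.

Lemma pairing_cut_split (phi : rV -> rV) U : test_field U phi ->
  T phi = T (fun y => cut x s y *: phi y) + T (fun y => (1 + -1 * cut x s y) *: phi y).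
Proof.
move=> tphi; have [sphi _ b] := tphi.
rewrite -(pairingD al01 q1 alq pq mf fin).
- congr (pairing al f _); apply/funext => y; rewrite -scalerDl.
  by rewrite (_ : _ + _ = 1) ?scale1r//; ring.
- exact: test_nice (cut_test sphi b).
- exact: test_nice (cut_test_compl tphi).
Qed.

End cut_props.

(** Substitute for finite subadditivity. A cutoff splits [phi] into a part living in the first
    doubled ball and a remainder that vanishes on the first ball, so that the other balls cover
    where it is nonzero. *)
Lemma pairing_cover (l : seq (rV * R)) (phi : rV -> rV) :
  (forall a, a \in l -> 0 < a.2) -> test_field setT phi ->
  (forall y, phi y <> 0 -> exists2 a, a \in l & eball a.1 a.2 y) ->
  T phi <= \sum_(a <- l) var (eball a.1 (2 * a.2)).
Proof.
elim: l phi => [|[x s] l IH] phi pos tphi cov.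
  rewrite big_nil (_ : phi = fun _ => 0) ?pairing0//.
  apply/funext => y; apply: contrapT => /cov[a]; by rewrite in_nil.
have s0 : 0 < s by apply: (pos (x, s)); rewrite mem_head.
have [sphi _ b] := tphi.
rewrite big_cons (pairing_cut_split x s0 tphi); apply: lerD.
  by apply: pairing_le_varR; exact: cut_test.
apply: IH.
- by move=> a al'; apply: pos; rewrite in_cons al' orbT.
- exact: cut_test_compl.
- move=> y hy.
  have [|[z t]] := cov y; first by move=> y0; apply: hy; rewrite y0 scaler0.
  rewrite in_cons => /orP[/eqP[-> ->] /= xy|]; last by exists (z, t).
  exfalso; apply: hy; rewrite (cut_eq1 s0 xy) mulr1 subrr scale0r //.
Qed.

(** Disjointness is asked of the doubled balls, as these contain the supports of the cutoffs. *)
Fixpoint separated (l : seq (rV * R)) : Prop :=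
  if l is a :: l' then
    (forall b, b \in l' -> 2 * a.2 + 2 * b.2 <= enorm (a.1 - b.1)) /\ separated l'
  else True.

Lemma separated_disjoint (a b : rV * R) y :
  2 * a.2 + 2 * b.2 <= enorm (a.1 - b.1) -> eball a.1 (2 * a.2) y -> ~ eball b.1 (2 * b.2) y.
Proof.
rewrite /eball /= => h1 h2 h3.
have := enormD (a.1 - y) (y - b.1); rewrite addrA subrK enormC.
by move=> h4; lra.
Qed.

(** Greedy choice of a largest ball [a]. A ball [b] too close to it has its centre within
    [2 a.2 + 2 b.2] of [a.1], so its double lies within [2 a.2 + 4 b.2 <= 6 a.2]. *)
Lemma finite_vitali (l : seq (rV * R)) : (forall a, a \in l -> 0 < a.2) ->
  exists l', [/\ {subset l' <= l}, separated l'
    & forall a y, a \in l -> eball a.1 (2 * a.2) y -> exists2 b, b \in l' & eball b.1 (6 * b.2) y].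
Proof.
have [m] := ubnP (size l); elim: m l => // m IH l /ltnSE lm pos.
case: l lm pos => [|a0 l0] lm pos; first by exists [::]; split.
have [a al' amax] : exists2 a, a \in a0 :: l0 & forall b, b \in a0 :: l0 -> b.2 <= a.2.
  clear lm pos; elim: l0 => [|b l0 [a al' amax]].
    by exists a0; [rewrite mem_head|move=> b; rewrite inE => /eqP ->].
  have [ba|ab] := leP b.2 a.2.
    exists a; first by move: al'; rewrite !inE => /orP[->//|->]; rewrite !orbT.
    by move=> c; rewrite !inE => /or3P[c0|/eqP ->//|cl]; apply: amax; rewrite inE ?c0 ?cl ?orbT.
  exists b; first by rewrite !inE eqxx orbT.
  move=> c; rewrite !inE => /or3P[c0|/eqP ->//|cl]; apply: (le_trans _ (ltW ab)).
    by apply: amax; rewrite inE c0.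
  by apply: amax; rewrite inE cl orbT.
set l := a0 :: l0 in lm pos al' amax *.
have a20 := pos _ al'.
pose far (b : rV * R) := 2 * a.2 + 2 * b.2 <= enorm (a.1 - b.1).
have [|b /[!mem_filter]/andP[_ /pos//]|l' [sub sep cov]] := IH [seq b <- l | far b].
  (* The list shrinks strictly: [a] is not far from itself, its radius being positive. *)
  apply: leq_trans lm; rewrite size_filter -(count_predC far) -addn1 leq_add2l.
  rewrite -has_count; apply/hasP; exists a => //=.
  by rewrite /far subrr enorm0 -ltNge; lra.
exists (a :: l'); split.
- by move=> b; rewrite inE => /orP[/eqP ->//|/sub]; rewrite mem_filter => /andP[].
- by split=> // b /sub; rewrite mem_filter => /andP[].
- move=> b y bl by_; have [fb|nfb] := boolP (far b).
    have [|c cl' cy] := cov b y _ by_; first by rewrite mem_filter fb.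
    by exists c => //; rewrite inE cl' orbT.
  exists a; first by rewrite mem_head.
  move: nfb; rewrite /far -ltNge => nfb.
  have ba := amax _ bl.
  move: by_; rewrite /eball /= => by_.
  have := enormD (y - b.1) (b.1 - a.1); rewrite addrA subrK.
  by rewrite [enorm (b.1 - a.1)]enormC => h; lra.
Qed.

(* Replacing phi on each ball by a field that is nearly optimal there raises the pairing. *)
Lemma competitor (phi : rV -> rV) (l : seq (rV * R)) :
  test_field setT phi -> separated l ->
  (forall a, a \in l -> 0 < a.2 /\ 0 < var (eball a.1 a.2) /\
     T (fun y => cut a.1 a.2 y *: phi y) <= var (eball a.1 a.2) / 4) ->
  \sum_(a <- l) var (eball a.1 a.2) / 4 <= var setT - T phi.
Proof.
move=> tphi sep hl.
suff [Phi [tPhi _ h]] : exists Phi, [/\ test_field setT Phi,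
    forall y, (forall a, a \in l -> ~ eball a.1 (2 * a.2) y) -> Phi y = phi y
  & T phi + \sum_(a <- l) var (eball a.1 a.2) / 4 <= T Phi].
  by have := pairing_le_varR tPhi; move: h; move: (\sum_(a <- l) _) => S; lra.
elim: l sep hl => [|a l IH] /= sep hl.
  by exists phi; split => //; rewrite big_nil addr0.
have [sepa sepl] := sep.
have [|Phi [tPhi PhiE hPhi]] := IH sepl.
  by move=> b bl; apply: hl; rewrite inE bl orbT.
have [a0 [va0 ha]] := hl _ (mem_head _ _).
(* Removing the old field costs at most a quarter of the local variation and the new one brings at
   least half of it, a net gain of a quarter. *)
have v20 : 0 < var (eball a.1 a.2) / 2 by rewrite divr_gt0.
have [psi tpsi hpsi] := var_approx (eball a.1 a.2) v20.
have [sPhi _ bPhi] := tPhi.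
have PhiEa y : eball a.1 (2 * a.2) y -> Phi y = phi y.
  by move=> ya; apply: PhiE => b bl; apply: separated_disjoint ya; exact: sepa.
have tc := @cut_test_compl a.1 a.2 setT Phi tPhi.
have [sc [K [cK _ Kc]] bc] := tc.
have [spsi [K' [cK' K'U K'0]] bpsi] := tpsi.
exists (fun y => (1 + -1 * cut a.1 a.2 y) *: Phi y + psi y); split.
- split.
  + exact: smoothD.
  + exists (K `|` K'); split => //; first exact: compactU.
    by move=> y /not_orP[/Kc -> /K'0 ->]; rewrite addr0.
  (* The two summands are never nonzero together: the first vanishes on the ball, the second outside
     it. This keeps the bound by 1. *)
  + move=> y; case: (pselect (eball a.1 a.2 y)) => ya.
      by rewrite (cut_eq1 a0 ya) mulr1 subrr scale0r add0r.
    rewrite (K'0 y); last by move=> /K'U.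
    by rewrite addr0.
- move=> y hy.
  have ya : ~ eball a.1 (2 * a.2) y by apply: hy; rewrite mem_head.
  rewrite (cut_out a0 ya) mulr0 addr0 scale1r (K'0 y).
    by rewrite addr0; apply: PhiE => b bl; apply: hy; rewrite inE bl orbT.
  move=> /K'U; rewrite /eball /= => h; apply: ya; rewrite /eball /=.
  by lra.
- rewrite big_cons (pairingD al01 q1 alq pq mf fin (test_nice tc) (test_nice tpsi)).
  have hs := pairing_cut_split a.1 a0 tPhi.
  (* Earlier replacements took place in other doubled balls, so the hypothesis on [phi] still
     applies to [Phi] here. *)
  have hE : T (fun y => cut a.1 a.2 y *: Phi y) = T (fun y => cut a.1 a.2 y *: phi y).
    congr (pairing al f _); apply/funext => y.
    case: (pselect (eball a.1 (2 * a.2) y)) => ya; first by rewrite PhiEa.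
    by rewrite (cut_out a0 ya) !scale0r.
  rewrite hE in hs.
  by move: hPhi; move: (\sum_(b <- l) _) => S; lra.
Qed.

(** Chosen so that [C0 * M * (2 s)^gam] is at most an eighth of [Aconst * M * s^gam]; the added 1
    keeps it positive, as [C0] is only known to be nonnegative. *)
Definition Aconst : R := 8 * C0 * 2 `^ gam + 1.

Lemma Aconst_gt0 : 0 < Aconst.
Proof. by rewrite /Aconst ltr_wpDl// mulr_ge0 ?powR_ge0// mulr_ge0. Qed.

(** The quarter is two eighths. Freezing [phi] at [x] leaves a constant vector, whose pairing is
    absorbed by the lower bound on the variation. The remainder is at most [2 L s], hence at most
    [1 / (8 * 12^n)], on the ball of radius [2 s], where the doubling hypothesis returns a factor
    [12^n]. *)
Lemma good_scale_bound (phi : rV -> rV) (L : R) (x : rV) (s : R) :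
  test_field setT phi -> 0 <= L ->
  (forall y z, enorm (phi (y + z) - phi y) <= L * enorm z) ->
  0 < s -> 2 * (L + 1) * s <= (8 * 12 ^+ n)^-1 ->
  Aconst * M * s `^ gam < var (eball x s) ->
  var (eball x (12 * s)) <= 12 ^+ n * var (eball x s) ->
  T (fun y => cut x s y *: phi y) <= var (eball x s) / 4.
Proof.
move=> tphi L0 hL s0 sL hA hd.
have [sphi _ b] := tphi.
set v := phi x.
have d0 : 0 < 8 * 12 ^+ n :> R by rewrite mulr_gt0 ?exprn_gt0.
have s1 : smooth (fun y => cut x s y *: v).
  by apply: smooth_scale; [exact: ssmooth_cut|exact: smooth_cst].
have s2 : smooth (fun y => cut x s y *: (phi y + -1 *: v)).
  apply: smooth_scale; first exact: ssmooth_cut.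
  by apply: smoothD => //; exact: smooth_cst.
have [K1 [cK1 _ K10]] := cut_field_supp x s0 (fun=> v).
have [K2 [cK2 K2U K20]] := cut_field_supp x s0 (fun y => phi y + -1 *: v).
have n1 := nice_smooth s1 cK1 K10; have n2 := nice_smooth s2 cK2 K20.
have -> : T (fun y => cut x s y *: phi y) =
    T (fun y => cut x s y *: v) + T (fun y => cut x s y *: (phi y + -1 *: v)).
  rewrite -(pairingD al01 q1 alq pq mf fin n1 n2); congr (pairing al f _).
  apply/funext => y; rewrite -scalerDr; congr (_ *: _).
  by rewrite scaleN1r addrC subrK.
have t1 : T (fun y => cut x s y *: v) <= C0 * M * (2 * s) `^ gam.
  apply: (pairing_cutoff_cst n0 al01 q1 alq pq mf fin) => //.
  - by rewrite mulr_gt0.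
  - by rewrite ltr_pMl ?exprn_gt0// ltr1n.
  - by rewrite exprMn ler_wpM2r ?sqr_ge0// expr2; lra.
  - exact: b.
have t2 : T (fun y => cut x s y *: (phi y + -1 *: v)) <= (8 * 12 ^+ n)^-1 * var (eball x (2 * s)).
  apply: pairing_le_scaled => //.
    by exists K2.
  move=> y; rewrite enormZ ger0_norm ?cut_ge0//.
  case: (pselect (eball x (2 * s) y)) => ya; last first.
    by rewrite (cut_out s0 ya) mul0r invr_ge0 ltW.
  apply: le_trans sL; rewrite scaleN1r.
  apply: (@le_trans _ _ (enorm (phi y - v))).
    by rewrite ler_piMl ?enorm_ge0// cut_le1.
  have h := hL x (y - x); rewrite (_ : x + (y - x) = y) in h; last by rewrite addrC subrK.
  apply: (le_trans h).
  move: ya; rewrite /eball /= => ya; have := enorm_ge0 (y - x); nra.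
have t3 : var (eball x (2 * s)) <= 12 ^+ n * var (eball x s).
  apply: le_trans hd; apply: var_le => y; rewrite /eball /= => h; lra.
have t4 : (8 * 12 ^+ n)^-1 * var (eball x (2 * s)) <= var (eball x s) / 8.
  rewrite ler_pdivrMl// (le_trans t3)//.
  by apply: ler_eq; field.
have t5 : C0 * M * (2 * s) `^ gam <= var (eball x s) / 8.
  rewrite powRM ?(ltW s0)// ler_pdivlMr// (le_trans _ (ltW hA))//.
  have -> : C0 * M * (2 `^ gam * s `^ gam) * 8 = (8 * C0 * 2 `^ gam) * (M * s `^ gam) by ring.
  rewrite -[leRHS]mulrA ler_wpM2r ?mulr_ge0 ?powR_ge0// /Aconst lerDl//.
lra.
Qed.

(** * Bad points form a null set *)

Definition bad (x : rV) := forall r0, 0 < r0 ->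
  exists2 r, 0 < r < r0 & Aconst * M * r `^ gam < var (eball x r).

(* Starting from a bad small radius and multiplying it by 12, non-doubling at every
   scale up to s0 would force the variation to exceed its total. *)
Lemma good_scale (x : rV) (s0 : R) : bad x -> 0 < s0 ->
  exists s, [/\ 0 < s, s < s0, Aconst * M * s `^ gam < var (eball x s)
    & var (eball x (12 * s)) <= 12 ^+ n * var (eball x s)].
Proof.
move=> bx s00; apply: contrapT => hno.
have M1 : 0 < M.
  have [r /andP[r0 _] h] := bx 1 ltr01.
  apply: (@var_gt0_Lp (eball x r)); apply: le_lt_trans h.
  by rewrite mulr_ge0 ?powR_ge0// mulr_ge0// ltW ?Aconst_gt0.
have A0 := Aconst_gt0.
set W := var setT.
have W0 : 0 <= W by exact: var_ge0.
have ng : 0 < n%:R - gam by rewrite subr_gt0; exact: gam_le_dim.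
(* The last radius [12^j r] below [s0] is at least [s0 / 12], where growth by [12^n] per scale gives
   a variation above [Aconst * M * (s0 / 12)^n / r^(n - gam)]. This exceeds [W + 1] as soon as
   [r^(n - gam) < c]. *)
pose c := Aconst * M * (s0 / 12) ^+ n / (W + 1).
have c0 : 0 < c by rewrite divr_gt0 ?mulr_gt0 ?exprn_gt0 ?divr_gt0// ltr_wpDl.
pose r0 := Num.min s0 (c `^ (n%:R - gam)^-1).
have r00 : 0 < r0 by rewrite lt_min s00 powR_gt0.
have [r /andP[rp rr0] hr] := bx r0 r00.
move: rr0; rewrite lt_min => /andP[rs0 rc].
have rc' : r `^ (n%:R - gam) < c.
  have := gt0_ltr_powR ng _ _ rc; rewrite !nnegrE -powRrM mulVf ?gt_eqF// powRr1 ?(ltW c0)//.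
  by apply; rewrite ?powR_ge0// ltW.
have grow (j : nat) : 12 ^+ j * r < s0 ->
    12 ^+ j ^+ n * var (eball x r) <= var (eball x (12 ^+ j * r)).
  elim: j => [|j IH] hj; first by rewrite expr0 expr1n !mul1r.
  have p12 : 0 < 12 ^+ j :> R by rewrite exprn_gt0.
  have hj' : 12 ^+ j * r < s0.
    apply: le_lt_trans hj; rewrite exprS ler_wpM2r ?(ltW rp)// ler_peMl ?(ltW p12)//; lra.
  have IHj := IH hj'.
  (* The threshold grows by [12^gam] per scale and the variation by [12^n], so the lower bound
     persists because [gam < n]. *)
  have vj : Aconst * M * (12 ^+ j * r) `^ gam < var (eball x (12 ^+ j * r)).
    apply: lt_le_trans IHj.
    apply: (@le_lt_trans _ _ (12 ^+ j ^+ n * (Aconst * M * r `^ gam))); last first.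
      by rewrite ltr_pM2l ?exprn_gt0.
    rewrite powRM ?(ltW p12) ?(ltW rp)// mulrCA ler_wpM2r ?mulr_ge0 ?powR_ge0 ?(ltW A0)//.
    rewrite -powR_mulrn ?(ltW p12)//; apply: ler_powR; last exact: ltW gam_le_dim.
    by rewrite exprn_ege1//; lra.
  have : 12 ^+ n * var (eball x (12 ^+ j * r)) < var (eball x (12 * (12 ^+ j * r))).
    rewrite ltNge; apply/negP => hd; apply: hno.
    by exists (12 ^+ j * r); split => //; rewrite mulr_gt0.
  rewrite exprS -mulrA => /ltW; apply: le_trans.
  by rewrite exprMn -mulrA ler_wpM2l// exprn_ge0.
have [j [hj1 hj2]] : exists j, 12 ^+ j * r < s0 /\ s0 <= 12 ^+ j.+1 * r.
  have ex : exists j, s0 <= 12 ^+ j.+1 * r.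
    exists (Num.truncn (s0 / r)); rewrite -ler_pdivrMr//.
    apply: (@le_trans _ _ (Num.truncn (s0 / r)).+1%:R); first by apply/ltW; exact: truncnS_gt.
    by rewrite -natrX ler_nat ltnW// ltn_expl.
  exists (ex_minn ex); case: ex_minnP => j hj jmin; split => //.
  case: j hj jmin => [|j] hj jmin; first by rewrite expr0 mul1r.
  by rewrite ltNge; apply/negP => /jmin; rewrite ltnn.
have h1 := grow j hj1.
have h2 : var (eball x (12 ^+ j * r)) <= W by exact: var_le.
have p12 : 0 < 12 ^+ j ^+ n :> R by rewrite !exprn_gt0.
have h3 : 12 ^+ j ^+ n * (Aconst * M * r `^ gam) < W.
  apply: lt_le_trans (le_trans h1 h2); by rewrite ltr_pM2l.
have h4 : (s0 / 12) ^+ n <= 12 ^+ j ^+ n * r ^+ n.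
  rewrite -exprMn; apply: lerXn2r; rewrite ?nnegrE ?divr_ge0 ?mulr_ge0 ?exprn_ge0 ?(ltW rp) ?(ltW s00)//.
  by rewrite ler_pdivrMr// (le_trans hj2)// exprS; apply: ler_eq; ring.
have h5 : r ^+ n = r `^ (n%:R - gam) * r `^ gam.
  rewrite -powRD; last by rewrite (gt_eqF rp) implybT.
  by rewrite subrK powR_mulrn ?(ltW rp).
have rg : 0 < r `^ gam by rewrite powR_gt0.
have h6 : (W + 1) * r ^+ n < Aconst * M * (s0 / 12) ^+ n * r `^ gam.
  rewrite h5 mulrA ltr_pM2r// mulrC -ltr_pdivlMr//.
  by rewrite ltr_wpDl.
have h7 : Aconst * M * (s0 / 12) ^+ n * r `^ gam <= W * r ^+ n.
  apply: (@le_trans _ _ (Aconst * M * (12 ^+ j ^+ n * r ^+ n) * r `^ gam)).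
    by rewrite ler_wpM2r ?(ltW rg)// ler_wpM2l// mulr_ge0// ltW.
  have -> : Aconst * M * (12 ^+ j ^+ n * r ^+ n) * r `^ gam =
    12 ^+ j ^+ n * (Aconst * M * r `^ gam) * r ^+ n by ring.
  by rewrite ler_wpM2r ?exprn_ge0 ?(ltW rp)// ltW.
have := lt_le_trans h6 h7; rewrite ltr_pM2r ?exprn_gt0//; lra.
Qed.

(** The field [phi] and its Lipschitz constant are fixed before any ball is chosen, so one [s0]
    works at all bad points. Testing the variation of the open cover with a compactly supported
    field leaves finitely many balls, which is why a finite covering lemma suffices. *)
Lemma bad_null : var_null al f bad.
Proof.
move=> eps eps0.
have p12 : 0 < 12 ^+ n :> R by rewrite exprn_gt0.
pose d := eps / (4 * 12 ^+ n).
have d0 : 0 < d by rewrite divr_gt0// mulr_gt0.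
have [phi tphi hphi] := var_approx setT d0.
have [L [_ [L0 _ _ hL _]]] := test_nice tphi.
have hL' y z : enorm (phi (y + z) - phi y) <= L * enorm z.
  apply: (le_trans (hL y z)); rewrite ler_wpM2l// /mint divr1.
  by rewrite ge_min lexx.
(* Exactly the smallness of the radius asked by [good_scale_bound]. *)
pose s0 := (8 * 12 ^+ n)^-1 / (2 * (L + 1)).
have L1 : 0 < 2 * (L + 1) by lra.
have s00 : 0 < s0 by rewrite divr_gt0// invr_gt0 mulr_gt0.
have /choice[S hS] : forall x, exists s, bad x ->
    [/\ 0 < s, s < s0, Aconst * M * s `^ gam < var (eball x s)
    & var (eball x (12 * s)) <= 12 ^+ n * var (eball x s)].
  move=> x; case: (pselect (bad x)) => bx; last by exists 0.
  by have [s hs] := good_scale bx s00; exists s.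
pose U : set rV := \bigcup_(x in bad) eball x (2 * S x).
exists U; split.
- by apply: bigcup_open => x _; exact: open_eball.
- move=> x bx; exists x => //; rewrite /eball /= subrr enorm0.
  by have [h _ _ _] := hS x bx; rewrite mulr_gt0.
apply: ub_ereal_sup => _ [psi tpsi <-]; rewrite lee_fin.
have [spsi [K [cK KU K0]] bpsi] := tpsi.
have : cover_compact K by rewrite -compact_cover.
have oB : forall x, bad x -> open (eball x (2 * S x)) by move=> x _; exact: open_eball.
move=> /(_ _ _ _ oB KU)[D' D'bad D'cov].
pose l := [seq (x, S x) | x <- finmap.enum_fset D'].
have lS a : a \in l -> bad a.1 /\ a.2 = S a.1.
  by move=> /mapP[x xD ->]; split => //; have := D'bad _ xD; rewrite inE.
have lpos a : a \in l -> 0 < a.2.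
  by move=> /lS[/hS[h _ _ _] ->].
have [l' [sub sep cov]] := finite_vitali lpos.
(* The enlarged balls cover the support; [pairing_cover] doubles them once more, to the radius
   [12 * s] of the doubling condition. *)
pose l6 := [seq (a.1, 6 * a.2) | a <- l'].
have tpsiT : test_field setT psi by exact: test_fieldS tpsi.
have h1 : T psi <= \sum_(a <- l6) var (eball a.1 (2 * a.2)).
  apply: pairing_cover => //.
    by move=> a /mapP[b bl' ->] /=; rewrite mulr_gt0//; apply: lpos; exact: sub.
  move=> y hy; have Ky : K y by apply: contrapT => /K0.
  have [x xD xy] := D'cov y Ky.
  have [|b bl' by_] := cov (x, S x) y _ xy; first by apply/mapP; exists x.
  by exists (b.1, 6 * b.2) => //; apply/mapP; exists b.
have h2 : \sum_(a <- l6) var (eball a.1 (2 * a.2)) <= \sum_(a <- l') 12 ^+ n * var (eball a.1 a.2).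
  rewrite big_map big_seq [leRHS]big_seq; apply: ler_sum => a /sub /lS[ba a2E] /=.
  have [_ _ _ h] := hS _ ba; rewrite mulrA (_ : 2 * 6 = 12) ?a2E//.
  by rewrite -natrM.
have h3 : \sum_(a <- l') var (eball a.1 a.2) / 4 <= var setT - T phi.
  apply: competitor => // a /sub /[dup] al' /lS[ba a2E].
  have [sp ss0 hA hd] := hS _ ba; rewrite a2E; split => //; split.
    apply: le_lt_trans hA; rewrite mulr_ge0 ?powR_ge0// mulr_ge0// ltW ?Aconst_gt0//.
  apply: (@good_scale_bound _ L) => //.
  by rewrite mulrC -ler_pdivlMr// ltW.
rewrite -/(T psi); apply: (le_trans h1); apply: (le_trans h2).
rewrite -mulr_sumr; rewrite -mulr_suml in h3.
move: h3; move: (\sum_(a <- l') _) => S' h3.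
have h4 : S' <= 4 * d by lra.
have -> : eps = 12 ^+ n * (4 * d).
  by rewrite /d; field; rewrite gt_eqF.
by rewrite ler_wpM2l// ltW.
Qed.

(** For a cutoff supported inside the ball, [eta phi] is a test field there and the Leibniz error is
    bounded uniformly in the cutoff. Both bounds pass to the indicator by dominated convergence. *)
Lemma var_indicator (x : rV) (r : R) : 0 < r ->
  (frac_var al (fun y => if `[< eball x r y >] then f y else 0%R) setT <=
   (var (eball x r) + C0 * M * r `^ gam)%:E)%E.
Proof.
move=> r0; apply: ub_ereal_sup => _ [phi tphi <-].
have nphi := test_nice tphi; have [sphi [K [cK _ K0]] b] := tphi.
pose chi (y : rV) : R := if `[< eball x r y >] then 1 else 0.
have -> : (fun y : rV => (if `[< eball x r y >] then f y else 0) * frac_div al phi y) =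
    (fun y => f y * chi y * frac_div al phi y).
  by apply/funext => y; rewrite /chi; case: ifP => _; rewrite ?mulr1// mulr0.
rewrite -/(pairing al (fun y => f y * chi y) phi).
(* Squared radii increasing to [r^2] from below: supports stay compact in the open ball, and at each
   point of the ball the cutoffs are eventually 1. *)
pose b_ (k : nat) : R := r ^+ 2 * (1 - k.+3%:R^-1).
pose a_ (k : nat) : R := r ^+ 2 * (1 - 2 * k.+3%:R^-1).
have r2 : 0 < r ^+ 2 by rewrite exprn_gt0.
have k3 (k : nat) : 0 < k.+3%:R^-1 :> R by rewrite invr_gt0.
have ab k : a_ k < b_ k.
  by rewrite /a_ /b_ ltr_pM2l//; have := k3 k; move: (k.+3%:R^-1) => u; lra.
have br k : b_ k < r ^+ 2.
  by rewrite /b_ gtr_pMr//; have := k3 k; move: (k.+3%:R^-1) => u; lra.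
pose eta k := cutoff x (a_ k) (b_ k).
have ceta k : continuous (eta k) by apply: ssmooth_continuous; exact: ssmooth_cutoff.
have eta01 k y : 0 <= eta k y <= 1 by rewrite cutoff_ge0 cutoff_le1.
have teta k : test_field (eball x r) (fun y => eta k y *: phi y).
  split.
  - by apply: smooth_scale => //; exact: ssmooth_cutoff.
  - exists [set y : rV | enorm (y - x) ^+ 2 <= b_ k]; split.
    + exact: compact_ecball.
    + move=> y /= yb; rewrite /eball /= -ltr_sqr ?nnegrE ?enorm_ge0 ?(ltW r0)//.
      exact: le_lt_trans yb (br k).
    + move=> y /negP; rewrite -ltNge => yb.
      by rewrite /eta /cutoff profile_eq0 ?scale0r// ltW.
  - move=> y; have /andP[e0 e1] := eta01 k y.
    by rewrite enormZ ger0_norm// mulr_ile1 ?enorm_ge0.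
have etachi y : eta ^~ y @ \oo --> chi y.
  apply: cvg_near_cst; rewrite /chi; case: asboolP => [yb|yb].
    have h0 : 0 < r ^+ 2 - enorm (y - x) ^+ 2.
      by rewrite subr_gt0 ltr_sqr ?nnegrE ?enorm_ge0 ?(ltW r0).
    exists (Num.truncn (2 * r ^+ 2 / (r ^+ 2 - enorm (y - x) ^+ 2))) => // k /= kN.
    apply: profile_eq1 => //.
    have hk : 2 * r ^+ 2 / (r ^+ 2 - enorm (y - x) ^+ 2) <= k.+3%:R.
      apply/ltW; apply: (lt_le_trans (truncnS_gt _)); rewrite ler_nat ltnS.
      by rewrite (leq_trans kN)// -addn2 leq_addr.
    rewrite ler_pdivrMr// in hk.
    have hu : 2 * r ^+ 2 * k.+3%:R^-1 <= r ^+ 2 - enorm (y - x) ^+ 2.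
      by rewrite ler_pdivrMr// [leRHS]mulrC.
    have -> : a_ k = r ^+ 2 - 2 * r ^+ 2 * k.+3%:R^-1 by rewrite /a_; ring.
    by rewrite lerBrDr -lerBrDl.
  exists 0%N => // k _; apply: profile_eq0 => //; apply: (le_trans (ltW (br k))).
  rewrite ler_sqr ?nnegrE ?enorm_ge0 ?(ltW r0)// leNgt; apply/negP => h; exact: yb.
have bound k : pairing al (fun y => f y * eta k y) phi <= var (eball x r) + C0 * M * r `^ gam.
  rewrite -lee_fin.
  apply: (le_trans (pairing_leibniz al01 q1 alq pq mf fin (ceta k) (eta01 k) nphi (test_nice (teta k)) b)).
  rewrite EFinD; apply: leeD; first by rewrite lee_fin; exact: pairing_le_varR.
  apply: (nonlocal_cutoff n0 al01 q1 alq pq mf fin) => //.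
  exact: ltW (br k).
have mchi : measurable_fun [set: rVb R n] chi.
  have -> : chi = \1_(eball x r).
    apply/funext => y; rewrite /chi indicE; case: asboolP => h; first by rewrite mem_set.
    by rewrite memNset.
  by apply: measurable_indic; apply: open_measurable_rV; exact: open_eball.
have chi01 y : 0 <= chi y <= 1 by rewrite /chi; case: ifP; rewrite ?lexx ?ler01.
have fle (g : rV -> R) : (forall y, 0 <= g y <= 1) -> forall y, `|f y * g y| <= `|f y|.
  by move=> g01 y; have /andP[g0 g1] := g01 y; rewrite normrM (ger0_norm g0) ler_piMr.
have meta k := continuous_measurable_rV (ceta k).
have mfe k : measurable_fun [set: rVb R n] (fun y => f y * eta k y) by exact: measurable_funM.
have mfc : measurable_fun [set: rVb R n] (fun y => f y * chi y) by exact: measurable_funM.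
have ik k := integrable_pairing al01 q1 alq pq mf fin (mfe k) (fle _ (eta01 k)) nphi.
have ic := integrable_pairing al01 q1 alq pq mf fin mfc (fle _ chi01) nphi.
have i0 := integrable_pairing al01 q1 alq pq mf fin mf (fun=> lexx _) nphi.
have mdiv := measurable_frac_div al01 nphi.
pose F (k : nat) (y : rVb R n) : \bar R := (f y * eta k y * frac_div al phi y)%:E.
pose F' (y : rVb R n) : \bar R := (f y * chi y * frac_div al phi y)%:E.
have lim : (\int[leb]_y F k y)%E @[k --> \oo] --> (\int[leb]_y F' y)%E.
  have mFk k : measurable_fun setT (F k).
    by apply/measurable_EFinP; exact: measurable_funM.
  have mF' : measurable_fun setT F' by apply/measurable_EFinP; exact: measurable_funM.
  pose G (y : rVb R n) : \bar R := (`|f y * frac_div al phi y|)%:E.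
  have iG : leb.-integrable setT G by exact: integrable_abse i0.
  have cv : {ae leb, forall y, setT y -> F ^~ y @ \oo --> F' y}.
    apply: aeW => y _; apply: cvg_EFin; first by near=> k.
    apply: cvgM; last exact: cvg_cst.
    by apply: cvgM; [exact: cvg_cst|exact: etachi].
  have dom : {ae leb, forall y k, setT y -> (`|F k y| <= G y)%E}.
    apply: aeW => y k _; rewrite /F /G abse_EFin lee_fin.
    have /andP[] := eta01 k y; move: (eta k y) (frac_div al phi y) => e w e0 e1.
    by rewrite mulrAC normrM (ger0_norm e0) ler_piMr.
  by have [] := dominated_convergence measurableT mFk mF' cv iG dom.
have -> : (pairing al (fun y => f y * chi y) phi)%:E = (\int[leb]_y F' y)%E.
  rewrite (pairingE al01 q1 alq pq mf fin mfc (fle _ chi01) nphi) /Rintegral.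
  by rewrite fineK; [|exact: (integrable_fin_num measurableT ic)].
rewrite -(cvg_lim _ lim)//; apply: lime_le; first exact: cvgP lim.
near=> k.
have -> : (\int[leb]_y F k y)%E = (pairing al (fun y => f y * eta k y) phi)%:E.
  rewrite (pairingE al01 q1 alq pq mf fin (mfe k) (fle _ (eta01 k)) nphi) /Rintegral.
  by rewrite fineK; [|exact: (integrable_fin_num measurableT (ik k))].
by rewrite lee_fin.
Unshelve. all: by end_near. Qed.

End Variation.

(** * Decay estimates *)

Theorem theorem4p3 (R : realType) (n : nat) (alpha : R) (p : \bar R) (q : R) :
  (1 <= n)%N -> 0 < alpha < 1 ->
  ((1 - alpha)^-1%:E < p)%E ->
  1 <= q ->
  (p = +oo%E /\ q = 1) \/ (exists p' : R, p = p'%:E /\ p'^-1 + q^-1 = 1) ->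
  exists A B : R, 0 < A /\ 0 < B /\
    forall f : 'rV[R]_n -> R, BValphap alpha p f ->
      var_ae alpha f (fun x =>
        exists rx : R, 0 < rx /\
          forall r : R, 0 < r < rx ->
            (frac_var alpha f (eball x r)
               <= A%:E * Lpnorm p f * (r `^ (n%:R / q - alpha))%:E)%E /\
            (frac_var alpha (fun y => if `[< eball x r y >] then f y else 0%R) setT
               <= B%:E * Lpnorm p f * (r `^ (n%:R / q - alpha))%:E)%E).
Proof.
move=> n0 al01 palpha q1 pq0; have /andP[a0 a1] := al01.
have b0 : 0 < (1 - alpha)^-1 by rewrite invr_gt0 subr_gt0.
have pq : (p = +oo%E /\ q = 1) \/
    (exists p' : R, [/\ p = p'%:E, 0 < p' & p'^-1 + q^-1 = 1]).
  case: pq0 => [h|[p' [pE h]]]; [by left|right; exists p'; split => //].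
  by move: palpha; rewrite pE lte_fin; exact: lt_trans.
(* The integrability threshold translated to the conjugate exponent. *)
have alq : alpha < q^-1.
  case: pq => [[_ ->]|[p' [pE p'0 h]]]; first by rewrite invr1.
  have : p'^-1 < 1 - alpha.
    by move: palpha; rewrite pE lte_fin => ?; rewrite -[ltRHS]invrK ltf_pV2 ?posrE.
  by move: h; move: (p'^-1) (q^-1) => u w; lra.
pose A := Aconst n alpha q; pose C := decay_const n alpha q.
have A0 : 0 < A by exact: Aconst_gt0.
have C0 : 0 <= C by exact: decay_const_ge0.
(* In the second constant, [A] accounts for the variation on the ball and [C] for the Leibniz
   error. *)
exists A, (A + C); split => //; split; first by rewrite ltr_wpDr.
move=> f [bf ffin bv].
have mf := measurable_borel_fun bf.
have ME : Lpnorm p f = (fine (Lpnorm p f))%:E.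
  by rewrite fineK// ge0_fin_numE//; exact: Lpnorm_ge0.
exists (bad alpha p q f); split; first exact: (bad_null n0 al01 q1 alq pq mf ffin bv).
move=> x nbad.
have [r0 [r00 hr0]] : exists r0 : R, 0 < r0 /\ forall r, 0 < r < r0 ->
    var alpha f (eball x r) <= A * fine (Lpnorm p f) * r `^ (n%:R / q - alpha).
  apply: contrapT => hno; apply: nbad => r0 r00; apply: contrapT => h; apply: hno.
  exists r0; split => // r hr; rewrite leNgt; apply/negP => h'; apply: h.
  by exists r.
exists r0; split => // r hr; have /andP[rp _] := hr.
rewrite ME -!EFinM; split.
  by rewrite (varE al01 q1 alq pq mf ffin bv) lee_fin; exact: hr0.
apply: (le_trans (var_indicator n0 al01 q1 alq pq mf ffin bv x rp)).
by rewrite lee_fin 2!mulrDl lerD2r hr0.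
Qed.
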